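(* Fix an admissible quadruple $(z,z',w,w')$. The family of probability measures $\{M_{z,z',w,w'\mid N}\}_{N\ge1}$ is coherent, i.e. for every $N\ge2$ and every $\lambda\in\mathbb S_{N-1}$, $$\sum_{\nu\in\mathbb S_N}M_{z,z',w,w'\mid N}(\nu)\,\Lambda^N_{N-1}(\nu,\lambda)=M_{z,z',w,w'\mid N-1}(\lambda).$$
   Context: Signatures and links: - $\mathbb S_N$ is the set of integer $N$-tuples $\nu_1\ge\dots\ge\nu_N$. - $\mathrm{Dim}_N\nu=\prod_{1\le i<j\le N}\frac{\nu_i-\nu_j-i+j}{j-i}$. - For $\lambda\in\mathbb S_{N-1}$ and $\nu\in\mathbb S_N$, write $\lambda\prec\nu$ if $\nu_i\ge\lambda_i\ge\nu_{i+1}$ for all $i$. - The link is $\Lambda^N_{N-1}(\nu,\lambda)=\mathrm{Dim}_{N-1}\lambda/\mathrm{Dim}_N\nu$ if $\lambda\prec\nu$, and $0$ otherwise. Admissibility: a quadruple $(z,z',w,w')\in\mathbb C^4$ is admissible if both of the following hold: - $(z+k)(z'+k)>0$ and $(w+k)(w'+k)>0$ for all $k\in\mathbb Z$; - $\mathrm{Re}(z+z'+w+w')>-1$. The zw-measures: $M_{z,z',w,w'\mid N}(\nu)=M'_{z,z',w,w'\mid N}(\nu)/C_{z,z',w,w'\mid N}$, where $$M'_{z,z',w,w'\mid N}(\nu)=\prod_{i=1}^N\frac{1}{\Gamma(z-\nu_i+i)\Gamma(z'-\nu_i+i)\Gamma(w+N+1+\nu_i-i)\Gamma(w'+N+1+\nu_i-i)}\,(\mathrm{Dim}_N\nu)^2$$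 and $$C_{z,z',w,w'\mid N}=\prod_{i=1}^N\frac{\Gamma(z+z'+w+w'+i)}{\Gamma(z+w+i)\Gamma(z+w'+i)\Gamma(z'+w+i)\Gamma(z'+w'+i)\Gamma(i)}.$$ This is a probability measure on $\mathbb S_N$. *)

(* Defs.v *)
From Stdlib Require Import Reals List ZArith Classical ClassicalEpsilon.
Import ListNotations.
Open Scope R_scope.

Definition Cx : Type := (R * R)%type.
Definition Cre (a : Cx) : R := fst a.
Definition Cim (a : Cx) : R := snd a.
Definition RtoC (x : R) : Cx := (x, 0).
Definition C0 : Cx := (0, 0).
Definition C1 : Cx := (1, 0).
Definition Cadd (a b : Cx) : Cx := (fst a + fst b, snd a + snd b).
Definition Copp (a : Cx) : Cx := (- fst a, - snd a).
Definition Csub (a b : Cx) : Cx := Cadd a (Copp b).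
Definition Cmul (a b : Cx) : Cx :=
  (fst a * fst b - snd a * snd b, fst a * snd b + snd a * fst b).
Definition Cnorm (a : Cx) : R := sqrt (fst a * fst a + snd a * snd a).
(* inverse; by convention Cinv 0 = 0 *)
Definition Cinv (a : Cx) : Cx :=
  let d := fst a * fst a + snd a * snd a in (fst a / d, - snd a / d).
Definition Cdiv (a b : Cx) : Cx := Cmul a (Cinv b).
Definition Cexp (a : Cx) : Cx := (exp (fst a) * cos (snd a), exp (fst a) * sin (snd a)).
Definition Cprod (l : list Cx) : Cx := fold_right Cmul C1 l.
Definition Csum (l : list Cx) : Cx := fold_right Cadd C0 l.

Definition C_cv (u : nat -> Cx) (l : Cx) : Prop :=
  forall eps, eps > 0 -> exists N0, forall n, (n >= N0)%nat -> Cnorm (Csub (u n) l) < eps.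

Definition Clim (u : nat -> Cx) : Cx :=
  epsilon (inhabits C0) (fun l => C_cv u l).

(** * Euler Gamma function on C.
    1/Gamma is defined by Gauss's limit formula
      1/Gamma(z) = lim_{n->oo} z (z+1) ... (z+n) / (n! n^z),
    valid for all complex z (1/Gamma is entire, zero at the poles of Gamma). *)
Definition rgamma_seq (z : Cx) (n : nat) : Cx :=
  Cdiv (Cprod (map (fun k => Cadd z (RtoC (INR k))) (seq 0 (S n))))
       (Cmul (RtoC (INR (fact n))) (Cexp (Cmul z (RtoC (ln (INR n)))))).
Definition rgamma (z : Cx) : Cx := Clim (rgamma_seq z).
Definition Gamma (z : Cx) : Cx := Cinv (rgamma z).

(** * Signatures: nonincreasing integer N-tuples, stored as lists of length N;
    the 1-based coordinate nu_i is  nth (i-1) nu 0. *)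
Definition sigc (nu : list Z) (i : nat) : Z := nth (i - 1) nu 0%Z.
Definition is_signature (N : nat) (nu : list Z) : Prop :=
  length nu = N /\ forall i, (1 <= i < N)%nat -> (sigc nu (S i) <= sigc nu i)%Z.

Definition Rprod (l : list R) : R := fold_right Rmult 1 l.

Definition Dim (N : nat) (nu : list Z) : R :=
  Rprod (map (fun i => Rprod (map (fun j =>
      (IZR (sigc nu i) - IZR (sigc nu j) - INR i + INR j) / (INR j - INR i))
    (seq (S i) (N - i)))) (seq 1 N)).

Definition interlaceb (N : nat) (lam nu : list Z) : bool :=
  forallb (fun i => andb (Z.leb (sigc lam i) (sigc nu i)) (Z.leb (sigc nu (S i)) (sigc lam i)))
          (seq 1 (N - 1)).

Definition Link (N : nat) (nu lam : list Z) : R :=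
  if interlaceb N lam nu then Dim (N - 1) lam / Dim N nu else 0.

Definition Cpos (c : Cx) : Prop := Cim c = 0 /\ Cre c > 0.
Definition admissible (z z' w w' : Cx) : Prop :=
  (forall k : Z, Cpos (Cmul (Cadd z (RtoC (IZR k))) (Cadd z' (RtoC (IZR k)))) /\
                 Cpos (Cmul (Cadd w (RtoC (IZR k))) (Cadd w' (RtoC (IZR k))))) /\
  Cre (Cadd (Cadd z z') (Cadd w w')) > -1.

Definition Mprime (z z' w w' : Cx) (N : nat) (nu : list Z) : Cx :=
  Cmul
    (Cprod (map (fun i =>
       let a := IZR (sigc nu i) in
       Cinv (Cprod [ Gamma (Cadd z (RtoC (- a + INR i)));
                     Gamma (Cadd z' (RtoC (- a + INR i)));
                     Gamma (Cadd w (RtoC (INR N + 1 + a - INR i)));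
                     Gamma (Cadd w' (RtoC (INR N + 1 + a - INR i))) ]))
     (seq 1 N)))
    (RtoC (Dim N nu * Dim N nu)).

Definition Cnorming (z z' w w' : Cx) (N : nat) : Cx :=
  Cprod (map (fun i =>
     let s := RtoC (INR i) in
     Cdiv (Gamma (Cadd (Cadd (Cadd z z') (Cadd w w')) s))
          (Cprod [ Gamma (Cadd (Cadd z w) s); Gamma (Cadd (Cadd z w') s);
                   Gamma (Cadd (Cadd z' w) s); Gamma (Cadd (Cadd z' w') s);
                   Gamma s ]))
   (seq 1 N)).

Definition Mzw (z z' w w' : Cx) (N : nat) (nu : list Z) : Cx :=
  Cdiv (Mprime z z' w w' N nu) (Cnorming z z' w w' N).

(** unconditional summation over a (countable) set P of signatures:
    the net of finite partial sums over finite subsets of P converges to s *)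
Definition has_sum (P : list Z -> Prop) (f : list Z -> Cx) (s : Cx) : Prop :=
  forall eps, eps > 0 ->
    exists F0 : list (list Z), (forall x, In x F0 -> P x) /\
      forall F : list (list Z), NoDup F -> (forall x, In x F -> P x) -> incl F0 F ->
        Cnorm (Csub (Csum (map f F)) s) < eps.

(* Main.v *)
(** In the coordinates [l_i = nu_i - i], the coherence relation is a sum of
    [prod_i f(l_i) * prod_(i<j) (l_i - l_j)] over [l_1 >= m_1 > l_2 >= m_2 > ... >= m_(N-1) > l_N],
    with [m_i = lambda_i - i] and with [f] a product of four reciprocal Gamma functions. Writing
    the Vandermonde product as a determinant of polynomials [p_0, ..., p_(N-1)] of degrees
    [0, ..., N-1], the sum becomes a determinant of one-variable sums of [f p_j] over disjoint
    intervals. If [h] is the analogue of [f] at level [N - 1], then [h(l+1) (l+1)^j - h(l) l^j] is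
    [f(l)] times a polynomial of degree [j + 1] whose leading coefficient does not vanish for
    [j <= N - 2]. Taking these polynomials as [p_1, ..., p_(N-1)], the sums telescope: after
    adding up rows, the last row of the determinant is [(D, 0, ..., 0)], where [D] is the sum of
    [f] over all integers, and the complementary minor is [prod_i h(m_i)] times the Vandermonde
    product of [m].

    The sum [D] is Dougall's bilateral [2H2] formula. Both sides of the formula satisfy the same
    first-order recurrence under [a -> a + 1], again by telescoping, so that their ratio is
    periodic in each of [a, b, c, d]. Let [a] and [c] tend to infinity together: by dominated
    convergence the limit of the ratio depends on [b] and [d] only, and for [a = c = 1] the sum
    has a single term, where the ratio is [1].

    Under admissibility all the terms are nonnegative reals, so that unconditional summability
    follows from convergence along an exhausting sequence of boxes. *)

From Coquelicot Require Import Coquelicot.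
From mathcomp Require all_boot all_fingroup all_algebra Rstruct ring.
From Stdlib Require Import Reals List ZArith Lra Lia Psatz FinFun.
Require Import Defs.
Import ListNotations.
Open Scope R_scope.

(** * Sums over integer intervals *)

(** With [N = n + 1], two relations drive the telescoping: h(l+1) = f(l) (l+1-z)(l+1-z') and h(l) =
    f(l) (w+N+l)(w'+N+l). Both quadratics are monic, so degree j+2 cancels and degree j+1 keeps the
    coefficient sigma + 2N - 2 - j, where sigma = z+z'+w+w'. The product of these coefficients over
    j <= N-2 is the Pochhammer symbol (sigma+N)_(N-1). Dougall's value contains Gamma(sigma+2N-1),
    which is that symbol times Gamma(sigma+N); this is how D becomes (N-1)! times the coefficients
    times C_N / C_(N-1).

    The determinant identity is proved on finite boxes, and the limit is then taken entry by entry.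

    In Dougall's sum, shifting [a] alone by n would multiply the l-th term, relative to the term l =
    0, by about n^l. Shifting [c] as well contributes n^(-l), which yields both a pointwise limit
    and a uniform bound.

    All the analysis concerns 1/Gamma. Gauss's approximants approach it with the relative error
    exp(K/n) - 1, and this one estimate gives convergence, the behaviour at infinity and the absence
    of zeros in the right half-plane. *)

Definition Rsum (l : list R) : R := fold_right Rplus 0 l.

(** Half-open, so that the ranges [m_(i+1), m_i) of consecutive particles concatenate without
    overlap. *)
Definition zrange (a b : Z) : list Z :=
  map (fun k => (a + Z.of_nat k)%Z) (seq 0 (Z.to_nat (b - a))).

Definition zsum (f : Z -> R) (a b : Z) : R := Rsum (map f (zrange a b)).

Lemma Rsum_app (l l' : list R) : Rsum (l ++ l') = Rsum l + Rsum l'.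
Proof. induction l as [|x l IH]; simpl; [ring|]. unfold Rsum in *; simpl. lra. Qed.

Lemma In_zrange (a b t : Z) : In t (zrange a b) <-> (a <= t < b)%Z.
Proof.
  unfold zrange. rewrite in_map_iff. split.
  - intros [k [<- Hk]]. apply in_seq in Hk. lia.
  - intros H. exists (Z.to_nat (t - a)). split; [lia|]. apply in_seq. lia.
Qed.

Lemma NoDup_zrange (a b : Z) : NoDup (zrange a b).
Proof.
  apply Injective_map_NoDup; [|apply seq_NoDup]. intros x y H. lia.
Qed.

Lemma zrange_split (a b c : Z) : (a <= b <= c)%Z -> zrange a c = zrange a b ++ zrange b c.
Proof.
  intros H. unfold zrange.
  replace (Z.to_nat (c - a)) with (Z.to_nat (b - a) + Z.to_nat (c - b))%nat by lia.
  rewrite seq_app, map_app. f_equal. simpl.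
  replace (seq (Z.to_nat (b - a)) (Z.to_nat (c - b))) with
    (map (fun k => (k + Z.to_nat (b - a))%nat) (seq 0 (Z.to_nat (c - b)))).
  - rewrite map_map. apply map_ext. intros k. lia.
  - generalize (Z.to_nat (b - a)) as s, (Z.to_nat (c - b)) as m. intros s m.
    rewrite (map_ext _ (fun k => (s + k)%nat)) by (intros; lia).
    induction m as [|m IH]; [reflexivity|].
    rewrite !seq_S, map_app, IH. reflexivity.
Qed.

Lemma zrange_succ (a b : Z) : (a <= b)%Z -> zrange a (b + 1) = zrange a b ++ [b].
Proof.
  intros H. rewrite (zrange_split a b (b + 1)) by lia. f_equal.
  unfold zrange. replace (Z.to_nat (b + 1 - b)) with 1%nat by lia. simpl. f_equal. lia.
Qed.

Lemma zsum_split (f : Z -> R) (a b c : Z) : (a <= b <= c)%Z -> zsum f a c = zsum f a b + zsum f b c.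
Proof. intros H. unfold zsum. now rewrite (zrange_split a b c), map_app, Rsum_app. Qed.

Lemma zsum_ext (f g : Z -> R) (a b : Z) : (forall l, f l = g l) -> zsum f a b = zsum g a b.
Proof. intros H. unfold zsum. f_equal. apply map_ext. exact H. Qed.

(** Passes from the coordinates nu_i, in which the boxes are written, to l_i = nu_i - i, in which
    the weights are. *)
Lemma zsum_shift (f : Z -> R) (a b s : Z) :
  Rsum (map (fun t => f (t - s)%Z) (zrange (a + s) (b + s))) = zsum f a b.
Proof.
  unfold zsum, zrange. rewrite !map_map. f_equal.
  replace (b + s - (a + s))%Z with (b - a)%Z by lia.
  apply map_ext. intros k. f_equal. lia.
Qed.

Lemma zsum_telescope (f g : Z -> R) (a b : Z) : (a <= b)%Z ->
  (forall l, f l = g (l + 1)%Z - g l) -> zsum f a b = g b - g a.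
Proof.
  intros H E. replace b with (a + Z.of_nat (Z.to_nat (b - a)))%Z by lia.
  generalize (Z.to_nat (b - a)) as k. induction k as [|k IH].
  - replace (a + Z.of_nat 0)%Z with a by lia.
    unfold zsum, zrange. rewrite Z.sub_diag. simpl. unfold Rsum; simpl. lra.
  - replace (a + Z.of_nat (S k))%Z with (a + Z.of_nat k + 1)%Z by lia.
    unfold zsum. rewrite zrange_succ by lia. rewrite map_app, Rsum_app.
    fold (zsum f a (a + Z.of_nat k)). rewrite IH. simpl. rewrite E. unfold Rsum; simpl. lra.
Qed.

Lemma zsum_ge0 (f : Z -> R) (a b : Z) : (forall l, 0 <= f l) -> 0 <= zsum f a b.
Proof.
  intros H. unfold zsum, Rsum. induction (zrange a b) as [|x l IH]; simpl; [lra|].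
  specialize (H x). lra.
Qed.

(** * Sums over boxes of interlacing signatures *)

(** The Cartesian product of the lists in [Is], each tuple stored as a list. *)
Fixpoint choices (T : Type) (Is : list (list T)) : list (list T) :=
  match Is with
  | nil => [nil]
  | J :: Is' => flat_map (fun t => map (cons t) (choices T Is')) J
  end.
Arguments choices {T} Is.

Definition vandermonde (n : nat) (v : nat -> R) : R :=
  Rprod (map (fun i => Rprod (map (fun j => v i - v j) (seq (S i) (n - S i)))) (seq 0 n)).

(* [l_(i+1)] ranges over [[cutoff (i+1), cutoff i)]; the two infinite end points are cut off at [K]. *)
Definition cutoff (n : nat) (m : nat -> Z) (K i : nat) : Z :=
  match i with
  | O => (Z.of_nat K + 1)%Z
  | S _ => if (i <=? n)%nat then m i else (- Z.of_nat K)%Z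
  end.

(* In terms of [nu_(i+1) = l_(i+1) + (i+1)]. *)
Definition box (n : nat) (m : nat -> Z) (K : nat) : list (list Z) :=
  choices (map (fun i => zrange (cutoff n m K (S i) + Z.of_nat (S i))
                                (cutoff n m K i + Z.of_nat (S i))) (seq 0 (S n))).

Lemma chain_le (b : nat -> Z) (i : nat) :
  (forall k, (k <= i)%nat -> (b (S k) <= b k)%Z) -> forall k, (k <= S i)%nat -> (b k <= b 0%nat)%Z.
Proof.
  intros H. induction k as [|k IH]; intros Hk; [lia|]. specialize (H k ltac:(lia)).
  specialize (IH ltac:(lia)). lia.
Qed.

(** Adding up the first rows of the determinant glues the ranges of the first particles into a
    single interval reaching up to the top cut-off. *)
Lemma zsum_chain (g : Z -> R) (b : nat -> Z) (i : nat) :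
  (forall k, (k <= i)%nat -> (b (S k) <= b k)%Z) ->
  Rsum (map (fun k => zsum g (b (S k)) (b k)) (seq 0 (S i))) = zsum g (b (S i)) (b 0%nat).
Proof.
  induction i as [|i IH]; intros H.
  - unfold Rsum; simpl. ring.
  - pose proof (chain_le b (S i) H) as Hm.
    rewrite seq_S, map_app, Rsum_app, IH by (intros k Hk; apply H; lia). simpl plus.
    rewrite (zsum_split g (b (S (S i))) (b (S i)) (b 0%nat)).
    + unfold Rsum; simpl. ring.
    + split; [apply H|apply Hm]; lia.
Qed.

(** Only the two ends depend on [K]; they lie beyond the given points once [K] exceeds both |m 1|
    and |m n|. *)
Lemma cutoff_decreasing (n : nat) (m : nat -> Z) :
  (forall i, (1 <= i < n)%nat -> (m (S i) <= m i)%Z) ->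
  exists K0, forall K, (K >= K0)%nat ->
  forall k, (k <= n)%nat -> (cutoff n m K (S k) <= cutoff n m K k)%Z.
Proof.
  intros Hm.
  exists (Z.to_nat (Z.abs (m 1%nat) + Z.abs (m n))). intros K HK [|k] Hk; unfold cutoff.
  - destruct (Nat.leb_spec 1 n); lia.
  - destruct (Nat.leb_spec (S (S k)) n), (Nat.leb_spec (S k) n); try lia.
    + apply Hm; lia.
    + replace (S k) with n by lia. lia.
Qed.

(** * Determinants of sums, and the telescoping polynomials *)

Module MinorSums.
Import all_boot all_fingroup all_algebra.
Import GRing.Theory.
Local Open Scope ring_scope.
Set Implicit Arguments.
Unset Strict Implicit.
Unset Printing Implicit Defensive.

Section Ring.
Variable F : comNzRingType.

Lemma sum_flat_map (T U : Type) (g : T -> seq U) (h : U -> F) (J : seq T) :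
  \sum_(y <- flat_map g J) h y = \sum_(t <- J) \sum_(y <- g t) h y.
Proof.
elim: J => [|t J IH] /=; first by rewrite !big_nil.
by rewrite big_cat /= IH big_cons.
Qed.

Lemma sum_choices_prod (T : Type) (x0 : T) (Is : seq (seq T)) (a : nat -> T -> F) :
  \sum_(x <- choices Is) \prod_(i < size Is) a i (nth x0 x i) =
  \prod_(i < size Is) \sum_(t <- nth [::] Is i) a i t.
Proof.
elim: Is a => [|J Is IH] a; first by rewrite /= big_seq1 !big_ord0.
rewrite [choices _]/= sum_flat_map [RHS]big_ord_recl mulr_suml.
apply: eq_bigr => t _; rewrite -[List.map _ _]/(map _ _) big_map.
have <- := IH (fun i => a i.+1); rewrite mulr_sumr.
by apply: eq_bigr => x _; rewrite big_ord_recl.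
Qed.

(** Coordinate i of the tuple occurs in row i alone, so each product of the Leibniz expansion can be
    summed one row at a time. *)
Lemma sum_choices_det (T : Type) (x0 : T) (Is : seq (seq T)) n (a : nat -> nat -> T -> F) :
  size Is = n ->
  \sum_(x <- choices Is) \det (\matrix_(i < n, j < n) a i j (nth x0 x i)) =
  \det (\matrix_(i < n, j < n) \sum_(t <- nth [::] Is i) a i j t).
Proof.
move=> <-; rewrite /determinant exchange_big /=; apply: eq_bigr => s _.
rewrite -mulr_sumr; congr (_ * _).
(* A permutation acts on ordinals, whereas [sum_choices_prod] takes factors indexed by [nat]; the
   family is extended by 0 outside the range. *)
pose b i t := if (insub i : option 'I_(size Is)) is Some i' then a i (s i') t else 0 : F.
have bE (i : 'I_(size Is)) t : b i t = a i (s i) t by rewrite /b valK.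
transitivity (\prod_(i < size Is) \sum_(t <- nth [::] Is i) b i t).
  rewrite -(sum_choices_prod x0); apply: eq_bigr => x _.
  by apply: eq_bigr => i _; rewrite mxE bE.
by apply: eq_bigr => i _; rewrite mxE; apply: eq_bigr => t _; rewrite bE.
Qed.

(** The coefficients of polynomials with [size (p j) <= j.+1] form a triangular matrix, which takes
    the monomial Vandermonde matrix to this one up to transposition. *)
Lemma det_poly_rows n (x : 'I_n -> F) (p : nat -> {poly F}) :
  (forall j, (size (p j) <= j.+1)%N) ->
  \det (\matrix_(i < n, j < n) (p j).[x i]) =
  (\prod_(j < n) (p j)`_j) * \prod_(i < n) \prod_(j < n | (i < j)%N) (x j - x i).
Proof.
move=> sp; pose U := \matrix_(j < n, k < n) (p j)`_k.
have -> : \matrix_(i < n, j < n) (p j).[x i] = (U *m Vandermonde n (\row_i x i))^T.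
  apply/matrixP => i j; rewrite !mxE (horner_coef_wide _ (leq_trans (sp j) (ltn_ord j))).
  by apply: eq_bigr => k _; rewrite !mxE.
rewrite det_tr det_mulmx det_Vandermonde det_trig.
  congr (_ * _); first by apply: eq_bigr => j _; rewrite mxE.
  by apply: eq_bigr => i _; apply: eq_bigr => j _; rewrite !mxE.
apply/is_trig_mxP => j k jk; rewrite mxE nth_default //.
exact: leq_trans (sp j) jk.
Qed.

Lemma det_scale_rows n (d : 'I_n -> F) (A : 'M[F]_n) :
  \det (\matrix_(i, j) (d i * A i j)) = (\prod_i d i) * \det A.
Proof.
rewrite -[X in _ = X * _](_ : \det (diag_mx (\row_i d i)) = _); last first.
  by rewrite det_diag; apply: eq_bigr => i _; rewrite mxE.
rewrite -det_mulmx; congr (\det _); apply/matrixP => i j.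
by rewrite mul_diag_mx !mxE.
Qed.

(** Replacing the rows by their partial sums is multiplication by a lower unitriangular matrix. *)
Lemma det_cumulative n (A : 'M[F]_n) :
  \det (\matrix_(i < n, j < n) \sum_(k < n | (k <= i)%N) A k j) = \det A.
Proof.
pose L := \matrix_(i < n, k < n) (if (k <= i)%N then 1 else 0 : F).
have -> : \matrix_(i < n, j < n) \sum_(k < n | (k <= i)%N) A k j = L *m A.
  apply/matrixP => i j; rewrite !mxE big_mkcond; apply: eq_bigr => k _.
  by rewrite mxE; case: ifP; rewrite ?mul1r ?mul0r.
rewrite det_mulmx det_trig ?big1 ?mul1r // => [i _|]; first by rewrite mxE leqnn.
by apply/is_trig_mxP => i k ik; rewrite mxE leqNgt ik.
Qed.

(** For a fixed tuple, the leading coefficients times the Vandermonde product form the determinant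
    of the values of the [p j], and the weights scale its rows. The sum over tuples then moves into
    the rows. The leading coefficients stay on the left because a ring offers no division. *)
Lemma sum_choices_vandermonde (T : Type) (x0 : T) (Is : seq (seq T)) n
    (f v : nat -> T -> F) (p : nat -> {poly F}) :
  size Is = n -> (forall j, (size (p j) <= j.+1)%N) ->
  (\prod_(j < n) (p j)`_j) *
    \sum_(x <- choices Is) (\prod_(i < n) f i (nth x0 x i)) *
      \prod_(i < n) \prod_(j < n | (i < j)%N) (v j (nth x0 x j) - v i (nth x0 x i)) =
  \det (\matrix_(i < n, j < n)
     \sum_(k < n | (k <= i)%N) \sum_(t <- nth [::] Is k) f k t * (p j).[v k t]).
Proof.
move=> sIs sp; pose A := \matrix_(k < n, j < n) \sum_(t <- nth [::] Is k) f k t * (p j).[v k t].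
have -> : \matrix_(i < n, j < n)
    \sum_(k < n | (k <= i)%N) \sum_(t <- nth [::] Is k) f k t * (p j).[v k t] =
  \matrix_(i < n, j < n) \sum_(k < n | (k <= i)%N) A k j.
  by apply/matrixP => i j; rewrite !mxE; apply: eq_bigr => k _; rewrite mxE.
rewrite det_cumulative -(sum_choices_det x0 (fun k j t => f k t * (p j).[v k t]) sIs).
rewrite mulr_sumr; apply: eq_bigr => x _.
rewrite mulrCA -(det_poly_rows (fun i : 'I_n => v i (nth x0 x i)) sp) -det_scale_rows.
by congr (\det _); apply/matrixP => i j; rewrite !mxE.
Qed.

(** The subleading coefficient is read off [P * 'X], so that j = 0 needs no separate index. It is
    the source of the term - j in [kappa]. *)
Lemma coef_X_sub1_exp j (P := ('X - 1 : {poly F}) ^+ j) :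
  [/\ forall k, (j < k)%N -> P`_k = 0, P`_j = 1 & (P * 'X)`_j = - j%:R].
Proof.
rewrite {}/P; elim: j => [|j [IH1 IH2 IH3]].
  rewrite expr0; split; last by rewrite coefMX oppr0.
    by move=> [|k] // _; rewrite coef1.
  by rewrite coef1.
have E k : (('X - 1 : {poly F}) ^+ j.+1)`_k = (('X - 1) ^+ j * 'X)`_k - (('X - 1) ^+ j)`_k.
  by rewrite exprSr mulrBr mulr1 coefB.
split.
- by move=> [|k] // jk; rewrite E coefMX /= !IH1 ?subr0 //; apply: ltn_trans jk.
- by rewrite E coefMX /= IH2 IH1 ?subr0.
- by rewrite coefMX /= E IH3 IH2 -opprD -natr1.
Qed.

Lemma coef_mul_quadratic (P : {poly F}) (a b : F) k :
  (P * ('X * 'X + a *: 'X + b%:P))`_k = (P * 'X * 'X)`_k + a * (P * 'X)`_k + b * P`_k.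
Proof.
by rewrite !mulrDr mulrA -scalerAr [P * _%:P]mulrC !coefD coefZ coefCM.
Qed.

(** The factor of f(l) in g_j(l+1) - g_j(l), for g_j(l) = h(l) y^j with y = -l. Passing from l to
    l+1 turns y into y - 1, and the two quadratics are the factors of f(l) in h(l+1) and in h(l). *)
Definition bracket (a b a' b' : F) j : {poly F} :=
  ('X - 1) ^+ j * ('X * 'X + a *: 'X + b%:P) - 'X^j * ('X * 'X + a' *: 'X + b'%:P).

Lemma horner_bracket (a b a' b' : F) j y :
  (bracket a b a' b' j).[y] =
  (y - 1) ^+ j * (y * y + a * y + b) - y ^+ j * (y * y + a' * y + b').
Proof. by rewrite /bracket !hornerE. Qed.

(** Both products are monic of degree j + 2, so their leading terms cancel. *)
Lemma size_bracket (a b a' b' : F) j : (size (bracket a b a' b' j) <= j.+2)%N.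
Proof.
have [P1 P2 P3] := coef_X_sub1_exp j.
apply/leq_sizeP => k jk; rewrite coefB !coef_mul_quadratic.
case: k jk => [|[|k]] //; rewrite !ltnS => jk.
rewrite !coefMX /= !coefXn.
case: (ltngtP j k) jk => // [jk _|<- _].
  have jk1 : (j < k.+1)%N by apply: ltnW.
  have jk2 : (j < k.+2)%N by apply: ltnW.
  by rewrite !P1 // !gtn_eqF // !mulr0 !addr0 subrr.
by rewrite P2 !P1 // ?eqxx !gtn_eqF // !mulr0 !addr0 subrr.
Qed.

(** The first product contributes a - j in degree j + 1, the second one a'. *)
Lemma coef_bracket (a b a' b' : F) j : (bracket a b a' b' j)`_j.+1 = a - a' - j%:R.
Proof.
have [P1 P2 P3] := coef_X_sub1_exp j.
rewrite coefB !coef_mul_quadratic ![(_ * 'X)`_j.+1]coefMX /= P3 P2 P1 //.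
have -> : ('X^j * 'X : {poly F})`_j = 0.
  by rewrite coefMX; case: (j) => [|k] //=; rewrite coefXn ltn_eqF.
rewrite !coefXn eqxx gtn_eqF // !mulr0 !addr0 !mulr1 add0r.
by rewrite -addrA addrC.
Qed.

(** The sign (-1)^n of the cofactor in the lower left corner cancels against det(-A) = (-1)^n det
    A. *)
Lemma det_last_row n (D : F) (B : 'M[F]_n.+1) (A : 'M[F]_n) :
  B ord_max 0 = D -> (forall j, B ord_max (lift 0 j) = 0) ->
  (forall i j, B (lift ord_max i) (lift 0 j) = - A i j) ->
  \det B = D * \det A.
Proof.
move=> B0 Bj Bij; rewrite (expand_det_row _ ord_max) big_ord_recl B0 big1 ?addr0; last first.
  by move=> j _; rewrite Bj mul0r.
congr (_ * _); rewrite /cofactor addn0.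
have -> : row' ord_max (col' 0 B) = - A.
  by apply/matrixP => i j; rewrite !mxE Bij.
by rewrite -scaleN1r detZ mulrA -exprD addnn -muln2 mulnC exprM sqrrN !expr1n mul1r.
Qed.

End Ring.
End MinorSums.

(** * The box sums as determinants, and their limit *)

Module MinorLimits.
Import all_boot all_fingroup all_algebra Rstruct ring.
Import Lim_seq Rbar.
Import GRing.Theory.
Import MinorSums.
Local Open Scope ring_scope.
Set Implicit Arguments.
Unset Strict Implicit.
Unset Printing Implicit Defensive.

Local Notation R := Rdefinitions.R.

Lemma lim_sum (J : Type) (r : seq J) (u : J -> nat -> R) (l : J -> R) :
  (forall i, is_lim_seq (u i) (l i)) ->
  is_lim_seq (fun K => \sum_(i <- r) u i K) (\sum_(i <- r) l i).
Proof.
move=> ul; elim: r => [|i r IH].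
  apply: (is_lim_seq_ext (fun _ => 0)); first by move=> K; rewrite big_nil.
  by rewrite big_nil; apply: is_lim_seq_const.
apply: (is_lim_seq_ext (fun K => u i K + \sum_(j <- r) u j K)).
  by move=> K; rewrite big_cons.
by rewrite big_cons; apply: is_lim_seq_plus'.
Qed.

Lemma lim_prod (J : Type) (r : seq J) (u : J -> nat -> R) (l : J -> R) :
  (forall i, is_lim_seq (u i) (l i)) ->
  is_lim_seq (fun K => \prod_(i <- r) u i K) (\prod_(i <- r) l i).
Proof.
move=> ul; elim: r => [|i r IH].
  apply: (is_lim_seq_ext (fun _ => 1)); first by move=> K; rewrite big_nil.
  by rewrite big_nil; apply: is_lim_seq_const.
apply: (is_lim_seq_ext (fun K => u i K * \prod_(j <- r) u j K)).
  by move=> K; rewrite big_cons.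
by rewrite big_cons; apply: is_lim_seq_mult'.
Qed.

Lemma lim_det n (A : nat -> 'M[R]_n) (B : 'M[R]_n) :
  (forall i j, is_lim_seq (fun K => A K i j) (B i j)) ->
  is_lim_seq (fun K => \det (A K)) (\det B).
Proof.
move=> AB; apply: lim_sum => s; apply: is_lim_seq_mult'; first exact: is_lim_seq_const.
by apply: lim_prod.
Qed.

Lemma seqE a n : List.seq a n = iota a n.
Proof. by elim: n a => //= n IH a; rewrite IH. Qed.

Lemma Rsum_map (J : Type) (g : J -> R) (s : seq J) : Rsum (List.map g s) = \sum_(x <- s) g x.
Proof. by elim: s => [|x s IH]; rewrite ?big_nil ?big_cons //= -IH. Qed.

Lemma Rprod_map (J : Type) (g : J -> R) (s : seq J) : Rprod (List.map g s) = \prod_(x <- s) g x.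
Proof. by elim: s => [|x s IH]; rewrite ?big_nil ?big_cons //= -IH. Qed.

Lemma Rprod_seq0 (g : nat -> R) n : Rprod (List.map g (List.seq 0 n)) = \prod_(i < n) g i.
Proof. by rewrite Rprod_map seqE -[n in iota 0 n]subn0 big_mkord. Qed.

Lemma Rsum_seq0 (g : nat -> R) n : Rsum (List.map g (List.seq 0 n)) = \sum_(i < n) g i.
Proof. by rewrite Rsum_map seqE -[n in iota 0 n]subn0 big_mkord. Qed.

Lemma Rprod_seq_gt (g : nat -> R) i n :
  Rprod (List.map g (List.seq i.+1 (n - i.+1))) = \prod_(j < n | (i < j)%N) g j.
Proof. by rewrite Rprod_map seqE -/(index_iota _ _) big_geq_mkord. Qed.

Lemma List_nthE (T : Type) (x0 : T) (s : seq T) i : List.nth i s x0 = nth x0 s i.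
Proof. by elim: s i => [|x s IH] [|i] //=. Qed.

Lemma vandermondeE n v : vandermonde n v = \prod_(i < n) \prod_(j < n | (i < j)%N) (v i - v j).
Proof. by rewrite /vandermonde Rprod_seq0; apply: eq_bigr => i _; rewrite Rprod_seq_gt. Qed.


(* Polynomials are evaluated at [- l]: their Vandermonde determinant then has the factors
   [l_i - l_j], [i < j], of the dimension, with no sign left over. *)
Section Limit.
Variables (n : nat) (f h : Z -> R) (e1 e2 d1 d2 D : R) (m : nat -> Z).

(** The leading coefficient of [poly_row j.+1]. In the application e1 = z+z', d1 = w+w' and n+1 = N,
    so it equals z+z'+w+w'+2N-2-j. *)
Let kappa (j : nat) := e1 + d1 + (n.+1)%:R *+ 2 - 2%:R - j%:R.
(** The constant row 0 gives the column of plain sums of [f], among them [D]; row j+1 is the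
    polynomial that makes the sums telescope to [g j]. *)
Let poly_row j : {poly R} :=
  if j is j'.+1 then
    bracket (e1 - 2%:R) (1 - e1 + e2) (- ((n.+1)%:R *+ 2 + d1))
      ((n.+1)%:R ^+ 2 + d1 * (n.+1)%:R + d2) j'
  else 1.

Hypothesis Hup : forall l y, y = - IZR l ->
  h (Z.add l 1) = f l * ((1 - y) ^+ 2 - e1 * (1 - y) + e2).
Hypothesis Hdn : forall l y, y = - IZR l ->
  h l = f l * (((n.+1)%:R - y) ^+ 2 + d1 * ((n.+1)%:R - y) + d2).

Let g (j : nat) (l : Z) := h l * (- IZR l) ^+ j.

Lemma telescoping_row j l : f l * (poly_row j.+1).[- IZR l] = g j (Z.add l 1) - g j l.
Proof.
rewrite /g horner_bracket (Hup (erefl _)) (Hdn (erefl _)).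
have -> : - IZR (Z.add l 1) = - IZR l - 1 by rewrite plus_IZR -opprD.
move: (- IZR l) => y; move: (_ ^+ j) (_ ^+ j) => u v; ring.
Qed.

Hypothesis Hm : forall i, (0 < i < n)%N -> Z.le (m i.+1) (m i).
Hypothesis Hright : forall j, (j < n)%N -> is_lim_seq (fun K => g j (Z.add (Z.of_nat K) 1)) (Finite R0).
Hypothesis Hleft : forall j, (j < n)%N -> is_lim_seq (fun K => g j (Z.opp (Z.of_nat K))) (Finite R0).
Hypothesis Htail : forall a, ex_finite_lim_seq (fun K => zsum f a (Z.add (Z.of_nat K) 1)).
Hypothesis HD :
  is_lim_seq (fun K => zsum f (Z.opp (Z.of_nat K)) (Z.add (Z.of_nat K) 1)) D.

Let entry (j : nat) (l : Z) := f l * (poly_row j).[- IZR l].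
Let partial_matrix K := \matrix_(i < n.+1, j < n.+1)
  zsum (entry j) (cutoff n m K i.+1) (Z.add (Z.of_nat K) 1).

Lemma size_poly_row j : (size (poly_row j) <= j.+1)%N.
Proof. by case: j => [|j]; [rewrite size_poly1|apply: size_bracket]. Qed.

Lemma prod_coef_poly_row : \prod_(j < n.+1) (poly_row j)`_j = \prod_(j < n) kappa j.
Proof.
rewrite big_ord_recl coef1 mul1r; apply: eq_bigr => j _.
by rewrite lift0 coef_bracket /kappa; ring.
Qed.

Lemma cutoff_chain : exists K0, forall K, (K0 <= K)%N ->
  forall k, (k <= n)%N -> Z.le (cutoff n m K k.+1) (cutoff n m K k).
Proof.
have [|K0 HK0] := @cutoff_decreasing n m.
  by move=> i [/leP i1 /leP i2]; apply: Hm; rewrite i1 i2.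
by exists K0 => K /leP K0K k /leP kn; apply: HK0.
Qed.

(** The Vandermonde product enters to the first power: of the two factors Dim nu in the measure, the
    link cancels one. *)
Definition interlacing_weight (x : list Z) : R :=
  Rmult (Rprod (List.map (fun i => f (Z.sub (List.nth i x Z0) (Z.of_nat i.+1))) (List.seq 0 n.+1)))
    (vandermonde n.+1 (fun i => IZR (Z.sub (List.nth i x Z0) (Z.of_nat i.+1)))).

Lemma box_sum_det K :
  (forall k, (k <= n)%N -> Z.le (cutoff n m K k.+1) (cutoff n m K k)) ->
  (\prod_(j < n) kappa j) * Rsum (List.map interlacing_weight (box n m K)) =
  \det (partial_matrix K).
Proof.
move=> Hb; rewrite -prod_coef_poly_row Rsum_map.
pose fi (i : nat) t := f (Z.sub t (Z.of_nat i.+1)).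
pose vi (i : nat) t := - IZR (Z.sub t (Z.of_nat i.+1)).
pose Is := [seq zrange (Z.add (cutoff n m K i.+1) (Z.of_nat i.+1))
                       (Z.add (cutoff n m K i) (Z.of_nat i.+1)) | i <- iota 0 n.+1].
have sIs : size Is = n.+1 by rewrite size_map size_iota.
rewrite [box n m K](_ : _ = choices Is); last by rewrite /Is -seqE.
transitivity ((\prod_(j < n.+1) (poly_row j)`_j) *
    \sum_(x <- choices Is) (\prod_(i < n.+1) fi i (nth Z0 x i)) *
      \prod_(i < n.+1) \prod_(j < n.+1 | (i < j)%N) (vi j (nth Z0 x j) - vi i (nth Z0 x i))).
  congr (_ * _); apply: eq_bigr => x _; rewrite /interlacing_weight Rprod_seq0 vandermondeE.
  congr (_ * _); first by apply: eq_bigr => i _; rewrite List_nthE.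
  apply: eq_bigr => i _; apply: eq_bigr => j _; rewrite !List_nthE /vi opprK addrC //.
rewrite (sum_choices_vandermonde Z0 fi vi sIs size_poly_row); congr (\det _).
apply/matrixP => i j; rewrite !mxE.
(* The top end K + 1 is [cutoff] at 0, so the single sum in row i of [partial_matrix] splits back
   into the ranges of particles 0 to i. *)
rewrite -[Z.add _ _]/(cutoff n m K 0) -zsum_chain; last first.
  by move=> k /leP ki; apply: Hb; apply: leq_trans ki _; rewrite -ltnS.
rewrite Rsum_seq0 (big_ord_widen n.+1
  (fun k => zsum (entry j) (cutoff n m K k.+1) (cutoff n m K k))) //; apply: eq_bigr => k ki.
rewrite (nth_map 0%N) ?size_iota // nth_iota // add0n.
by rewrite -(@zsum_shift _ _ _ (Z.of_nat k.+1)) Rsum_map.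
Qed.

(** The boundary terms at the cut-offs K + 1 and - K vanish in the limit: the rows i < n keep the
    one at m_(i+1), the last row keeps none. Column 0 above the last row just has to converge, since
    the expansion along the last row strikes it out; hence [Lim_seq] may name its value. *)
Let limit_matrix := \matrix_(i < n.+1, j < n.+1)
  (if (i < n)%N then
     (if j == 0%N :> nat then real (Lim_seq (fun K => zsum f (m i.+1) (Z.add (Z.of_nat K) 1)))
      else - g j.-1 (m i.+1))
   else if j == 0%N :> nat then D else 0).

Lemma partial_matrix_cv i j :
  is_lim_seq (fun K => partial_matrix K i j) (limit_matrix i j).
Proof.
have [K0 HK0] := cutoff_chain.
have entry0 a b : zsum (entry 0) a b = zsum f a b.
  by apply: zsum_ext => l; rewrite /entry hornerC mulr1.
have entryS j' a b : Z.le a b -> zsum (entry j'.+1) a b = g j' b - g j' a.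
  by move=> ab; apply: zsum_telescope => // l; apply: telescoping_row.
have le_top K k : (K0 <= K)%N -> (k <= n)%N -> Z.le (cutoff n m K k.+1) (Z.add (Z.of_nat K) 1).
  move=> KK kn; apply: (@chain_le (cutoff n m K) n); last by apply/leP.
  by move=> k' /leP; apply: HK0.
have in1 : (i <= n)%N by rewrite -ltnS.
rewrite [limit_matrix i j]mxE.
apply: (is_lim_seq_ext (fun K => zsum (entry j) (cutoff n m K i.+1) (Z.add (Z.of_nat K) 1))).
  by move=> K; rewrite mxE.
case: ltnP => i_n.
  have bE K : cutoff n m K i.+1 = m i.+1.
    by rewrite /cutoff; case: Nat.leb_spec => // /ltP; rewrite ltnNge i_n.
  case: (posnP j) => [->|j0].
    apply: (is_lim_seq_ext (fun K => zsum f (m i.+1) (Z.add (Z.of_nat K) 1))).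
      by move=> K; rewrite entry0 bE.
    by apply: Lim_seq_correct'; apply: Htail.
  apply: (is_lim_seq_ext_loc (fun K => g j.-1 (Z.add (Z.of_nat K) 1) - g j.-1 (m i.+1))).
    exists K0 => K /leP KK; rewrite -{3}(prednK j0) entryS ?bE //.
    by have := le_top K i KK in1; rewrite bE.
  have jn : (j.-1 < n)%N by rewrite -ltnS prednK.
  have := is_lim_seq_minus' _ _ _ _ (Hright jn) (is_lim_seq_const (g j.-1 (m i.+1))).
  by have -> : Rminus R0 (g j.-1 (m i.+1)) = - g j.-1 (m i.+1) by exact: sub0r.
have bE K : cutoff n m K i.+1 = Z.opp (Z.of_nat K).
  by rewrite /cutoff; case: Nat.leb_spec => // /leP; rewrite ltnNge i_n.
case: (posnP j) => [->|j0].
  by apply: is_lim_seq_ext HD => K; rewrite entry0 bE.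
apply: (is_lim_seq_ext_loc (fun K => g j.-1 (Z.add (Z.of_nat K) 1) - g j.-1 (Z.opp (Z.of_nat K)))).
  exists K0 => K /leP KK; rewrite -{3}(prednK j0) entryS ?bE //.
  by have := le_top K i KK in1; rewrite bE.
have jn : (j.-1 < n)%N by rewrite -ltnS prednK.
have := is_lim_seq_minus' _ _ _ _ (Hright jn) (Hleft jn).
by have -> : Rminus R0 R0 = R0 by exact: subr0.
Qed.

(** The minor left by the last row has the rows h(m_i) (1, y, y^2, ...) with y = - m_i, a row-scaled
    Vandermonde matrix. *)
Lemma det_limit_matrix :
  \det limit_matrix = D * ((\prod_(i < n) h (m i.+1)) * vandermonde n (fun i => IZR (m i.+1))).
Proof.
rewrite (@det_last_row _ _ D _ (\matrix_(i < n, j < n) (h (m i.+1) * (- IZR (m i.+1)) ^+ j))).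
- pose A := \matrix_(i < n, j < n) ('X^j : {poly R}).[- IZR (m i.+1)].
  rewrite (_ : \matrix_(i, j) _ = \matrix_(i < n, j < n) (h (m i.+1) * A i j)); last first.
    by apply/matrixP => i j; rewrite !mxE hornerXn.
  rewrite det_scale_rows (det_poly_rows (fun i : 'I_n => - IZR (m i.+1)) (p := fun j => 'X^j)).
    have -> : \prod_(j < n) ('X^j : {poly R})`_j = 1.
      by apply: big1 => j _; rewrite coefXn eqxx.
    rewrite mul1r vandermondeE; congr (_ * (_ * _)); apply: eq_bigr => i _; apply: eq_bigr => j _.
    by rewrite opprK addrC.
  by move=> j; rewrite size_polyXn.
- by rewrite mxE ltnn.
- by move=> j; rewrite mxE ltnn.
- by move=> i j; rewrite !mxE lift_max ltn_ord lift0.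
Qed.

Definition limit_value :=
  D * ((\prod_(i < n) h (m i.+1)) * vandermonde n (fun i => IZR (m i.+1))).

Lemma lim_box_sum :
  is_lim_seq (fun K => (\prod_(j < n) kappa j) * Rsum (List.map interlacing_weight (box n m K)))
    (Finite limit_value).
Proof.
have [K0 HK0] := cutoff_chain.
rewrite /limit_value -det_limit_matrix.
apply: (is_lim_seq_ext_loc (fun K => \det (partial_matrix K))).
  by exists K0 => K /leP KK; rewrite box_sum_det //; apply: HK0.
exact/lim_det/partial_matrix_cv.
Qed.

End Limit.
Local Close Scope ring_scope.
Local Open Scope R_scope.

(** The interface to the analytic part: the same limit, with the quadratics written in l and with
    the powers and casts of the standard reals. *)
Theorem lim_box_sum_R (n : nat) (f h : Z -> R) (e1 e2 d1 d2 D : R) (m : nat -> Z) :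
  (forall l : Z, h (Z.add l 1) = f l * ((1 + IZR l) * (1 + IZR l) - e1 * (1 + IZR l) + e2)) ->
  (forall l : Z, h l = f l * ((INR (S n) + IZR l) * (INR (S n) + IZR l) + d1 * (INR (S n) + IZR l) + d2)) ->
  (forall i : nat, lt 0 i -> lt i n -> Z.le (m (S i)) (m i)) ->
  (forall j : nat, lt j n ->
     is_lim_seq (fun K => h (Z.add (Z.of_nat K) 1) * pow (- IZR (Z.add (Z.of_nat K) 1)) j) 0) ->
  (forall j : nat, lt j n ->
     is_lim_seq (fun K => h (Z.opp (Z.of_nat K)) * pow (- IZR (Z.opp (Z.of_nat K))) j) 0) ->
  (forall a : Z, ex_finite_lim_seq (fun K => zsum f a (Z.add (Z.of_nat K) 1))) ->
  is_lim_seq (fun K => zsum f (Z.opp (Z.of_nat K)) (Z.add (Z.of_nat K) 1)) D ->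
  is_lim_seq (fun K => Rprod (List.map (fun j => e1 + d1 + 2 * INR (S n) - 2 - INR j) (List.seq 0 n)) *
      Rsum (List.map (interlacing_weight n f) (box n m K)))
    (D * (Rprod (List.map (fun i => h (m (S i))) (List.seq 0 n)) *
          vandermonde n (fun i => IZR (m (S i))))).
Proof.
move=> Hup Hdn Hm Hright Hleft Htail HD.
have -> : D * (Rprod (List.map (fun i => h (m (S i))) (List.seq 0 n)) *
          vandermonde n (fun i => IZR (m (S i)))) = limit_value n h D m.
  by rewrite Rprod_seq0.
apply: is_lim_seq_ext; last first.
  apply: (@lim_box_sum n f h e1 e2 d1 d2 D m).
  - move=> l y ->; rewrite Hup opprK expr2; congr (_ * _).
  - move=> l y ->; rewrite Hdn opprK expr2 -INRE; congr (_ * _).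
  - by move=> i /andP[/leP i0 /leP ij]; apply: Hm.
  - move=> j /leP jn; apply: is_lim_seq_ext (Hright j jn) => K.
    by rewrite RpowE.
  - move=> j /leP jn; apply: is_lim_seq_ext (Hleft j jn) => K.
    by rewrite RpowE.
  - exact: Htail.
  - exact: HD.
move=> K; rewrite Rprod_seq0; congr (_ * _); apply: eq_bigr => j _.
rewrite -!INRE. congr (_ - _); congr (_ - _); congr (_ + _).
by rewrite mulr2n; first [exact: Rplus_diag | exact: esym (Rplus_diag _)].
Qed.

End MinorLimits.


Declare Scope Cx_scope.
Delimit Scope Cx_scope with Cx.
Bind Scope Cx_scope with Cx.
Notation "x + y" := (Cadd x y) : Cx_scope.
Notation "x - y" := (Csub x y) : Cx_scope.
Notation "x * y" := (Cmul x y) : Cx_scope.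
Notation "- x" := (Copp x) : Cx_scope.
Notation "x / y" := (Cdiv x y) : Cx_scope.
Notation "0" := C0 : Cx_scope.
Notation "1" := C1 : Cx_scope.

(** * Complex numbers *)

Lemma Cx_ext (a b : Cx) : fst a = fst b -> snd a = snd b -> a = b.
Proof. destruct a, b; simpl; congruence. Qed.

Lemma C1_neq_C0 : C1 <> C0.
Proof. intros H; apply (f_equal fst) in H; simpl in H; lra. Qed.

Lemma Cx_sqr_pos (a : Cx) : a <> C0 -> 0 < fst a * fst a + snd a * snd a.
Proof.
  intros Ha. destruct a as [x y]; simpl.
  destruct (Req_dec x 0) as [->|Hx]; [destruct (Req_dec y 0) as [->|Hy]|].
  - now elim Ha.
  - nra.
  - nra.
Qed.

Lemma Cx_field_theory : field_theory C0 C1 Cadd Cmul Csub Copp Cdiv Cinv (@eq Cx).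
Proof.
  constructor; [constructor| | |]; intros;
    try (apply Cx_ext; unfold Csub, Cmul, Cadd, Copp, C0, C1; simpl; ring).
  - now apply C1_neq_C0.
  - pose proof (Cx_sqr_pos _ H).
    apply Cx_ext; unfold Cmul, Cinv, C1; simpl; field; lra.
Qed.

Add Field Cx_field : Cx_field_theory.

Lemma Cmul_assoc (a b c : Cx) : (a * (b * c))%Cx = (a * b * c)%Cx.
Proof. ring. Qed.

Lemma RtoC_inv (x : R) : x <> 0 -> RtoC (/ x) = Cinv (RtoC x).
Proof. intros Hx. apply Cx_ext; simpl; field; lra. Qed.

Lemma RtoC_plus (x y : R) : RtoC (x + y) = (RtoC x + RtoC y)%Cx.
Proof. apply Cx_ext; simpl; ring. Qed.

Lemma RtoC_minus (x y : R) : RtoC (x - y) = (RtoC x - RtoC y)%Cx.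
Proof. apply Cx_ext; simpl; ring. Qed.

Lemma RtoC_opp (x : R) : RtoC (- x) = (- RtoC x)%Cx.
Proof. apply Cx_ext; simpl; ring. Qed.

Lemma RtoC_mult (x y : R) : RtoC (x * y) = (RtoC x * RtoC y)%Cx.
Proof. apply Cx_ext; simpl; ring. Qed.

Lemma RtoC_neq (x : R) : x <> 0 -> RtoC x <> C0.
Proof. intros H E; apply H; now injection E. Qed.

Lemma Cmul_neq0 (a b : Cx) : a <> C0 -> b <> C0 -> Cmul a b <> C0.
Proof.
  intros Ha Hb E; apply Hb.
  replace b with (Cinv a * (a * b))%Cx by (field; exact Ha).
  rewrite E; ring.
Qed.

Lemma Cmul_cancel_l (a b c : Cx) : a <> C0 -> Cmul a b = Cmul a c -> b = c.
Proof.
  intros Ha E.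
  replace b with (Cinv a * (a * b))%Cx by (field; exact Ha).
  rewrite E; field; exact Ha.
Qed.

Lemma Cinv_0 : Cinv C0 = C0.
Proof. apply Cx_ext; unfold Cinv, C0; simpl; unfold Rdiv; ring. Qed.

Lemma Cx_eq_dec0 (a : Cx) : a = C0 \/ a <> C0.
Proof.
  destruct (Req_dec (fst a) 0) as [H|H]; [destruct (Req_dec (snd a) 0) as [H'|H']|].
  - left; apply Cx_ext; assumption.
  - right; intros E; apply H'; now rewrite E.
  - right; intros E; apply H; now rewrite E.
Qed.

Lemma Cinv_neq0 (a : Cx) : a <> C0 -> Cinv a <> C0.
Proof.
  intros Ha E. apply C1_neq_C0.
  replace C1 with (a * Cinv a)%Cx by (field; exact Ha). rewrite E; ring.
Qed.

(** Holds at 0 as well, by the convention on [Cinv]. Hence the inverse of [Gamma] is [rgamma] at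
    every argument, the poles of Gamma included. *)
Lemma Cinv_Cinv (a : Cx) : Cinv (Cinv a) = a.
Proof.
  destruct (Cx_eq_dec0 a) as [->|Ha]; [now rewrite !Cinv_0|].
  apply (Cmul_cancel_l (Cinv a)); [now apply Cinv_neq0|].
  transitivity C1; [|symmetry]; field; auto using Cinv_neq0, C1_neq_C0.
Qed.

Lemma Cinv_mul (a b : Cx) : Cinv (Cmul a b) = Cmul (Cinv a) (Cinv b).
Proof.
  destruct (Cx_eq_dec0 a) as [->|Ha].
  { replace (0 * b)%Cx with C0 by ring. rewrite Cinv_0; ring. }
  destruct (Cx_eq_dec0 b) as [->|Hb].
  { replace (a * 0)%Cx with C0 by ring. rewrite Cinv_0; ring. }
  field; auto.
Qed.

Lemma Cinv_1 : Cinv C1 = C1.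
Proof. field; exact C1_neq_C0. Qed.

Lemma Cnorm_Cmod (a : Cx) : Cnorm a = Cmod a.
Proof. unfold Cnorm, Cmod; f_equal; ring. Qed.

Lemma Cnorm_mul (a b : Cx) : Cnorm (Cmul a b) = Cnorm a * Cnorm b.
Proof. rewrite !Cnorm_Cmod; apply (Cmod_mult a b). Qed.

Lemma Cnorm_add (a b : Cx) : Cnorm (Cadd a b) <= Cnorm a + Cnorm b.
Proof. rewrite !Cnorm_Cmod; apply (Cmod_triangle a b). Qed.

Lemma Cnorm_opp (a : Cx) : Cnorm (Copp a) = Cnorm a.
Proof. unfold Cnorm; simpl; f_equal; ring. Qed.

Lemma Cnorm_sub_sym (a b : Cx) : Cnorm (Csub a b) = Cnorm (Csub b a).
Proof. rewrite <- Cnorm_opp; f_equal; ring. Qed.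

Lemma Cnorm_ge0 (a : Cx) : 0 <= Cnorm a.
Proof. apply sqrt_pos. Qed.

Lemma Cnorm_RtoC (x : R) : Cnorm (RtoC x) = Rabs x.
Proof.
  unfold Cnorm, RtoC; simpl. rewrite <- sqrt_Rsqr_abs. unfold Rsqr; f_equal; ring.
Qed.

Lemma Cnorm_0 : Cnorm C0 = 0.
Proof. change C0 with (RtoC 0). rewrite Cnorm_RtoC. apply Rabs_R0. Qed.

Lemma Cnorm_1 : Cnorm C1 = 1.
Proof. change C1 with (RtoC 1). rewrite Cnorm_RtoC. apply Rabs_R1. Qed.

Lemma Cnorm_fst (a : Cx) : Rabs (fst a) <= Cnorm a.
Proof.
  unfold Cnorm. rewrite <- sqrt_Rsqr_abs. apply sqrt_le_1_alt. unfold Rsqr.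
  pose proof (Rle_0_sqr (snd a)) as H; unfold Rsqr in H; lra.
Qed.

Lemma Cnorm_snd (a : Cx) : Rabs (snd a) <= Cnorm a.
Proof.
  unfold Cnorm. rewrite <- sqrt_Rsqr_abs. apply sqrt_le_1_alt. unfold Rsqr.
  pose proof (Rle_0_sqr (fst a)) as H; unfold Rsqr in H; lra.
Qed.

Lemma Cnorm_le_parts (a : Cx) : Cnorm a <= Rabs (fst a) + Rabs (snd a).
Proof.
  replace a with (RtoC (fst a) + (0%R, snd a))%Cx by (apply Cx_ext; simpl; ring).
  eapply Rle_trans; [apply Cnorm_add|]. simpl.
  rewrite Cnorm_RtoC, Rplus_0_r, Rplus_0_l. apply Rplus_le_compat_l.
  unfold Cnorm; simpl. rewrite <- sqrt_Rsqr_abs. unfold Rsqr. right; f_equal; ring.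
Qed.

Lemma Cnorm_pos (a : Cx) : a <> C0 -> 0 < Cnorm a.
Proof. intros H. apply sqrt_lt_R0, Cx_sqr_pos, H. Qed.

Lemma Cnorm_add_ge (a b : Cx) : Cnorm a - Cnorm b <= Cnorm (Cadd a b).
Proof.
  pose proof (Cnorm_add (a + b) (- b)) as H. rewrite Cnorm_opp in H.
  replace (a + b + - b)%Cx with a in H by ring. lra.
Qed.

Lemma Re_pos_neq0 (a : Cx) : 0 < fst a -> a <> C0.
Proof. intros H E; rewrite E in H; simpl in H; lra. Qed.

Lemma Cexp_add (a b : Cx) : Cexp (Cadd a b) = Cmul (Cexp a) (Cexp b).
Proof.
  apply Cx_ext; simpl; rewrite exp_plus; [rewrite cos_plus|rewrite sin_plus]; ring.
Qed.

Lemma Cexp_RtoC (x : R) : Cexp (RtoC x) = RtoC (exp x).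
Proof. apply Cx_ext; simpl; rewrite ?cos_0, ?sin_0; ring. Qed.

Lemma Cexp_0 : Cexp C0 = C1.
Proof. change C0 with (RtoC 0). rewrite Cexp_RtoC, exp_0. reflexivity. Qed.

Lemma Cnorm_Cexp (a : Cx) : Cnorm (Cexp a) = exp (fst a).
Proof.
  unfold Cnorm, Cexp; simpl.
  replace (_ + _) with (Rsqr (exp (fst a)) * (Rsqr (sin (snd a)) + Rsqr (cos (snd a))))
    by (unfold Rsqr; ring).
  rewrite sin2_cos2, Rmult_1_r. apply sqrt_Rsqr, Rlt_le, exp_pos.
Qed.

Lemma Cexp_neq0 (a : Cx) : Cexp a <> C0.
Proof.
  intros E. pose proof (Cnorm_Cexp a) as H. rewrite E, Cnorm_0 in H.
  pose proof (exp_pos (fst a)); lra.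
Qed.

Lemma Cexp_opp (a : Cx) : Cexp (Copp a) = Cinv (Cexp a).
Proof.
  apply (Cmul_cancel_l (Cexp a)); [apply Cexp_neq0|].
  rewrite <- Cexp_add. replace (a + - a)%Cx with C0 by ring.
  rewrite Cexp_0. field. apply Cexp_neq0.
Qed.

(** * Limits of complex sequences *)

Lemma is_lim_seq_eps (u : nat -> R) (l : R) :
  is_lim_seq u l <->
  forall eps, eps > 0 -> exists N, forall n, (n >= N)%nat -> Rabs (u n - l) < eps.
Proof.
  split.
  - intros H eps He. apply is_lim_seq_spec in H.
    destruct (H (mkposreal eps He)) as [N HN]. exists N; exact HN.
  - intros H. apply is_lim_seq_spec. intros [eps He]. exact (H eps He).
Qed.

Lemma C_cv_parts (u : nat -> Cx) (l : Cx) :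
  C_cv u l <-> is_lim_seq (fun n => fst (u n)) (fst l) /\ is_lim_seq (fun n => snd (u n)) (snd l).
Proof.
  rewrite !is_lim_seq_eps. split.
  - intros H; split; intros eps He; destruct (H eps He) as [N HN]; exists N; intros n Hn;
      (eapply Rle_lt_trans; [|exact (HN n Hn)]).
    + exact (Cnorm_fst (u n - l)%Cx).
    + exact (Cnorm_snd (u n - l)%Cx).
  - intros [H1 H2] eps He.
    destruct (H1 (eps / 2)) as [N1 HN1]; [lra|]. destruct (H2 (eps / 2)) as [N2 HN2]; [lra|].
    exists (max N1 N2). intros n Hn.
    eapply Rle_lt_trans; [apply Cnorm_le_parts|].
    specialize (HN1 n ltac:(lia)). specialize (HN2 n ltac:(lia)).
    change (fst (u n - l)%Cx) with (fst (u n) - fst l).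
    change (snd (u n - l)%Cx) with (snd (u n) - snd l). lra.
Qed.

Lemma C_cv_unique (u : nat -> Cx) (l l' : Cx) : C_cv u l -> C_cv u l' -> l = l'.
Proof.
  rewrite !C_cv_parts. intros [H1 H2] [H1' H2'].
  apply is_lim_seq_unique in H1, H2, H1', H2'.
  apply Cx_ext; congruence.
Qed.

Lemma C_cv_Clim (u : nat -> Cx) (l : Cx) : C_cv u l -> C_cv u (Clim u).
Proof.
  intros H. unfold Clim.
  apply (ClassicalEpsilon.epsilon_spec (inhabits C0) (fun l => C_cv u l)). now exists l.
Qed.

Lemma Clim_eq (u : nat -> Cx) (l : Cx) : C_cv u l -> Clim u = l.
Proof. intros H. exact (C_cv_unique u _ _ (C_cv_Clim u l H) H). Qed.

Lemma C_cv_ext_loc (u v : nat -> Cx) (l : Cx) (N : nat) :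
  (forall n, (n >= N)%nat -> u n = v n) -> C_cv u l -> C_cv v l.
Proof.
  intros E H eps He. destruct (H eps He) as [M HM]. exists (max N M).
  intros n Hn. rewrite <- E by lia. apply HM; lia.
Qed.

Lemma C_cv_ext (u v : nat -> Cx) (l : Cx) :
  (forall n, u n = v n) -> C_cv u l -> C_cv v l.
Proof. intros E. apply (C_cv_ext_loc u v l 0); auto. Qed.

Lemma C_cv_const (a : Cx) : C_cv (fun _ => a) a.
Proof. apply C_cv_parts; split; apply is_lim_seq_const. Qed.

Lemma C_cv_add (u v : nat -> Cx) (a b : Cx) :
  C_cv u a -> C_cv v b -> C_cv (fun n => Cadd (u n) (v n)) (Cadd a b).
Proof.
  rewrite !C_cv_parts. intros [H1 H2] [H3 H4]; split; simpl; now apply is_lim_seq_plus'.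
Qed.

Lemma C_cv_opp (u : nat -> Cx) (a : Cx) :
  C_cv u a -> C_cv (fun n => Copp (u n)) (Copp a).
Proof.
  rewrite !C_cv_parts. intros [H1 H2]; split; simpl.
  - exact (proj1 (is_lim_seq_opp _ _) H1).
  - exact (proj1 (is_lim_seq_opp _ _) H2).
Qed.

Lemma C_cv_sub (u v : nat -> Cx) (a b : Cx) :
  C_cv u a -> C_cv v b -> C_cv (fun n => Csub (u n) (v n)) (Csub a b).
Proof. intros H1 H2. apply C_cv_add; [exact H1|]. now apply C_cv_opp. Qed.

Lemma C_cv_mul (u v : nat -> Cx) (a b : Cx) :
  C_cv u a -> C_cv v b -> C_cv (fun n => Cmul (u n) (v n)) (Cmul a b).
Proof.
  rewrite !C_cv_parts. intros [H1 H2] [H3 H4]; split; simpl.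
  - apply is_lim_seq_minus'; now apply is_lim_seq_mult'.
  - apply is_lim_seq_plus'; now apply is_lim_seq_mult'.
Qed.

Lemma C_cv_inv (u : nat -> Cx) (a : Cx) :
  a <> C0 -> C_cv u a -> C_cv (fun n => Cinv (u n)) (Cinv a).
Proof.
  intros Ha. pose proof (Cx_sqr_pos a Ha) as Hp. rewrite !C_cv_parts. intros [H1 H2].
  assert (H : is_lim_seq (fun n => fst (u n) * fst (u n) + snd (u n) * snd (u n))
                (fst a * fst a + snd a * snd a)).
  { apply is_lim_seq_plus'; now apply is_lim_seq_mult'. }
  split; unfold Cinv; simpl; apply is_lim_seq_div'; auto; try lra.
  exact (proj1 (is_lim_seq_opp _ _) H2).
Qed.

Lemma C_cv_div (u v : nat -> Cx) (a b : Cx) :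
  b <> C0 -> C_cv u a -> C_cv v b -> C_cv (fun n => Cdiv (u n) (v n)) (Cdiv a b).
Proof. intros Hb H1 H2. apply C_cv_mul; [exact H1|]. now apply C_cv_inv. Qed.

Lemma C_cv_comp (u : nat -> Cx) (s : nat -> nat) (a : Cx) :
  (forall n, (n <= s n)%nat) -> C_cv u a -> C_cv (fun n => u (s n)) a.
Proof.
  intros Hs H eps He. destruct (H eps He) as [N HN]. exists N.
  intros n Hn. apply HN. specialize (Hs n); lia.
Qed.

Lemma C_cv_RtoC (u : nat -> R) (a : R) : is_lim_seq u a -> C_cv (fun n => RtoC (u n)) (RtoC a).
Proof. intros H. apply C_cv_parts; split; [exact H|apply is_lim_seq_const]. Qed.

Lemma C_cv_norm_le (u : nat -> Cx) (a : Cx) (M : R) (N : nat) :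
  C_cv u a -> (forall n, (n >= N)%nat -> Cnorm (u n) <= M) -> Cnorm a <= M.
Proof.
  intros H HM. apply Rnot_lt_le. intros Hlt.
  destruct (H (Cnorm a - M)) as [N1 HN1]; [lra|].
  specialize (HN1 (max N N1) ltac:(lia)). specialize (HM (max N N1) ltac:(lia)).
  pose proof (Cnorm_add_ge a (u (max N N1) - a)) as Hg.
  replace (a + (u (max N N1) - a))%Cx with (u (max N N1)) in Hg by ring. lra.
Qed.

Lemma C_cv_bounded (u : nat -> Cx) (a : Cx) :
  C_cv u a -> exists M, 0 < M /\ forall n, Cnorm (u n) <= M.
Proof.
  intros H. destruct (H 1) as [N HN]; [lra|].
  assert (Hfin : forall K, exists M, 0 < M /\ forall n, (n < K)%nat -> Cnorm (u n) <= M).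
  { induction K as [|K [M [HM0 HM]]].
    - exists 1; split; [lra|]; intros; lia.
    - exists (M + Cnorm (u K)). pose proof (Cnorm_ge0 (u K)).
      split; [lra|]. intros n Hn. destruct (Nat.eq_dec n K) as [->|Hne]; [lra|].
      specialize (HM n ltac:(lia)); lra. }
  destruct (Hfin N) as [M [HM0 HM]].
  exists (M + Cnorm a + 1). pose proof (Cnorm_ge0 a). split; [lra|]. intros n.
  destruct (le_lt_dec N n) as [Hn|Hn].
  - specialize (HN n Hn). pose proof (Cnorm_add (u n - a) a) as Ht.
    replace (u n - a + a)%Cx with (u n) in Ht by ring. lra.
  - specialize (HM n Hn); lra.
Qed.

Lemma C_cauchy_cv (u : nat -> Cx) :
  (forall eps, eps > 0 -> exists N, forall n, (n >= N)%nat -> Cnorm (Csub (u n) (u N)) < eps) ->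
  exists l, C_cv u l.
Proof.
  intros H.
  assert (Hc : forall p : Cx -> R,
     (forall a b, Rabs (p a - p b) <= Cnorm (Csub a b)) ->
     exists l : R, is_lim_seq (fun n => p (u n)) l).
  { intros p Hp. apply ex_lim_seq_cauchy_corr. intros [eps He].
    destruct (H (eps / 2)) as [N HN]; [lra|]. exists N. intros n m Hn Hm. simpl.
    pose proof (HN n Hn). pose proof (HN m Hm).
    pose proof (Hp (u n) (u N)). pose proof (Hp (u m) (u N)).
    replace (p (u n) - p (u m)) with ((p (u n) - p (u N)) - (p (u m) - p (u N))) by ring.
    eapply Rle_lt_trans; [apply Rabs_triang|]. rewrite Rabs_Ropp. lra. }
  destruct (Hc fst) as [x Hx]; [intros a b; exact (Cnorm_fst (a - b)%Cx)|].
  destruct (Hc snd) as [y Hy]; [intros a b; exact (Cnorm_snd (a - b)%Cx)|].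
  exists (x, y). apply C_cv_parts; split; assumption.
Qed.

(** * The reciprocal Gamma function *)

Lemma quadratic_bound_of_derive (f df : R -> R) (K L : R) :
  (forall x : R, is_derive f x (df x)) ->
  (forall x, 0 <= x <= 1 -> Rabs (df x) <= K * x) ->
  0 <= K -> 0 <= L <= 1 -> Rabs (f L - f 0) <= K * (L * L).
Proof.
  intros Hd Hb HK HL.
  destruct (MVT_gen f 0 L df) as [c [Hc E]].
  - intros x _; apply Hd.
  - intros x _. apply derivable_continuous_pt, ex_derive_Reals_0. now exists (df x).
  - rewrite Rmin_left, Rmax_right in Hc by lra.
    rewrite E, Rminus_0_r, Rabs_mult, (Rabs_right L) by lra.
    specialize (Hb c ltac:(lra)). rewrite <- Rmult_assoc. apply Rmult_le_compat_r; [lra|].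
    apply Rle_trans with (1 := Hb), Rmult_le_compat_l; lra.
Qed.

(* With [L = ln (1 + 1/n)], this is the ratio of consecutive terms of [rgamma_seq z]. *)
Definition gauss_ratio (z : Cx) (L : R) : Cx :=
  ((1 + z * RtoC (1 - exp (- L))) * Cexp (- (z * RtoC L)))%Cx.

(** The derivative in L is -(1 - exp(-L)) (z + z^2) exp(-zL), which is of order L near 0; the ratio
    therefore leaves its value 1 at L = 0 only to second order. The real and imaginary parts are
    treated separately, because the mean value theorem is real. *)
Lemma gauss_ratio_bound (z : Cx) :
  exists C, 0 < C /\ forall L, 0 <= L <= 1 -> Cnorm (gauss_ratio z L - 1)%Cx <= C * (L * L).
Proof.
  destruct z as [p q].
  (* [A] and [B] are the real and imaginary parts of z + z^2. *)
  set (A := p + p * p - q * q). set (B := q + 2 * p * q).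
  set (K := exp (Rabs p) * (Rabs A + Rabs B)).
  assert (HK : 0 <= K).
  { pose proof (exp_pos (Rabs p)). pose proof (Rabs_pos A). pose proof (Rabs_pos B).
    unfold K; nra. }
  set (fr := fun x => exp (- p * x) *
     ((1 + p * (1 - exp (- x))) * cos (q * x) + q * (1 - exp (- x)) * sin (q * x))).
  set (fi := fun x => exp (- p * x) *
     (q * (1 - exp (- x)) * cos (q * x) - (1 + p * (1 - exp (- x))) * sin (q * x))).
  set (dr := fun x => - (1 - exp (- x)) * exp (- p * x) * (A * cos (q * x) + B * sin (q * x))).
  set (di := fun x => - (1 - exp (- x)) * exp (- p * x) * (B * cos (q * x) - A * sin (q * x))).
  assert (Hfr : forall x : R, is_derive fr x (dr x)).
  { intros x. unfold fr, dr, A, B. auto_derive; [exact I|]. ring. }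
  assert (Hfi : forall x : R, is_derive fi x (di x)).
  { intros x. unfold fi, di, A, B. auto_derive; [exact I|]. ring. }
  assert (Hcore : forall x t, 0 <= x <= 1 -> Rabs t <= Rabs A + Rabs B ->
     Rabs (- (1 - exp (- x)) * exp (- p * x) * t) <= K * x).
  { intros x t Hx Ht. rewrite !Rabs_mult, Rabs_Ropp.
    rewrite (Rabs_right (exp (- p * x))) by (apply Rle_ge, Rlt_le, exp_pos).
    assert (H1 : Rabs (1 - exp (- x)) <= x).
    { apply Rabs_le. pose proof (exp_ineq1_le (- x)).
      assert (exp (- x) <= exp 0).
      { destruct (Req_dec x 0) as [->|Hx0]; [rewrite Ropp_0; lra|].
        apply Rlt_le, exp_increasing; lra. }
      rewrite exp_0 in *. lra. }
    assert (H2 : exp (- p * x) <= exp (Rabs p)).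
    { assert (- p * x <= Rabs p).
      { pose proof (Rle_abs (- p)) as H. rewrite Rabs_Ropp in H.
        pose proof (Rabs_pos p). nra. }
      destruct (Req_dec (- p * x) (Rabs p)) as [->|Hne]; [lra|].
      apply Rlt_le, exp_increasing; lra. }
    pose proof (Rabs_pos (1 - exp (- x))). pose proof (exp_pos (- p * x)).
    pose proof (Rabs_pos t).
    replace (K * x) with (x * exp (Rabs p) * (Rabs A + Rabs B)) by (unfold K; ring).
    apply Rmult_le_compat; try lra; [nra|].
    apply Rmult_le_compat; lra. }
  assert (Htrig : forall a b x, Rabs a + Rabs b = Rabs A + Rabs B ->
     Rabs (a * cos x + b * sin x) <= Rabs A + Rabs B).
  { intros a b x <-. eapply Rle_trans; [apply Rabs_triang|]. rewrite !Rabs_mult.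
    assert (Rabs (cos x) <= 1) by (apply Rabs_le, COS_bound).
    assert (Rabs (sin x) <= 1) by (apply Rabs_le, SIN_bound).
    pose proof (Rabs_pos a). pose proof (Rabs_pos b). nra. }
  exists (2 * K + 1). split; [lra|]. intros L HL.
  assert (Hr : Rabs (fr L - fr 0) <= K * (L * L)).
  { apply quadratic_bound_of_derive with dr; auto.
    intros x Hx. apply Hcore; [exact Hx|]. now apply Htrig. }
  assert (Hi : Rabs (fi L - fi 0) <= K * (L * L)).
  { apply quadratic_bound_of_derive with di; auto.
    intros x Hx. apply Hcore; [exact Hx|].
    replace (B * cos (q * x) - A * sin (q * x)) with (B * cos (q * x) + - A * sin (q * x)) by ring.
    apply Htrig. rewrite Rabs_Ropp; ring. }
  assert (E : (gauss_ratio (p, q) L - 1)%Cx = (fr L - fr 0, fi L - fi 0)).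
  { unfold fr, fi. rewrite !Rmult_0_r, Ropp_0, exp_0, cos_0, sin_0.
    unfold gauss_ratio. apply Cx_ext; simpl.
    - replace (- (p * L - q * 0)) with (- p * L) by ring.
      replace (- (p * 0 + q * L)) with (- (q * L)) by ring.
      rewrite cos_neg, sin_neg. ring.
    - replace (- (p * L - q * 0)) with (- p * L) by ring.
      replace (- (p * 0 + q * L)) with (- (q * L)) by ring.
      rewrite cos_neg, sin_neg. ring. }
  rewrite E. eapply Rle_trans; [apply Cnorm_le_parts|]. simpl.
  nra.
Qed.

Lemma Cprod_app (l l' : list Cx) : Cprod (l ++ l') = Cmul (Cprod l) (Cprod l').
Proof. induction l as [|x l IH]; simpl; [ring|]. rewrite IH; ring. Qed.

(** The Pochhammer symbol (z)_n. *)
Definition rising (z : Cx) (n : nat) : Cx :=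
  Cprod (map (fun k => Cadd z (RtoC (INR k))) (seq 0 n)).

Lemma rising_S (z : Cx) (n : nat) : rising z (S n) = (rising z n * (z + RtoC (INR n)))%Cx.
Proof.
  unfold rising. rewrite seq_S, map_app, Cprod_app. simpl. ring.
Qed.

Lemma rising_S_l (z : Cx) (n : nat) : rising z (S n) = (z * rising (z + 1) n)%Cx.
Proof.
  induction n as [|n IH].
  - unfold rising; simpl. change (RtoC 0) with C0. ring.
  - rewrite rising_S, IH, rising_S, S_INR, RtoC_plus. change (RtoC 1) with C1. ring.
Qed.

(** The quantity n! n^z, to which Gamma(z+n+1) is asymptotic. *)
Definition gauss_scale (z : Cx) (n : nat) : Cx :=
  (RtoC (INR (fact n)) * Cexp (z * RtoC (ln (INR n))))%Cx.

Lemma rgamma_seqE (z : Cx) (n : nat) : rgamma_seq z n = (rising z (S n) / gauss_scale z n)%Cx.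
Proof. reflexivity. Qed.

Lemma gauss_scale_neq0 (z : Cx) (n : nat) : gauss_scale z n <> C0.
Proof. apply Cmul_neq0; [apply RtoC_neq, INR_fact_neq_0|apply Cexp_neq0]. Qed.

Lemma rgamma_seq_S (z : Cx) (n : nat) : (1 <= n)%nat ->
  rgamma_seq z (S n) = (rgamma_seq z n * gauss_ratio z (ln (INR (S n)) - ln (INR n)))%Cx.
Proof.
  intros Hn. rewrite !rgamma_seqE, (rising_S z (S n)). unfold gauss_ratio, gauss_scale.
  assert (Hn0 : 0 < INR n) by (apply lt_0_INR; lia).
  assert (Hn1 : 0 < INR (S n)) by (apply lt_0_INR; lia).
  assert (Ee : exp (- (ln (INR (S n)) - ln (INR n))) = / (INR (S n) / INR n)).
  { rewrite exp_Ropp, <- ln_div, exp_ln by (try apply Rdiv_lt_0_compat; assumption).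
    reflexivity. }
  rewrite Ee.
  rewrite fact_simpl, mult_INR, RtoC_mult, (RtoC_minus (ln _) (ln _)).
  set (x := ln (INR (S n))). set (y := ln (INR n)).
  replace (- (z * (RtoC x - RtoC y)))%Cx with (z * RtoC y + - (z * RtoC x))%Cx by ring.
  rewrite Cexp_add, Cexp_opp.
  replace (1 + z * RtoC (1 - / (INR (S n) / INR n)))%Cx
    with ((z + RtoC (INR (S n))) / RtoC (INR (S n)))%Cx.
  2:{ replace (1 - / (INR (S n) / INR n)) with (/ INR (S n)).
      2:{ rewrite S_INR in *. field. lra. }
      rewrite RtoC_inv by lra. field. apply RtoC_neq; lra. }
  field. repeat split; try apply Cexp_neq0; apply RtoC_neq; try lra. apply INR_fact_neq_0.
Qed.

(** Since m + 1 <= 2m, the bound C/m^2 is at most 2C(1/m - 1/(m+1)), and the exponents telescope.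
    The error is kept relative to the modulus of [r n], so that one may later divide by [r n]. *)
Lemma almost_constant_product (r : nat -> Cx) (e : nat -> Cx) (C : R) :
  0 < C ->
  (forall n, (1 <= n)%nat -> r (S n) = (r n * (1 + e n))%Cx) ->
  (forall n, (1 <= n)%nat -> Cnorm (e n) <= C / (INR n * INR n)) ->
  forall n m, (1 <= n <= m)%nat ->
  Cnorm (r m - r n)%Cx <= Cnorm (r n) * (exp (2 * C * (/ INR n - / INR m)) - 1).
Proof.
  intros HC Hr He n m [Hn Hm]. induction Hm as [|m Hm IH].
  - rewrite Rminus_diag, Rmult_0_r, exp_0.
    replace (r n - r n)%Cx with C0 by ring. rewrite Cnorm_0. lra.
  - assert (Hm1 : (1 <= m)%nat) by lia.
    assert (Hm0 : 1 <= INR m) by (apply (le_INR 1); lia).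
    assert (Hn0 : 1 <= INR n) by (apply (le_INR 1); lia).
    set (E := exp (2 * C * (/ INR n - / INR m))) in *.
    assert (HE : 0 < E) by apply exp_pos.
    pose proof (Cnorm_ge0 (r n)) as Hp.
    assert (Hrm : Cnorm (r m) <= Cnorm (r n) * E).
    { pose proof (Cnorm_add (r m - r n) (r n)) as H.
      replace (r m - r n + r n)%Cx with (r m) in H by ring. lra. }
    assert (Hd : C / (INR m * INR m) <= 2 * C * (/ INR m - / INR (S m))).
    { rewrite S_INR. replace (2 * C * (/ INR m - / (INR m + 1))) with
        (C / (INR m * INR m) * (2 * INR m / (INR m + 1))) by (field; lra).
      assert (0 < C / (INR m * INR m)) by (apply Rdiv_lt_0_compat; nra).
      assert (1 <= 2 * INR m / (INR m + 1)).
      { apply (Rmult_le_reg_r (INR m + 1)); [lra|]. unfold Rdiv.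
        rewrite Rmult_assoc, Rinv_l by lra. lra. }
      nra. }
    rewrite (Hr m Hm1).
    replace (r m * (1 + e m) - r n)%Cx with ((r m - r n) + r m * e m)%Cx by ring.
    eapply Rle_trans; [apply Cnorm_add|]. rewrite Cnorm_mul.
    replace (2 * C * (/ INR n - / INR (S m))) with
      (2 * C * (/ INR n - / INR m) + 2 * C * (/ INR m - / INR (S m))) by ring.
    rewrite exp_plus. fold E.
    set (d := 2 * C * (/ INR m - / INR (S m))) in *.
    pose proof (exp_ineq1_le d) as Hexp.
    specialize (He m Hm1). pose proof (Cnorm_ge0 (e m)).
    assert (Cnorm (r m) * Cnorm (e m) <= Cnorm (r n) * E * d).
    { apply Rmult_le_compat; try lra; apply Cnorm_ge0. }
    assert (Cnorm (r n) * E * d <= Cnorm (r n) * E * (exp d - 1)).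
    { apply Rmult_le_compat_l; [apply Rmult_le_pos; lra|lra]. }
    nra.
Qed.

Lemma ln_succ_bounds (n : nat) : (1 <= n)%nat ->
  0 <= ln (INR (S n)) - ln (INR n) <= / INR n.
Proof.
  intros Hn. assert (H1 : 1 <= INR n) by (apply (le_INR 1); lia).
  rewrite <- ln_div by (rewrite ?S_INR; lra).
  replace (INR (S n) / INR n) with (1 + / INR n) by (rewrite S_INR; field; lra).
  assert (H0 : 0 < / INR n) by (apply Rinv_0_lt_compat; lra).
  split.
  - rewrite <- ln_1. apply Rlt_le, ln_increasing; lra.
  - rewrite <- (ln_exp (/ INR n)) at 2.
    apply ln_le; [lra|]. apply exp_ineq1_le.
Qed.

Lemma rgamma_seq_tail (z : Cx) :
  exists K, 0 < K /\ forall n m, (1 <= n <= m)%nat ->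
  Cnorm (rgamma_seq z m - rgamma_seq z n)%Cx <= Cnorm (rgamma_seq z n) * (exp (K / INR n) - 1).
Proof.
  destruct (gauss_ratio_bound z) as [C [HC HB]].
  exists (2 * C). split; [lra|]. intros n m Hnm.
  set (e := fun n => (gauss_ratio z (ln (INR (S n)) - ln (INR n)) - 1)%Cx).
  eapply Rle_trans.
  - apply (almost_constant_product (rgamma_seq z) e C HC); [| |exact Hnm].
    + intros k Hk. rewrite rgamma_seq_S by exact Hk. unfold e. ring.
    + intros k Hk. assert (H1 : 1 <= INR k) by (apply (le_INR 1); lia).
      pose proof (ln_succ_bounds k Hk) as HL.
      assert (/ INR k <= 1) by (rewrite <- Rinv_1; apply Rinv_le_contravar; lra).
      eapply Rle_trans; [apply HB; split; lra|]. unfold Rdiv. rewrite Rinv_mult.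
      apply Rmult_le_compat_l; [lra|]. nra.
  - apply Rmult_le_compat_l; [apply Cnorm_ge0|].
    assert (1 <= INR n) by (apply (le_INR 1); lia).
    assert (1 <= INR m) by (apply (le_INR 1); lia).
    assert (0 < / INR m) by (apply Rinv_0_lt_compat; lra).
    apply Rplus_le_compat_r, Rlt_le, exp_increasing. unfold Rdiv. nra.
Qed.

Lemma exp_over_n_cv (K eps : R) : 0 < K -> 0 < eps ->
  exists N, (1 <= N)%nat /\ forall n, (n >= N)%nat -> exp (K / INR n) - 1 < eps.
Proof.
  intros HK He.
  assert (Hl : 0 < ln (1 + eps)) by (rewrite <- ln_1; apply ln_increasing; lra).
  destruct (INR_unbounded (K / ln (1 + eps))) as [N HN].
  exists (S N). split; [lia|]. intros n Hn.
  assert (HNn : INR (S N) <= INR n) by (apply le_INR; lia). rewrite S_INR in HNn.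
  assert (0 < K / ln (1 + eps)) by (apply Rdiv_lt_0_compat; lra).
  assert (K / INR n < ln (1 + eps)).
  { apply (Rmult_lt_reg_r (INR n)); [lra|]. unfold Rdiv.
    rewrite Rmult_assoc, Rinv_l, Rmult_1_r by lra.
    apply (Rmult_lt_reg_r (/ ln (1 + eps))); [now apply Rinv_0_lt_compat|].
    replace (ln (1 + eps) * INR n * / ln (1 + eps)) with (INR n) by (field; lra).
    unfold Rdiv in *. lra. }
  apply exp_increasing in H0. rewrite exp_ln in H0 by lra. lra.
Qed.

(** The relative tail bound from index 1 bounds the whole sequence by [M]; with that, the relative
    errors become absolute and the sequence is Cauchy. *)
Lemma rgamma_cv (z : Cx) : C_cv (rgamma_seq z) (rgamma z).
Proof.
  destruct (rgamma_seq_tail z) as [K [HK Ht]].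
  set (M := Cnorm (rgamma_seq z 1) * exp (K / INR 1) + 1).
  assert (HM0 : 0 < M).
  { pose proof (Cnorm_ge0 (rgamma_seq z 1)). pose proof (exp_pos (K / INR 1)). unfold M; nra. }
  assert (HM : forall n, (1 <= n)%nat -> Cnorm (rgamma_seq z n) <= M).
  { intros n Hn. specialize (Ht 1%nat n ltac:(lia)).
    pose proof (Cnorm_add (rgamma_seq z n - rgamma_seq z 1) (rgamma_seq z 1)) as H.
    replace (rgamma_seq z n - rgamma_seq z 1 + rgamma_seq z 1)%Cx with (rgamma_seq z n) in H by ring.
    unfold M. lra. }
  destruct (C_cauchy_cv (rgamma_seq z)) as [l Hl].
  - intros eps He. destruct (exp_over_n_cv K (eps / M)) as [N [HN1 HN]]; [lra| |].
    + apply Rdiv_lt_0_compat; lra.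
    + exists N. intros n Hn. eapply Rle_lt_trans; [apply Ht; lia|].
      specialize (HN N (Nat.le_refl N)). specialize (HM N HN1).
      assert (0 <= exp (K / INR N) - 1).
      { pose proof (exp_ineq1_le (K / INR N)).
        assert (0 < K / INR N) by (apply Rdiv_lt_0_compat; [lra|apply lt_0_INR; lia]). lra. }
      apply Rle_lt_trans with (M * (exp (K / INR N) - 1)).
      * apply Rmult_le_compat_r; lra.
      * replace eps with (M * (eps / M)) by (field; lra). apply Rmult_lt_compat_l; lra.
  - unfold rgamma. now apply C_cv_Clim with l.
Qed.

Lemma is_lim_seq_inv_INR : is_lim_seq (fun n => / INR n) 0.
Proof.
  apply (is_lim_seq_inv INR p_infty); [apply is_lim_seq_INR|discriminate].
Qed.

(** Gauss's approximants satisfy the recurrence up to the factor 1 + (z+1)/n, which tends to 1. *)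
Lemma rgamma_succ (z : Cx) : rgamma z = (z * rgamma (z + 1))%Cx.
Proof.
  apply (C_cv_unique (fun n => z * rgamma_seq (z + 1) n)%Cx).
  2:{ apply C_cv_mul; [apply C_cv_const|apply rgamma_cv]. }
  apply (C_cv_ext_loc (fun n => (rgamma_seq z n * (1 + (z + 1) * RtoC (/ INR n)))%Cx) _ _ 1).
  - intros n Hn. rewrite !rgamma_seqE.
    assert (Hn0 : 0 < INR n) by (apply lt_0_INR; lia).
    unfold gauss_scale.
    replace ((z + 1) * RtoC (ln (INR n)))%Cx with (z * RtoC (ln (INR n)) + RtoC (ln (INR n)))%Cx
      by ring.
    rewrite Cexp_add, Cexp_RtoC, exp_ln by exact Hn0.
    assert (E : (z * rising (z + 1) (S n) = rising z (S n) * (z + RtoC (INR n) + 1))%Cx).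
    { rewrite <- rising_S_l, (rising_S z (S n)), S_INR, RtoC_plus.
      change (RtoC 1) with C1. ring. }
    rewrite RtoC_inv by lra.
    unfold Cdiv. rewrite Cmul_assoc, E.
    field. repeat split; try apply Cexp_neq0; apply RtoC_neq; try lra; apply INR_fact_neq_0.
  - replace (rgamma z) with (rgamma z * (1 + (z + 1) * RtoC 0))%Cx.
    2:{ change (RtoC 0) with C0. ring. }
    apply C_cv_mul; [apply rgamma_cv|]. apply C_cv_add; [apply C_cv_const|].
    apply C_cv_mul; [apply C_cv_const|]. apply C_cv_RtoC, is_lim_seq_inv_INR.
Qed.

Lemma rgamma_rising (z : Cx) (n : nat) :
  rgamma z = (rising z n * rgamma (z + RtoC (INR n)))%Cx.
Proof.
  induction n as [|n IH].
  - unfold rising; simpl. change (RtoC 0) with C0.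
    replace (z + 0)%Cx with z by ring. ring.
  - rewrite IH, (rgamma_succ (z + RtoC (INR n))), rising_S, S_INR, RtoC_plus.
    change (RtoC 1) with C1.
    replace (z + RtoC (INR n) + 1)%Cx with (z + (RtoC (INR n) + 1))%Cx by ring. ring.
Qed.

Lemma rising_neq0 (z : Cx) (n : nat) : 0 < fst z -> rising z n <> C0.
Proof.
  intros Hz. induction n as [|n IH].
  - unfold rising; simpl; exact C1_neq_C0.
  - rewrite rising_S. apply Cmul_neq0; [exact IH|].
    apply Re_pos_neq0; simpl. pose proof (pos_INR n). lra.
Qed.

Lemma rgamma_seq_gauss (z : Cx) (n : nat) :
  rgamma z = (rgamma_seq z n * (rgamma (z + RtoC (INR (S n))) * gauss_scale z n))%Cx.
Proof.
  rewrite (rgamma_rising z (S n)), rgamma_seqE. field. apply gauss_scale_neq0.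
Qed.

(* Stirling-type asymptotics: [1/Gamma(z+n+1) ~ 1/(n! n^z)]. *)
Lemma rgamma_asymptotic (z : Cx) :
  C_cv (fun n => Cmul (rgamma (z + RtoC (INR (S n)))%Cx) (gauss_scale z n)) C1.
Proof.
  (* For Re z > 0 the approximant is nonzero, and dividing the relative tail bound by it gives the
     claim. Any other z is reached from the right half-plane by unit steps down, each costing a
     factor that tends to 1. *)
  assert (Hpos : forall z, 0 < fst z ->
    C_cv (fun n => Cmul (rgamma (z + RtoC (INR (S n)))%Cx) (gauss_scale z n)) C1).
  { clear z. intros z Hz eps He.
    destruct (rgamma_seq_tail z) as [K [HK Ht]].
    destruct (exp_over_n_cv K (eps / 2)) as [N [HN1 HN]]; [lra|lra|].
    exists N. intros n Hn.
    set (G := (rgamma (z + RtoC (INR (S n))) * gauss_scale z n)%Cx).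
    assert (Hr : rgamma_seq z n <> C0).
    { rewrite rgamma_seqE. apply Cmul_neq0; [now apply rising_neq0|].
      apply Cinv_neq0, gauss_scale_neq0. }
    pose proof (Cnorm_pos _ Hr) as Hr0.
    assert (H : Cnorm (rgamma z - rgamma_seq z n)%Cx
                <= Cnorm (rgamma_seq z n) * (exp (K / INR n) - 1)).
    { apply C_cv_norm_le with (u := fun m => (rgamma_seq z m - rgamma_seq z n)%Cx) (N := n).
      - apply C_cv_sub; [apply rgamma_cv|apply C_cv_const].
      - intros m Hm. apply Ht. lia. }
    rewrite (rgamma_seq_gauss z n) in H. fold G in H.
    replace (rgamma_seq z n * G - rgamma_seq z n)%Cx with (rgamma_seq z n * (G - 1))%Cx in H by ring.
    rewrite Cnorm_mul in H. apply Rmult_le_reg_l in H; [|exact Hr0].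
    specialize (HN n Hn). lra. }
  destruct (INR_unbounded (- fst z)) as [k Hk].
  assert (Hz : 0 < fst (z + RtoC (INR k))%Cx) by (simpl; lra).
  clear Hk. revert z Hz. induction k as [|k IH]; intros z Hz.
  - apply Hpos. simpl in Hz. lra.
  - assert (Hz' : 0 < fst ((z + 1) + RtoC (INR k))%Cx).
    { rewrite S_INR in Hz. simpl in *. lra. }
    specialize (IH _ Hz').
    replace C1 with ((1 + (z + 1) * RtoC 0) * C1)%Cx by (change (RtoC 0) with C0; ring).
    apply (C_cv_ext_loc (fun n => ((1 + (z + 1) * RtoC (/ INR n)) *
       (rgamma (z + 1 + RtoC (INR (S n))) * gauss_scale (z + 1) n))%Cx) _ _ 1).
    + intros n Hn. assert (Hn0 : 0 < INR n) by (apply lt_0_INR; lia).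
      rewrite (rgamma_succ (z + RtoC (INR (S n)))), RtoC_inv by lra.
      unfold gauss_scale.
      replace ((z + 1) * RtoC (ln (INR n)))%Cx with (z * RtoC (ln (INR n)) + RtoC (ln (INR n)))%Cx
        by ring.
      rewrite Cexp_add, Cexp_RtoC, exp_ln, S_INR, RtoC_plus by exact Hn0.
      change (RtoC 1) with C1.
      replace (z + 1 + (RtoC (INR n) + 1))%Cx with (z + (RtoC (INR n) + 1) + 1)%Cx by ring.
      field. apply RtoC_neq; lra.
    + apply C_cv_mul; [|exact IH].
      apply C_cv_add; [apply C_cv_const|].
      apply C_cv_mul; [apply C_cv_const|]. apply C_cv_RtoC, is_lim_seq_inv_INR.
Qed.

(** If [rgamma z] vanished, so would every product in [rgamma_asymptotic], whose limit is 1. *)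
Lemma rgamma_neq0 (z : Cx) : 0 < fst z -> rgamma z <> C0.
Proof.
  intros Hz E.
  assert (H : C_cv (fun n => Cmul (rgamma (z + RtoC (INR (S n)))%Cx) (gauss_scale z n)) C0).
  { apply (C_cv_ext (fun _ => C0)); [|apply C_cv_const]. intros n.
    assert (Hr : rgamma_seq z n <> C0).
    { rewrite rgamma_seqE. apply Cmul_neq0; [now apply rising_neq0|].
      apply Cinv_neq0, gauss_scale_neq0. }
    apply (Cmul_cancel_l (rgamma_seq z n) _ _ Hr). rewrite <- rgamma_seq_gauss, E. ring. }
  apply C1_neq_C0. exact (C_cv_unique _ _ _ (rgamma_asymptotic z) H).
Qed.

Lemma rising_1 (n : nat) : rising C1 n = RtoC (INR (fact n)).
Proof.
  induction n as [|n IH].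
  - reflexivity.
  - rewrite rising_S, IH, fact_simpl, mult_INR, S_INR, RtoC_mult, RtoC_plus.
    change (RtoC 1) with C1. ring.
Qed.

Lemma rgamma_1 : rgamma C1 = C1.
Proof.
  assert (H : C_cv (rgamma_seq C1) C1).
  2:{ exact (C_cv_unique _ _ _ (rgamma_cv C1) H). }
  replace C1 with (1 + RtoC 0)%Cx at 2 by (change (RtoC 0) with C0; ring).
  apply (C_cv_ext_loc (fun n => (1 + RtoC (/ INR n))%Cx) _ _ 1).
  - intros n Hn. assert (Hn0 : 0 < INR n) by (apply lt_0_INR; lia).
    rewrite rgamma_seqE, rising_1, RtoC_inv by lra. unfold gauss_scale.
    replace (1 * RtoC (ln (INR n)))%Cx with (RtoC (ln (INR n))) by ring.
    rewrite Cexp_RtoC, exp_ln, fact_simpl, mult_INR, S_INR, RtoC_mult, RtoC_plus by exact Hn0.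
    change (RtoC 1) with C1.
    field. split; apply RtoC_neq; [lra|apply INR_fact_neq_0].
  - apply C_cv_add; [apply C_cv_const|]. apply C_cv_RtoC, is_lim_seq_inv_INR.
Qed.

Lemma Gamma_nat (n : nat) : Gamma (RtoC (INR (S n))) = RtoC (INR (fact n)).
Proof.
  unfold Gamma. pose proof (rgamma_rising C1 n) as H. rewrite rgamma_1, rising_1 in H.
  rewrite S_INR, RtoC_plus. change (RtoC 1) with C1.
  replace (RtoC (INR n) + 1)%Cx with (1 + RtoC (INR n))%Cx by ring.
  assert (Hf : RtoC (INR (fact n)) <> C0) by apply RtoC_neq, INR_fact_neq_0.
  assert (E : rgamma (1 + RtoC (INR n)) = Cinv (RtoC (INR (fact n)))).
  { apply (Cmul_cancel_l (RtoC (INR (fact n))) _ _ Hf). rewrite <- H. field. exact Hf. }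
  rewrite E. apply Cinv_Cinv.
Qed.

Lemma rgamma_nonpos (n : nat) : rgamma (RtoC (- INR n)) = C0.
Proof.
  induction n as [|n IH].
  - rewrite rgamma_succ. simpl INR. rewrite Ropp_0. change (RtoC 0) with C0. ring.
  - rewrite rgamma_succ.
    replace (RtoC (- INR (S n)) + 1)%Cx with (RtoC (- INR n)).
    + rewrite IH. ring.
    + rewrite S_INR. change C1 with (RtoC 1). rewrite <- RtoC_plus. f_equal. ring.
Qed.

Lemma Cnorm_gauss_scale (z : Cx) (n : nat) :
  Cnorm (gauss_scale z n) = INR (fact n) * exp (fst z * ln (INR n)).
Proof.
  unfold gauss_scale. rewrite Cnorm_mul, Cnorm_RtoC, Cnorm_Cexp, Rabs_right
    by apply Rle_ge, pos_INR.
  f_equal. f_equal. simpl. ring.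
Qed.

(** In fact (a-n)_n = (-1)^n (1-a)_n. In modulus this does the work of the reflection formula for
    arguments going to the left. *)
Lemma Cnorm_rising_reflect (a : Cx) (n : nat) :
  Cnorm (rising (a - RtoC (INR n)) n) = Cnorm (rising (1 - a) n).
Proof.
  induction n as [|n IH]; [reflexivity|].
  rewrite rising_S_l, rising_S, !Cnorm_mul.
  replace (a - RtoC (INR (S n)) + 1)%Cx with (a - RtoC (INR n))%Cx
    by (rewrite S_INR, RtoC_plus; change (RtoC 1) with C1; ring).
  rewrite IH, Rmult_comm. f_equal.
  rewrite <- Cnorm_opp. f_equal. rewrite S_INR, RtoC_plus. change (RtoC 1) with C1. ring.
Qed.

(* The factorials produced by the two factors cancel, leaving a power of [n]. *)
Lemma rgamma_pair_bound (a c : Cx) :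
  exists M, 0 < M /\ forall n, (1 <= n)%nat ->
  Cnorm (rgamma (a - RtoC (INR (S n))) * rgamma (c + RtoC (INR (S n))))%Cx
    <= M * exp ((1 - fst a - fst c) * ln (INR n)).
Proof.
  destruct (C_cv_bounded _ _ (rgamma_asymptotic c)) as [M1 [HM1 H1]].
  destruct (C_cv_bounded _ _ (rgamma_cv (1 - a))) as [M2 [HM2 H2]].
  pose proof (Cnorm_ge0 (rgamma a)) as Ha.
  exists (M1 * M2 * (Cnorm (rgamma a) + 1)).
  split; [apply Rmult_lt_0_compat; [apply Rmult_lt_0_compat|]; lra|].
  intros n Hn. specialize (H1 n). specialize (H2 n).
  assert (Hf : 0 < INR (fact n)) by apply INR_fact_lt_0.
  rewrite Cnorm_mul, (rgamma_rising (a - RtoC (INR (S n))) (S n)).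
  replace (a - RtoC (INR (S n)) + RtoC (INR (S n)))%Cx with a by ring.
  rewrite Cnorm_mul, Cnorm_rising_reflect.
  replace (rising (1 - a) (S n)) with (rgamma_seq (1 - a) n * gauss_scale (1 - a) n)%Cx
    by (rewrite rgamma_seqE; field; apply gauss_scale_neq0).
  rewrite Cnorm_mul, Cnorm_gauss_scale.
  rewrite Cnorm_mul, Cnorm_gauss_scale in H1.
  set (x := Cnorm (rgamma (c + RtoC (INR (S n))))) in *.
  set (y := Cnorm (rgamma_seq (1 - a) n)) in *.
  set (L := ln (INR n)) in *.
  replace (fst (1 - a)%Cx) with (1 - fst a) by (simpl; ring).
  replace ((1 - fst a - fst c) * L) with ((1 - fst a) * L + - (fst c * L)) by ring.
  rewrite exp_plus, exp_Ropp.
  set (E1 := exp ((1 - fst a) * L)). set (E2 := exp (fst c * L)) in *.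
  assert (HE1 : 0 < E1) by apply exp_pos. assert (HE2 : 0 < E2) by apply exp_pos.
  assert (Hx : 0 <= x) by apply Cnorm_ge0. assert (Hy : 0 <= y) by apply Cnorm_ge0.
  replace (y * (INR (fact n) * E1) * Cnorm (rgamma a) * x) with
    ((x * (INR (fact n) * E2)) * y * Cnorm (rgamma a) * (E1 * / E2)) by (field; lra).
  apply Rmult_le_compat_r.
  - apply Rmult_le_pos; [lra|]. apply Rlt_le, Rinv_0_lt_compat, HE2.
  - apply Rmult_le_compat; try lra.
    + apply Rmult_le_pos; [|exact Hy]. apply Rmult_le_pos; [exact Hx|]. nra.
    + apply Rmult_le_compat; try lra. apply Rmult_le_pos; nra.
Qed.

(** Changing the sign of l exchanges [a] and [c], under which the exponent is symmetric; the sign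
    [s] covers both ends of the integers at once. *)
Lemma rgamma_pair_bound_Z (a c : Cx) :
  exists M, 0 < M /\ forall n, (1 <= n)%nat -> forall s, s = 1%Z \/ s = (-1)%Z ->
  Cnorm (rgamma (a - RtoC (IZR (s * Z.of_nat (S n)))) * rgamma (c + RtoC (IZR (s * Z.of_nat (S n)))))%Cx
    <= M * exp ((1 - fst a - fst c) * ln (INR n)).
Proof.
  destruct (rgamma_pair_bound a c) as [M1 [HM1 H1]].
  destruct (rgamma_pair_bound c a) as [M2 [HM2 H2]].
  exists (M1 + M2). split; [lra|]. intros n Hn s Hs.
  specialize (H1 n Hn). specialize (H2 n Hn).
  replace (1 - fst c - fst a) with (1 - fst a - fst c) in H2 by ring.
  pose proof (exp_pos ((1 - fst a - fst c) * ln (INR n))).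
  rewrite mult_IZR, <- INR_IZR_INZ.
  destruct Hs as [-> | ->]; rewrite ?Rmult_1_l.
  - nra.
  - replace (-1 * INR (S n)) with (- INR (S n)) by ring. rewrite RtoC_opp.
    replace (a - - RtoC (INR (S n)))%Cx with (a + RtoC (INR (S n)))%Cx by ring.
    replace (c + - RtoC (INR (S n)))%Cx with (c - RtoC (INR (S n)))%Cx by ring.
    rewrite Cnorm_mul, Rmult_comm, <- Cnorm_mul. nra.
Qed.

(** * Bilateral sums *)

Fixpoint bsum (T : Z -> Cx) (K : nat) : Cx :=
  match K with
  | O => T 0%Z
  | S k => (bsum T k + (T (Z.of_nat K) + T (- Z.of_nat K)%Z))%Cx
  end.

Lemma bsum_ext (T U : Z -> Cx) (K : nat) : (forall l, T l = U l) -> bsum T K = bsum U K.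
Proof. intros H. induction K as [|K IH]; simpl; [|rewrite IH]; now rewrite !H. Qed.

Lemma bsum_reflect (T : Z -> Cx) (K : nat) : bsum (fun l => T (- l)%Z) K = bsum T K.
Proof.
  induction K as [|K IH]; [reflexivity|].
  cbn [bsum]. rewrite IH, Z.opp_involutive. ring.
Qed.

Lemma bsum_scal (x : Cx) (T : Z -> Cx) (K : nat) :
  bsum (fun l => Cmul x (T l)) K = Cmul x (bsum T K).
Proof.
  induction K as [|K IH]; [reflexivity|]. cbn [bsum]. rewrite IH. ring.
Qed.

Lemma bsum_telescope (x y : Cx) (T U g : Z -> Cx) (K : nat) :
  (forall l, Csub (x * T l) (y * U l) = Csub (g l) (g (l + 1)%Z)) ->
  (x * bsum T K - y * bsum U K)%Cx = (g (- Z.of_nat K)%Z - g (Z.of_nat K + 1)%Z)%Cx.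
Proof.
  intros H. induction K as [|K IH].
  - exact (H 0%Z).
  - cbn [bsum].
    replace (x * (bsum T K + (T (Z.of_nat (S K)) + T (- Z.of_nat (S K))%Z)) -
      y * (bsum U K + (U (Z.of_nat (S K)) + U (- Z.of_nat (S K))%Z)))%Cx
      with ((x * bsum T K - y * bsum U K) +
        ((x * T (Z.of_nat (S K)) - y * U (Z.of_nat (S K))) +
         (x * T (- Z.of_nat (S K))%Z - y * U (- Z.of_nat (S K))%Z)))%Cx by ring.
    rewrite IH, !H.
    replace (- Z.of_nat (S K) + 1)%Z with (- Z.of_nat K)%Z by lia.
    replace (Z.of_nat (S K)) with (Z.of_nat K + 1)%Z by lia. ring.
Qed.

Definition quadratic_decay (T : Z -> Cx) (M : R) : Prop :=
  forall k, (1 <= k)%nat ->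
    Cnorm (T (Z.of_nat k)) <= M / (INR k * INR k) /\
    Cnorm (T (- Z.of_nat k)%Z) <= M / (INR k * INR k).

(** Each new term is at most M/(J+1)^2 <= M(1/J - 1/(J+1)), which telescopes; the factor 2 counts
    the two ends. *)
Lemma bsum_tail (T : Z -> Cx) (M : R) : 0 < M -> quadratic_decay T M ->
  forall K J, (1 <= K <= J)%nat ->
  Cnorm (bsum T J - bsum T K)%Cx <= 2 * M * (/ INR K - / INR J).
Proof.
  intros HM HT K J [HK HJ]. induction HJ as [|J HJ IH].
  - replace (bsum T K - bsum T K)%Cx with C0 by ring. rewrite Cnorm_0. lra.
  - cbn [bsum].
    assert (HJ1 : 1 <= INR J) by (apply (le_INR 1); lia).
    destruct (HT (S J) ltac:(lia)) as [H1 H2].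
    replace (bsum T J + (T (Z.of_nat (S J)) + T (- Z.of_nat (S J))%Z) - bsum T K)%Cx
      with ((bsum T J - bsum T K) + (T (Z.of_nat (S J)) + T (- Z.of_nat (S J))%Z))%Cx by ring.
    eapply Rle_trans; [apply Cnorm_add|].
    eapply Rle_trans; [apply Rplus_le_compat_l, Cnorm_add|].
    assert (M / (INR (S J) * INR (S J)) <= M * (/ INR J - / INR (S J))).
    { rewrite S_INR.
      replace (M * (/ INR J - / (INR J + 1))) with (M / (INR J * (INR J + 1))) by (field; lra).
      apply Rmult_le_compat_l; [lra|]. apply Rinv_le_contravar; nra. }
    lra.
Qed.

Lemma bsum_cv (T : Z -> Cx) (M : R) : 0 < M -> quadratic_decay T M ->
  C_cv (bsum T) (Clim (bsum T)).
Proof.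
  intros HM HT. destruct (C_cauchy_cv (bsum T)) as [l Hl]; [|now apply C_cv_Clim with l].
  intros eps He. destruct (INR_unbounded (2 * M / eps)) as [N HN].
  assert (0 < 2 * M / eps) by (apply Rdiv_lt_0_compat; lra).
  exists N. assert (HN0 : (1 <= N)%nat).
  { destruct N; [simpl in HN; lra|lia]. }
  intros n Hn. eapply Rle_lt_trans; [apply (bsum_tail T M HM HT); lia|].
  assert (0 < / INR n) by (apply Rinv_0_lt_compat, lt_0_INR; lia).
  assert (2 * M * / INR N < eps).
  { apply (Rmult_lt_reg_r (INR N)); [lra|]. rewrite Rmult_assoc, Rinv_l by lra.
    apply (Rmult_lt_compat_r eps) in HN; [|exact He]. unfold Rdiv in HN.
    rewrite Rmult_assoc, Rinv_l in HN by lra. lra. }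
  nra.
Qed.

Lemma bsum_lim_tail (T : Z -> Cx) (M : R) (s : Cx) : 0 < M -> quadratic_decay T M ->
  C_cv (bsum T) s -> forall K, (1 <= K)%nat -> Cnorm (s - bsum T K)%Cx <= 2 * M / INR K.
Proof.
  intros HM HT Hs K HK.
  apply C_cv_norm_le with (u := fun J => (bsum T J - bsum T K)%Cx) (N := K).
  - apply C_cv_sub; [exact Hs|apply C_cv_const].
  - intros J HJ. eapply Rle_trans; [apply (bsum_tail T M HM HT); lia|].
    assert (0 < / INR J) by (apply Rinv_0_lt_compat, lt_0_INR; lia).
    unfold Rdiv. nra.
Qed.

Lemma bsum_cv_pointwise (T : nat -> Z -> Cx) (U : Z -> Cx) (K : nat) :
  (forall l, C_cv (fun n => T n l) (U l)) -> C_cv (fun n => bsum (T n) K) (bsum U K).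
Proof.
  intros H. induction K as [|K IH]; cbn [bsum]; [apply H|].
  apply C_cv_add; [exact IH|]. now apply C_cv_add.
Qed.

(** Dominated convergence for series: the common majorant makes the tails beyond some K uniformly
    small, and the finite part converges term by term. *)
Lemma bsum_tannery (T : nat -> Z -> Cx) (U : Z -> Cx) (s : nat -> Cx) (t : Cx) (M : R) (n0 : nat) :
  0 < M -> (forall n, (n >= n0)%nat -> quadratic_decay (T n) M) -> quadratic_decay U M ->
  (forall l, C_cv (fun n => T n l) (U l)) ->
  (forall n, (n >= n0)%nat -> C_cv (bsum (T n)) (s n)) -> C_cv (bsum U) t ->
  C_cv s t.
Proof.
  intros HM HT HU HTU Hs Ht eps He.
  destruct (INR_unbounded (2 * M / (eps / 3))) as [K HK].
  assert (0 < 2 * M / (eps / 3)) by (apply Rdiv_lt_0_compat; lra).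
  assert (HK1 : (1 <= K)%nat) by (destruct K; [simpl in HK; lra|lia]).
  assert (HKe : 2 * M / INR K < eps / 3).
  { apply (Rmult_lt_reg_r (INR K)); [lra|]. unfold Rdiv at 1.
    rewrite Rmult_assoc, Rinv_l by lra.
    apply (Rmult_lt_compat_r (eps / 3)) in HK; [|lra]. unfold Rdiv at 1 in HK.
    rewrite Rmult_assoc, Rinv_l in HK by lra. lra. }
  destruct (bsum_cv_pointwise T U K HTU (eps / 3)) as [N HN]; [lra|].
  exists (max n0 N). intros n Hn. specialize (HN n ltac:(lia)).
  pose proof (bsum_lim_tail (T n) M (s n) HM (HT n ltac:(lia)) (Hs n ltac:(lia)) K HK1) as H1.
  pose proof (bsum_lim_tail U M t HM HU Ht K HK1) as H2.
  rewrite Cnorm_sub_sym in H2.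
  replace (s n - t)%Cx with ((s n - bsum (T n) K) + ((bsum (T n) K - bsum U K) + (bsum U K - t)))%Cx
    by ring.
  eapply Rle_lt_trans; [apply Cnorm_add|].
  eapply Rle_lt_trans; [apply Rplus_le_compat_l, Cnorm_add|]. lra.
Qed.

(** The Gamma estimates bound the term at n + 1 through n. The factor 4 pays for (n+1)^2 <= 4 n^2,
    and the terms at 1 and -1, which the hypothesis does not reach, are added to the constant. *)
Lemma quadratic_decay_shift (T : Z -> Cx) (M : R) : 0 < M ->
  (forall n, (1 <= n)%nat -> forall s, s = 1%Z \/ s = (-1)%Z ->
     Cnorm (T (s * Z.of_nat (S n))%Z) <= M / (INR n * INR n)) ->
  exists M', 0 < M' /\ quadratic_decay T M'.
Proof.
  intros HM H.
  pose proof (Cnorm_ge0 (T 1%Z)). pose proof (Cnorm_ge0 (T (-1)%Z)).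
  set (M' := 4 * M + Cnorm (T 1%Z) + Cnorm (T (-1)%Z)).
  exists M'. split; [unfold M'; lra|].
  intros [|[|k]] Hk; [lia| |].
  - simpl. split; unfold M'; lra.
  - set (n := S k).
    assert (Hn : 1 <= INR n) by (apply (le_INR 1); lia).
    assert (HMM : M / (INR n * INR n) <= M' / (INR (S n) * INR (S n))).
    { rewrite (S_INR n). apply Rle_trans with (4 * M / ((INR n + 1) * (INR n + 1))).
      - apply (Rmult_le_reg_r ((INR n * INR n) * ((INR n + 1) * (INR n + 1)))); [nra|].
        replace (M / (INR n * INR n) * (INR n * INR n * ((INR n + 1) * (INR n + 1))))
          with (M * ((INR n + 1) * (INR n + 1))) by (field; lra).
        replace (4 * M / ((INR n + 1) * (INR n + 1)) * (INR n * INR n * ((INR n + 1) * (INR n + 1))))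
          with (M * (4 * (INR n * INR n))) by (field; lra).
        apply Rmult_le_compat_l; [lra|nra].
      - apply Rmult_le_compat_r; [|unfold M'; lra].
        apply Rlt_le, Rinv_0_lt_compat; nra. }
    split; (eapply Rle_trans; [|exact HMM]).
    + replace (Z.of_nat (S n)) with (1 * Z.of_nat (S n))%Z by lia. apply H; [lia|now left].
    + replace (- Z.of_nat (S n))%Z with (-1 * Z.of_nat (S n))%Z by lia. apply H; [lia|now right].
Qed.

Lemma ln_INR_ge0 (n : nat) : (1 <= n)%nat -> 0 <= ln (INR n).
Proof.
  intros Hn. rewrite <- ln_1. apply ln_le; [lra|]. now apply (le_INR 1).
Qed.

Lemma exp_ln_power_le (x : R) (n : nat) : (1 <= n)%nat -> x <= -2 ->
  exp (x * ln (INR n)) <= / (INR n * INR n).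
Proof.
  intros Hn Hx. assert (H1 : 1 <= INR n) by (apply (le_INR 1); lia).
  pose proof (ln_INR_ge0 n Hn) as H0.
  replace (/ (INR n * INR n)) with (exp (-2 * ln (INR n))).
  - assert (Hle : x * ln (INR n) <= -2 * ln (INR n)) by nra.
    destruct Hle as [Hlt|Heq]; [apply Rlt_le, exp_increasing, Hlt|rewrite Heq; lra].
  - replace (-2 * ln (INR n)) with (- (ln (INR n) + ln (INR n))) by ring.
    rewrite exp_Ropp, exp_plus, exp_ln by lra. reflexivity.
Qed.

(** * Dougall's bilateral sum *)

Definition pair_term (a c : Cx) (l : Z) : Cx :=
  (rgamma (a - RtoC (IZR l)) * rgamma (c + RtoC (IZR l)))%Cx.

Definition dougall_term (a b c d : Cx) (l : Z) : Cx :=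
  (pair_term a c l * pair_term b d l)%Cx.

Lemma pair_term_decay (a c : Cx) : 3 <= fst a + fst c ->
  exists M, 0 < M /\ quadratic_decay (pair_term a c) M.
Proof.
  intros H. destruct (rgamma_pair_bound_Z a c) as [M [HM HB]].
  apply quadratic_decay_shift with M; [exact HM|].
  intros n Hn s Hs. eapply Rle_trans; [exact (HB n Hn s Hs)|].
  apply Rmult_le_compat_l; [lra|]. apply exp_ln_power_le; [exact Hn|lra].
Qed.

Lemma dougall_term_bound (a b c d : Cx) :
  exists M, 0 < M /\ forall n, (1 <= n)%nat -> forall s, s = 1%Z \/ s = (-1)%Z ->
  Cnorm (dougall_term a b c d (s * Z.of_nat (S n)))
    <= M * exp ((2 - fst a - fst b - fst c - fst d) * ln (INR n)).
Proof.
  destruct (rgamma_pair_bound_Z a c) as [M1 [HM1 H1]].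
  destruct (rgamma_pair_bound_Z b d) as [M2 [HM2 H2]].
  exists (M1 * M2). split; [nra|]. intros n Hn s Hs.
  specialize (H1 n Hn s Hs). specialize (H2 n Hn s Hs).
  unfold dougall_term, pair_term. rewrite Cnorm_mul.
  replace ((2 - fst a - fst b - fst c - fst d) * ln (INR n)) with
    ((1 - fst a - fst c) * ln (INR n) + (1 - fst b - fst d) * ln (INR n)) by ring.
  rewrite exp_plus.
  eapply Rle_trans.
  - apply Rmult_le_compat; [apply Cnorm_ge0|apply Cnorm_ge0|exact H1|exact H2].
  - right; ring.
Qed.

(** The terms are O(n^(2-s)), s being the sum of the real parts, so s >= 4 yields n^(-2). *)
Lemma dougall_term_decay (a b c d : Cx) : 4 <= fst a + fst b + fst c + fst d ->
  exists M, 0 < M /\ quadratic_decay (dougall_term a b c d) M.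
Proof.
  intros H. destruct (dougall_term_bound a b c d) as [M [HM HB]].
  apply quadratic_decay_shift with M; [exact HM|].
  intros n Hn s Hs. eapply Rle_trans; [exact (HB n Hn s Hs)|].
  apply Rmult_le_compat_l; [lra|]. apply exp_ln_power_le; [exact Hn|lra].
Qed.

Definition dougall_sum (a b c d : Cx) : Cx := Clim (bsum (dougall_term a b c d)).

Lemma dougall_sum_cv (a b c d : Cx) : 4 <= fst a + fst b + fst c + fst d ->
  C_cv (bsum (dougall_term a b c d)) (dougall_sum a b c d).
Proof.
  intros H. destruct (dougall_term_decay a b c d H) as [M [HM HD]]. exact (bsum_cv _ M HM HD).
Qed.

Lemma dougall_sum_swap (a b c d : Cx) : dougall_sum a b c d = dougall_sum b a d c.
Proof.
  unfold dougall_sum. f_equal. apply FunctionalExtensionality.functional_extensionality.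
  intros K. apply bsum_ext. intros l. unfold dougall_term. ring.
Qed.

Lemma dougall_sum_reflect (a b c d : Cx) : dougall_sum a b c d = dougall_sum c d a b.
Proof.
  unfold dougall_sum. f_equal. apply FunctionalExtensionality.functional_extensionality.
  intros K. rewrite <- bsum_reflect. apply bsum_ext. intros l.
  unfold dougall_term, pair_term. rewrite opp_IZR, RtoC_opp.
  replace (a - - RtoC (IZR l))%Cx with (a + RtoC (IZR l))%Cx by ring.
  replace (b - - RtoC (IZR l))%Cx with (b + RtoC (IZR l))%Cx by ring.
  replace (c + - RtoC (IZR l))%Cx with (c - RtoC (IZR l))%Cx by ring.
  replace (d + - RtoC (IZR l))%Cx with (d - RtoC (IZR l))%Cx by ring.
  ring.
Qed.

(* [1 + 1 + 1] instead of [RtoC 3] keeps such identities within reach of [ring]. *)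
Lemma dougall_sum_shift (a b c d : Cx) : 4 <= fst a + fst b + fst c + fst d ->
  ((a + c - 1) * (a + d - 1) * dougall_sum (a + 1) b c d
   = (a + b + c + d - (1 + 1 + 1)) * dougall_sum a b c d)%Cx.
Proof.
  intros Hs.
  set (X := ((a + c - 1) * (a + d - 1))%Cx). set (Y := (a + b + c + d - (1 + 1 + 1))%Cx).
  (* The telescoping certificate. With 1/(Gamma(a-l+1) Gamma(b-l) Gamma(c+l) Gamma(d+l)) factored
     out, what remains is X - Y(a-l) = (c+l-1)(d+l-1) - (a-l)(b-l-1). *)
  set (g := fun l : Z => (dougall_term (a + 1) b (c - 1) (d - 1) l)).
  assert (Hg : forall l, (X * dougall_term (a + 1) b c d l - Y * dougall_term a b c d l)%Cx
                         = (g l - g (l + 1)%Z)%Cx).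
  { intros l. unfold g, dougall_term, pair_term, X, Y. rewrite plus_IZR, RtoC_plus.
    change (RtoC 1) with C1. set (x := RtoC (IZR l)).
    replace (a + 1 - x)%Cx with ((a - x) + 1)%Cx by ring.
    replace (a + 1 - (x + 1))%Cx with (a - x)%Cx by ring.
    replace (c - 1 + (x + 1))%Cx with (c + x)%Cx by ring.
    replace (d - 1 + (x + 1))%Cx with (d + x)%Cx by ring.
    rewrite (rgamma_succ (a - x)), (rgamma_succ (b - (x + 1))),
      (rgamma_succ (c - 1 + x)), (rgamma_succ (d - 1 + x)).
    replace (b - (x + 1) + 1)%Cx with (b - x)%Cx by ring.
    replace (c - 1 + x + 1)%Cx with (c + x)%Cx by ring.
    replace (d - 1 + x + 1)%Cx with (d + x)%Cx by ring. ring. }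
  (* The parameters of [g] add up to one less than a+b+c+d, so [g] is still O(1/n) and the boundary
     terms vanish. *)
  assert (Hg0 : exists M, 0 < M /\ forall n, (1 <= n)%nat -> forall s, s = 1%Z \/ s = (-1)%Z ->
     Cnorm (g (s * Z.of_nat (S n))%Z) <= M * exp (-1 * ln (INR n))).
  { destruct (dougall_term_bound (a + 1) b (c - 1) (d - 1)) as [M [HM HB]].
    exists M. split; [exact HM|]. intros n Hn s Hs'. eapply Rle_trans; [exact (HB n Hn s Hs')|].
    apply Rmult_le_compat_l; [lra|].
    assert (H1 : 1 <= INR n) by (apply (le_INR 1); lia).
    pose proof (ln_INR_ge0 n Hn) as H0.
    assert (Hle : (2 - fst (a + 1)%Cx - fst b - fst (c - 1)%Cx - fst (d - 1)%Cx) * ln (INR n)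
                  <= -1 * ln (INR n)) by (apply Rmult_le_compat_r; simpl; lra).
    destruct Hle as [Hlt|Heq]; [apply Rlt_le, exp_increasing, Hlt|rewrite Heq; lra]. }
  destruct Hg0 as [M [HM HB]].
  assert (Hg1 : forall s, s = 1%Z \/ s = (-1)%Z ->
     forall eps, eps > 0 -> exists N, forall n, (n >= N)%nat -> Cnorm (g (s * Z.of_nat n)%Z) < eps).
  { intros s Hs' eps He. destruct (INR_unbounded (M / eps)) as [N HN].
    assert (0 < M / eps) by (apply Rdiv_lt_0_compat; lra).
    exists (S (S N)). intros [|n] Hn; [lia|].
    eapply Rle_lt_trans; [apply HB; [lia|exact Hs']|].
    assert (Hn1 : INR (S N) <= INR n) by (apply le_INR; lia). rewrite S_INR in Hn1.
    replace (-1 * ln (INR n)) with (- ln (INR n)) by ring.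
    rewrite exp_Ropp, exp_ln by lra.
    apply (Rmult_lt_reg_r (INR n)); [lra|]. rewrite Rmult_assoc, Rinv_l, Rmult_1_r by lra.
    replace M with (eps * (M / eps)) by (field; lra). apply Rmult_lt_compat_l; lra. }
  assert (H1 : C_cv (fun K => (X * bsum (dougall_term (a + 1) b c d) K -
                               Y * bsum (dougall_term a b c d) K)%Cx)
                    (X * dougall_sum (a + 1) b c d - Y * dougall_sum a b c d)%Cx).
  { apply C_cv_sub; (apply C_cv_mul; [apply C_cv_const|]); apply dougall_sum_cv;
      simpl; lra. }
  assert (H2 : C_cv (fun K => (X * bsum (dougall_term (a + 1) b c d) K -
                               Y * bsum (dougall_term a b c d) K)%Cx) C0).
  { apply (C_cv_ext (fun K => (g (- Z.of_nat K)%Z - g (Z.of_nat K + 1)%Z)%Cx)).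
    - intros K. symmetry. now apply bsum_telescope.
    - replace C0 with (0 - 0)%Cx by ring. apply C_cv_sub.
      + intros eps He. destruct (Hg1 (-1)%Z (or_intror eq_refl) eps He) as [N HN].
        exists N. intros n Hn. specialize (HN n Hn).
        replace (g (- Z.of_nat n)%Z - 0)%Cx with (g (-1 * Z.of_nat n)%Z); [exact HN|].
        replace (-1 * Z.of_nat n)%Z with (- Z.of_nat n)%Z by lia. ring.
      + intros eps He. destruct (Hg1 1%Z (or_introl eq_refl) eps He) as [N HN].
        exists N. intros n Hn. specialize (HN (S n) ltac:(lia)).
        replace (g (Z.of_nat n + 1)%Z - 0)%Cx with (g (1 * Z.of_nat (S n))%Z); [exact HN|].
        replace (1 * Z.of_nat (S n))%Z with (Z.of_nat n + 1)%Z by lia. ring. }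
  pose proof (C_cv_unique _ _ _ H1 H2) as E.
  replace (X * dougall_sum (a + 1) b c d)%Cx with
    (X * dougall_sum (a + 1) b c d - Y * dougall_sum a b c d + Y * dougall_sum a b c d)%Cx by ring.
  rewrite E. ring.
Qed.

Definition dougall_value (a b c d : Cx) : Cx :=
  (Gamma (a + b + c + d - (1 + 1 + 1)) *
   (rgamma (a + c - 1) * rgamma (a + d - 1) * rgamma (b + c - 1) * rgamma (b + d - 1)))%Cx.

(** The first four conditions put the arguments of the [rgamma] factors of [dougall_value] in the
    right half-plane, where [rgamma] has no zeros; the last one gives quadratic decay of the
    terms. *)
Definition dougall_region (a b c d : Cx) : Prop :=
  1 < fst a + fst c /\ 1 < fst a + fst d /\ 1 < fst b + fst c /\ 1 < fst b + fst d /\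
  4 <= fst a + fst b + fst c + fst d.

Lemma dougall_value_neq0 (a b c d : Cx) : dougall_region a b c d -> dougall_value a b c d <> C0.
Proof.
  intros (H1 & H2 & H3 & H4 & H5). unfold dougall_value, Gamma.
  repeat apply Cmul_neq0; try apply Cinv_neq0; apply rgamma_neq0; simpl; lra.
Qed.

Lemma dougall_value_swap (a b c d : Cx) : dougall_value a b c d = dougall_value b a d c.
Proof.
  unfold dougall_value. replace (b + a + d + c)%Cx with (a + b + c + d)%Cx by ring. ring.
Qed.

Lemma dougall_value_reflect (a b c d : Cx) : dougall_value a b c d = dougall_value c d a b.
Proof.
  unfold dougall_value. replace (c + d + a + b)%Cx with (a + b + c + d)%Cx by ring.
  replace (c + a)%Cx with (a + c)%Cx by ring. replace (c + b)%Cx with (b + c)%Cx by ring.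
  replace (d + a)%Cx with (a + d)%Cx by ring. replace (d + b)%Cx with (b + d)%Cx by ring. ring.
Qed.

Lemma dougall_value_shift (a b c d : Cx) : dougall_region a b c d ->
  ((a + c - 1) * (a + d - 1) * dougall_value (a + 1) b c d
   = (a + b + c + d - (1 + 1 + 1)) * dougall_value a b c d)%Cx.
Proof.
  intros (H1 & H2 & H3 & H4 & H5). unfold dougall_value, Gamma.
  set (s := (a + b + c + d - (1 + 1 + 1))%Cx).
  replace (a + 1 + b + c + d - (1 + 1 + 1))%Cx with (s + 1)%Cx by (unfold s; ring).
  rewrite (rgamma_succ s), (rgamma_succ (a + c - 1)), (rgamma_succ (a + d - 1)).
  replace (a + c - 1 + 1)%Cx with (a + c)%Cx by ring.
  replace (a + d - 1 + 1)%Cx with (a + d)%Cx by ring.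
  replace (a + 1 + c - 1)%Cx with (a + c)%Cx by ring.
  replace (a + 1 + d - 1)%Cx with (a + d)%Cx by ring.
  assert (Hs : s <> C0) by (apply Re_pos_neq0; unfold s; simpl; lra).
  assert (Hs1 : rgamma (s + 1) <> C0) by (apply rgamma_neq0; unfold s; simpl; lra).
  field. auto.
Qed.

Definition dougall_ratio (a b c d : Cx) : Cx := (dougall_sum a b c d / dougall_value a b c d)%Cx.

Lemma dougall_region_succ (a b c d : Cx) :
  dougall_region a b c d -> dougall_region (a + 1)%Cx b c d.
Proof. unfold dougall_region; simpl; lra. Qed.

Lemma dougall_ratio_succ (a b c d : Cx) : dougall_region a b c d ->
  dougall_ratio (a + 1) b c d = dougall_ratio a b c d.
Proof.
  intros H. pose proof (dougall_value_shift a b c d H) as HV.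
  assert (HS : ((a + c - 1) * (a + d - 1) * dougall_sum (a + 1) b c d
   = (a + b + c + d - (1 + 1 + 1)) * dougall_sum a b c d)%Cx).
  { apply dougall_sum_shift. unfold dougall_region in H. lra. }
  pose proof (dougall_value_neq0 _ _ _ _ H) as H0.
  pose proof (dougall_value_neq0 _ _ _ _ (dougall_region_succ _ _ _ _ H)) as H1.
  destruct H as (Ha & Hb & _).
  set (X := ((a + c - 1) * (a + d - 1))%Cx) in *.
  assert (HX : X <> C0).
  { apply Cmul_neq0; apply Re_pos_neq0; simpl; lra. }
  unfold dougall_ratio. apply (Cmul_cancel_l (X * dougall_value (a + 1) b c d)%Cx).
  { now apply Cmul_neq0. }
  transitivity (X * dougall_sum (a + 1) b c d)%Cx; [field; exact H1|].
  rewrite HS, HV. field. exact H0.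
Qed.

Lemma dougall_ratio_swap (a b c d : Cx) : dougall_ratio a b c d = dougall_ratio b a d c.
Proof. unfold dougall_ratio. now rewrite dougall_sum_swap, dougall_value_swap. Qed.

Lemma dougall_ratio_reflect (a b c d : Cx) : dougall_ratio a b c d = dougall_ratio c d a b.
Proof. unfold dougall_ratio. now rewrite dougall_sum_reflect, dougall_value_reflect. Qed.

(** The shift of [c] is the shift of [a] seen through the reflection l -> -l. *)
Lemma dougall_ratio_shift (a b c d : Cx) (n : nat) : dougall_region a b c d ->
  dougall_ratio (a + RtoC (INR n)) b (c + RtoC (INR n)) d = dougall_ratio a b c d.
Proof.
  intros H.
  enough (E : dougall_region (a + RtoC (INR n)) b (c + RtoC (INR n)) d /\
    dougall_ratio (a + RtoC (INR n)) b (c + RtoC (INR n)) d = dougall_ratio a b c d) by apply E.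
  induction n as [|n [IH1 IH2]].
  - simpl INR. change (RtoC 0) with C0.
    replace (a + 0)%Cx with a by ring. replace (c + 0)%Cx with c by ring. now split.
  - rewrite S_INR, RtoC_plus. change (RtoC 1) with C1.
    replace (a + (RtoC (INR n) + 1))%Cx with (a + RtoC (INR n) + 1)%Cx by ring.
    replace (c + (RtoC (INR n) + 1))%Cx with (c + RtoC (INR n) + 1)%Cx by ring.
    set (a' := (a + RtoC (INR n))%Cx) in *. set (c' := (c + RtoC (INR n))%Cx) in *.
    split; [unfold dougall_region in *; simpl in *; lra|].
    rewrite dougall_ratio_succ, dougall_ratio_reflect, dougall_ratio_succ,
      dougall_ratio_reflect; [exact IH2| |]; unfold dougall_region in *; simpl in *; lra.
Qed.

(* Unlike [dougall_term], these quotients have a limit as [n -> oo], namely [1]. *)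
Definition normalized_pair (a c : Cx) (n : nat) (l : Z) : Cx :=
  (Cinv (rgamma (a + RtoC (INR (S n))) * rgamma (c + RtoC (INR (S n)))) *
   pair_term (a + RtoC (INR (S n))) (c + RtoC (INR (S n))) l)%Cx.

Lemma normalized_pair_opp (a c : Cx) (n : nat) (l : Z) :
  normalized_pair a c n (- l) = normalized_pair c a n l.
Proof.
  unfold normalized_pair, pair_term. rewrite opp_IZR, RtoC_opp.
  set (x := RtoC (IZR l)). set (y := RtoC (INR (S n))).
  replace (a + y - - x)%Cx with (a + y + x)%Cx by ring.
  replace (c + y + - x)%Cx with (c + y - x)%Cx by ring.
  replace (rgamma (a + y) * rgamma (c + y))%Cx with (rgamma (c + y) * rgamma (a + y))%Cx by ring.
  ring.
Qed.

Lemma normalized_pair_0 (a c : Cx) (n : nat) :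
  0 < fst a + INR (S n) -> 0 < fst c + INR (S n) -> normalized_pair a c n 0 = C1.
Proof.
  intros Ha Hc. unfold normalized_pair, pair_term. change (RtoC 0) with C0.
  set (y := RtoC (INR (S n))).
  replace (a + y - 0)%Cx with (a + y)%Cx by ring. replace (c + y + 0)%Cx with (c + y)%Cx by ring.
  assert (rgamma (a + y) <> C0) by (apply rgamma_neq0; exact Ha).
  assert (rgamma (c + y) <> C0) by (apply rgamma_neq0; exact Hc).
  field. auto.
Qed.

Lemma normalized_pair_S (a c : Cx) (n k : nat) : 0 < fst c + INR (S n) ->
  normalized_pair a c n (Z.of_nat (S k)) =
  (normalized_pair a c n (Z.of_nat k) *
   ((a + RtoC (INR n - INR k)) / (c + RtoC (INR n + 1 + INR k))))%Cx.
Proof.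
  intros Hc. unfold normalized_pair, pair_term.
  rewrite <- !INR_IZR_INZ, (S_INR k), (S_INR n).
  rewrite (S_INR n) in Hc. pose proof (pos_INR k).
  assert (Hd : (c + RtoC (INR n + 1 + INR k))%Cx <> C0) by (apply Re_pos_neq0; simpl; lra).
  revert Hd. rewrite RtoC_minus, !RtoC_plus. change (RtoC 1) with C1.
  set (x := RtoC (INR k)). set (y := RtoC (INR n)). intros Hd.
  rewrite (rgamma_succ (a + (y + 1) - (x + 1))), (rgamma_succ (c + (y + 1) + x)).
  replace (a + (y + 1) - (x + 1) + 1)%Cx with (a + (y + 1) - x)%Cx by ring.
  replace (c + (y + 1) + x + 1)%Cx with (c + (y + 1) + (x + 1))%Cx by ring.
  set (p := rgamma (a + (y + 1) - x)). set (q := rgamma (c + (y + 1) + (x + 1))).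
  set (i := Cinv (rgamma (a + (y + 1)) * rgamma (c + (y + 1)))).
  field. exact Hd.
Qed.

Lemma fst_ge_opp_Cnorm (a : Cx) : - Cnorm a <= fst a.
Proof. pose proof (Cnorm_fst a) as H. apply Rabs_le_between in H. lra. Qed.

(** The step from k to k+1 multiplies by (a+n-k)/(c+n+1+k). Under the conditions on [k0] and [n]
    this factor has modulus at most 2 for k < k0 and at most 1 afterwards, hence a bound uniform in
    n and k. *)
Lemma normalized_pair_bound (a c : Cx) (k0 n k : nat) :
  2 * (Cnorm a + Cnorm c) <= INR k0 -> (k0 <= n)%nat ->
  Cnorm (normalized_pair a c n (Z.of_nat k)) <= 2 ^ Nat.min k k0.
Proof.
  intros Hk0 Hn. apply le_INR in Hn.
  pose proof (Cnorm_ge0 a) as Ha. pose proof (Cnorm_ge0 c) as Hc.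
  pose proof (fst_ge_opp_Cnorm a). pose proof (fst_ge_opp_Cnorm c).
  induction k as [|k IH].
  - simpl Z.of_nat. rewrite normalized_pair_0 by (rewrite S_INR; lra).
    rewrite Cnorm_1. simpl. lra.
  - rewrite normalized_pair_S by (rewrite S_INR; lra). unfold Cdiv.
    rewrite !Cnorm_mul. pose proof (pos_INR k) as Hk.
    set (D := (c + RtoC (INR n + 1 + INR k))%Cx).
    assert (HD : INR n + 1 + INR k - Cnorm c <= Cnorm D).
    { pose proof (Cnorm_add_ge (RtoC (INR n + 1 + INR k)) c) as H1.
      rewrite Cnorm_RtoC, Rabs_right in H1 by lra.
      replace (RtoC (INR n + 1 + INR k) + c)%Cx with D in H1 by (unfold D; ring). lra. }
    assert (HD0 : 0 < Cnorm D) by lra.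
    assert (HN : Cnorm (a + RtoC (INR n - INR k))%Cx <= Cnorm a + Rabs (INR n - INR k)).
    { eapply Rle_trans; [apply Cnorm_add|]. rewrite Cnorm_RtoC. lra. }
    assert (HDi : Cnorm (Cinv D) = / Cnorm D).
    { apply (Rmult_eq_reg_l (Cnorm D)); [|lra]. rewrite <- Cnorm_mul, Rinv_r by lra.
      replace (D * Cinv D)%Cx with C1; [apply Cnorm_1|].
      field. intros E. rewrite E, Cnorm_0 in HD0. lra. }
    rewrite HDi.
    assert (Hstep : Cnorm (a + RtoC (INR n - INR k))%Cx * / Cnorm D <= 2 ^ (Nat.min (S k) k0 - Nat.min k k0)).
    { apply (Rmult_le_reg_r (Cnorm D)); [exact HD0|].
      rewrite Rmult_assoc, Rinv_l, Rmult_1_r by lra.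
      destruct (le_lt_dec k0 k) as [Hkk|Hkk].
      - rewrite !Nat.min_r by lia. rewrite Nat.sub_diag. simpl.
        apply le_INR in Hkk. unfold Rabs in HN. destruct (Rcase_abs (INR n - INR k)); lra.
      - rewrite !Nat.min_l by lia. replace (S k - k)%nat with 1%nat by lia. simpl.
        unfold Rabs in HN. destruct (Rcase_abs (INR n - INR k)); lra. }
    replace (Nat.min (S k) k0) with (Nat.min k k0 + (Nat.min (S k) k0 - Nat.min k k0))%nat by lia.
    rewrite pow_add. replace (Nat.min k k0 + (Nat.min (S k) k0 - Nat.min k k0) - Nat.min k k0)%nat
      with (Nat.min (S k) k0 - Nat.min k k0)%nat in * by lia.
    apply Rmult_le_compat; [apply Cnorm_ge0| |exact IH|exact Hstep].
    apply Rmult_le_pos; [apply Cnorm_ge0|]. apply Rlt_le, Rinv_0_lt_compat, HD0.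
Qed.

Lemma normalized_pair_bound_Z (a c : Cx) (k0 n k : nat) :
  2 * (Cnorm a + Cnorm c) <= INR k0 -> (k0 <= n)%nat ->
  Cnorm (normalized_pair a c n (Z.of_nat k)) <= 2 ^ k0 /\
  Cnorm (normalized_pair a c n (- Z.of_nat k)) <= 2 ^ k0.
Proof.
  intros H1 H2.
  assert (Hp : 2 ^ Nat.min k k0 <= 2 ^ k0) by (apply Rle_pow; [lra|lia]).
  split; [|rewrite normalized_pair_opp]; eapply Rle_trans; try exact Hp;
    apply normalized_pair_bound; lra || lia.
Qed.

Lemma linear_fractional_cv (a c : Cx) (x y : R) :
  C_cv (fun n => Cdiv (a + RtoC (INR n + x))%Cx (c + RtoC (INR n + y))%Cx) C1.
Proof.
  replace C1 with ((1 + (a + RtoC x) * RtoC 0) / (1 + (c + RtoC y) * RtoC 0))%Cx.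
  2:{ change (RtoC 0) with C0. field. replace (1 + (c + RtoC y) * 0)%Cx with C1 by ring.
      exact C1_neq_C0. }
  assert (Hcv : forall b, C_cv (fun n => (1 + b * RtoC (/ INR n))%Cx) (1 + b * RtoC 0)%Cx).
  { intros b. apply C_cv_add; [apply C_cv_const|]. apply C_cv_mul; [apply C_cv_const|].
    apply C_cv_RtoC, is_lim_seq_inv_INR. }
  destruct (INR_unbounded (Cnorm c + Rabs y)) as [N HN].
  apply (C_cv_ext_loc (fun n => ((1 + (a + RtoC x) * RtoC (/ INR n)) /
                                 (1 + (c + RtoC y) * RtoC (/ INR n)))%Cx) _ _ (S N)).
  - intros n Hn. assert (Hn0 : 0 < INR n) by (apply lt_0_INR; lia).
    assert (HNn : INR N <= INR n) by (apply le_INR; lia).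
    rewrite RtoC_inv, !RtoC_plus by lra.
    assert (Hn' : RtoC (INR n) <> C0) by (apply RtoC_neq; lra).
    assert (Hd : (c + (RtoC (INR n) + RtoC y))%Cx <> C0).
    { apply Re_pos_neq0. simpl. pose proof (fst_ge_opp_Cnorm c).
      pose proof (Rle_abs (- y)) as H1. rewrite Rabs_Ropp in H1. lra. }
    field. now split.
  - apply C_cv_div; auto. change (RtoC 0) with C0.
    replace (1 + (c + RtoC y) * 0)%Cx with C1 by ring. exact C1_neq_C0.
Qed.

Lemma normalized_pair_cv_nat (a c : Cx) (k : nat) :
  C_cv (fun n => normalized_pair a c n (Z.of_nat k)) C1.
Proof.
  destruct (INR_unbounded (Cnorm a + Cnorm c)) as [N HN].
  pose proof (Cnorm_ge0 a) as Ha. pose proof (Cnorm_ge0 c) as Hc.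
  pose proof (fst_ge_opp_Cnorm a). pose proof (fst_ge_opp_Cnorm c).
  assert (Hpos : forall n, (n >= N)%nat -> 0 < fst a + INR (S n) /\ 0 < fst c + INR (S n)).
  { intros n Hn. apply le_INR in Hn. rewrite S_INR. lra. }
  induction k as [|k IH].
  - apply (C_cv_ext_loc (fun _ => C1) _ _ N); [|apply C_cv_const].
    intros n Hn. simpl. symmetry. apply normalized_pair_0; now apply Hpos.
  - replace C1 with (1 * 1)%Cx by ring.
    apply (C_cv_ext_loc (fun n => (normalized_pair a c n (Z.of_nat k) *
      ((a + RtoC (INR n + - INR k)) / (c + RtoC (INR n + (1 + INR k)))))%Cx) _ _ N).
    + intros n Hn. rewrite normalized_pair_S by now apply Hpos.
      rewrite (Rplus_assoc (INR n)). reflexivity.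
    + apply C_cv_mul; [exact IH|apply linear_fractional_cv].
Qed.

Lemma normalized_pair_cv (a c : Cx) (l : Z) : C_cv (fun n => normalized_pair a c n l) C1.
Proof.
  destruct (Z_le_gt_dec 0 l) as [Hl|Hl].
  - rewrite <- (Z2Nat.id l Hl). apply normalized_pair_cv_nat.
  - replace l with (- (- l))%Z by lia. rewrite <- (Z2Nat.id (- l)%Z) by lia.
    apply (C_cv_ext (fun n => normalized_pair c a n (Z.of_nat (Z.to_nat (- l))))).
    + intros n. now rewrite normalized_pair_opp.
    + apply normalized_pair_cv_nat.
Qed.

(** Tannery's theorem with the majorant 2^k0 M/k^2. The limiting series is left unevaluated: what
    counts is that it depends on [b] and [d] only. *)
Lemma dougall_sum_normalized_cv (a b c d : Cx) : 3 <= fst b + fst d ->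
  C_cv (fun n => Cmul (Cinv (rgamma (a + RtoC (INR (S n))) * rgamma (c + RtoC (INR (S n)))))
                      (dougall_sum (a + RtoC (INR (S n))) b (c + RtoC (INR (S n))) d))
       (Clim (bsum (pair_term b d))).
Proof.
  intros Hbd. destruct (pair_term_decay b d Hbd) as [M [HM HU]].
  pose proof (Cnorm_ge0 a) as Ha. pose proof (Cnorm_ge0 c) as Hc.
  pose proof (fst_ge_opp_Cnorm a). pose proof (fst_ge_opp_Cnorm c).
  destruct (INR_unbounded (2 * (Cnorm a + Cnorm c) + 1)) as [k0 Hk0].
  assert (H2 : 1 <= 2 ^ k0) by (apply pow_R1_Rle; lra).
  set (T := fun n l => (normalized_pair a c n l * pair_term b d l)%Cx).
  apply (bsum_tannery T (pair_term b d) _ _ (2 ^ k0 * M) k0).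
  - apply Rmult_lt_0_compat; lra.
  - intros n Hn k Hk. destruct (HU k Hk) as [HU1 HU2].
    destruct (normalized_pair_bound_Z a c k0 n k) as [Hb1 Hb2]; [lra|lia|].
    unfold T. rewrite !Cnorm_mul.
    replace (2 ^ k0 * M / (INR k * INR k)) with (2 ^ k0 * (M / (INR k * INR k)))
      by (unfold Rdiv; ring).
    split; apply Rmult_le_compat; auto using Cnorm_ge0.
  - intros k Hk. destruct (HU k Hk) as [HU1 HU2].
    assert (0 <= M / (INR k * INR k)).
    { eapply Rle_trans; [apply Cnorm_ge0|exact HU1]. }
    replace (2 ^ k0 * M / (INR k * INR k)) with (2 ^ k0 * (M / (INR k * INR k)))
      by (unfold Rdiv; ring).
    split; nra.
  - intros l. replace (pair_term b d l) with (1 * pair_term b d l)%Cx by ring.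
    apply C_cv_mul; [apply normalized_pair_cv|apply C_cv_const].
  - intros n Hn. apply le_INR in Hn.
    set (A := (a + RtoC (INR (S n)))%Cx). set (C := (c + RtoC (INR (S n)))%Cx).
    apply (C_cv_ext (fun K => (Cinv (rgamma A * rgamma C) * bsum (dougall_term A b C d) K)%Cx)).
    + intros K. rewrite <- bsum_scal. apply bsum_ext. intros l.
      unfold T, normalized_pair, dougall_term. fold A C. ring.
    + apply C_cv_mul; [apply C_cv_const|]. apply dougall_sum_cv.
      unfold A, C. rewrite S_INR. simpl fst. lra.
  - exact (bsum_cv _ M HM HU).
Qed.

(** The two factors whose arguments grow like 2n are compared with [gauss_scale] at index 2n, the
    others at index n. The factorials and the powers of n cancel, and the mismatch of the exponents
    at 2n leaves 2^(b+d-2). *)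
Lemma dougall_value_normalized_cv (a b c d : Cx) :
  C_cv (fun n => Cmul (Cinv (rgamma (a + RtoC (INR (S n))) * rgamma (c + RtoC (INR (S n)))))
                      (dougall_value (a + RtoC (INR (S n))) b (c + RtoC (INR (S n))) d))
       (Cexp ((b + d - (1 + 1)) * RtoC (ln 2)) * rgamma (b + d - 1))%Cx.
Proof.
  set (G := fun x n => (rgamma (x + RtoC (INR (S n))) * gauss_scale x n)%Cx).
  set (E := Cexp ((b + d - (1 + 1)) * RtoC (ln 2))).
  set (s := (a + b + c + d - (1 + 1))%Cx).
  apply (C_cv_ext_loc (fun n =>
    ((G (a + c) (2 * n)%nat * G (a + d - 1) n * G (b + c - 1) n) /
     (G s (2 * n)%nat * G a n * G c n) * (E * rgamma (b + d - 1)))%Cx) _ _ 1).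
  - intros n Hn. assert (Hn0 : 0 < INR n) by (apply lt_0_INR; lia).
    unfold G, dougall_value, Gamma.
    assert (HS2 : RtoC (INR (S (2 * n))) = (RtoC (INR n) + RtoC (INR n) + 1)%Cx).
    { change C1 with (RtoC 1). rewrite <- !RtoC_plus. f_equal.
      rewrite S_INR, mult_INR. simpl (INR 2). ring. }
    rewrite HS2, S_INR, RtoC_plus. change (RtoC 1) with C1. set (y := RtoC (INR n)).
    replace (a + (y + 1) + b + (c + (y + 1)) + d - (1 + 1 + 1))%Cx with (s + (y + y + 1))%Cx
      by (unfold s; ring).
    replace (a + (y + 1) + (c + (y + 1)) - 1)%Cx with (a + c + (y + y + 1))%Cx by ring.
    replace (a + (y + 1) + d - 1)%Cx with (a + d - 1 + (y + 1))%Cx by ring.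
    replace (b + (c + (y + 1)) - 1)%Cx with (b + c - 1 + (y + 1))%Cx by ring.
    assert (HE : (gauss_scale s (2 * n) * gauss_scale a n * gauss_scale c n =
      E * (gauss_scale (a + c) (2 * n) * gauss_scale (a + d - 1) n * gauss_scale (b + c - 1) n))%Cx).
    { unfold gauss_scale, E.
      assert (Hl : RtoC (ln (INR (2 * n))) = (RtoC (ln 2) + RtoC (ln (INR n)))%Cx).
      { rewrite <- RtoC_plus, <- ln_mult by lra. rewrite mult_INR. reflexivity. }
      rewrite Hl. set (L := RtoC (ln (INR n))). set (L2 := RtoC (ln 2)).
      set (f1 := RtoC (INR (fact (2 * n)))). set (f2 := RtoC (INR (fact n))).
      transitivity (f1 * f2 * f2 * (Cexp (s * (L2 + L)) * Cexp (a * L) * Cexp (c * L)))%Cx; [ring|].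
      transitivity (f1 * f2 * f2 * (Cexp ((b + d - (1 + 1)) * L2) * Cexp ((a + c) * (L2 + L)) *
         Cexp ((a + d - 1) * L) * Cexp ((b + c - 1) * L)))%Cx; [|ring].
      f_equal. rewrite <- !Cexp_add. f_equal. unfold s. ring. }
    unfold Cdiv. rewrite !Cinv_mul.
    set (i1 := Cinv (rgamma (s + (y + y + 1)))). set (i2 := Cinv (rgamma (a + (y + 1)))).
    set (i3 := Cinv (rgamma (c + (y + 1)))).
    pose proof (gauss_scale_neq0 s (2 * n)) as N1. pose proof (gauss_scale_neq0 a n) as N2.
    pose proof (gauss_scale_neq0 c n) as N3. pose proof (gauss_scale_neq0 (a + c)%Cx (2 * n)) as N4.
    pose proof (gauss_scale_neq0 (a + d - 1)%Cx n) as N5.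
    pose proof (gauss_scale_neq0 (b + c - 1)%Cx n) as N6.
    replace E with (gauss_scale s (2 * n) * gauss_scale a n * gauss_scale c n /
      (gauss_scale (a + c) (2 * n) * gauss_scale (a + d - 1) n * gauss_scale (b + c - 1) n))%Cx.
    + field. repeat split; assumption.
    + rewrite HE. field. repeat split; assumption.
  - assert (Heq : ((1 * 1 * 1) / (1 * 1 * 1) * (E * rgamma (b + d - 1)))%Cx
                  = (E * rgamma (b + d - 1))%Cx) by (field; exact C1_neq_C0).
    refine (eq_ind _ (C_cv _) _ _ Heq).
    assert (H1 : (1 * 1 * 1)%Cx <> C0) by (replace (1 * 1 * 1)%Cx with C1 by ring; exact C1_neq_C0).
    assert (Hd : forall x, C_cv (fun n => G x (2 * n)%nat) C1).
    { intros x. apply (C_cv_comp (G x) (fun n => (2 * n)%nat)); [intros; lia|].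
      apply rgamma_asymptotic. }
    apply C_cv_mul; [|apply C_cv_const].
    apply C_cv_div; [exact H1| |]; (apply C_cv_mul; [apply C_cv_mul; [apply Hd|]|]);
      apply rgamma_asymptotic.
Qed.

(** The ratio is constant along the joint shifts of [a] and [c], hence equal to its limit, in which
    neither of them occurs. *)
Lemma dougall_ratio_limit (a b c d : Cx) : dougall_region a b c d -> 3 <= fst b + fst d ->
  dougall_ratio a b c d =
  (Clim (bsum (pair_term b d)) / (Cexp ((b + d - (1 + 1)) * RtoC (ln 2)) * rgamma (b + d - 1)))%Cx.
Proof.
  intros HR Hbd.
  apply (C_cv_unique (fun _ => dougall_ratio a b c d)); [apply C_cv_const|].
  assert (Hne : (Cexp ((b + d - (1 + 1)) * RtoC (ln 2)) * rgamma (b + d - 1))%Cx <> C0).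
  { apply Cmul_neq0; [apply Cexp_neq0|]. apply rgamma_neq0; simpl; lra. }
  pose proof (C_cv_div _ _ _ _ Hne (dougall_sum_normalized_cv a b c d Hbd)
    (dougall_value_normalized_cv a b c d)) as H.
  destruct (INR_unbounded (Cnorm a + Cnorm c)) as [N HN].
  pose proof (Cnorm_ge0 a) as Ha. pose proof (Cnorm_ge0 c) as Hc.
  pose proof (fst_ge_opp_Cnorm a). pose proof (fst_ge_opp_Cnorm c).
  revert H. apply (C_cv_ext_loc _ _ _ N). intros n Hn. apply le_INR in Hn.
  rewrite <- (dougall_ratio_shift a b c d (S n) HR). unfold dougall_ratio.
  set (A := (a + RtoC (INR (S n)))%Cx). set (C := (c + RtoC (INR (S n)))%Cx).
  assert (HAC : rgamma A <> C0 /\ rgamma C <> C0).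
  { split; apply rgamma_neq0; unfold A, C; rewrite S_INR; simpl fst; lra. }
  assert (HV : dougall_value A b C d <> C0).
  { apply dougall_value_neq0. unfold A, C, dougall_region in *. rewrite S_INR. simpl fst.
    pose proof (pos_INR n). lra. }
  field. intuition.
Qed.

(** For l nonzero, one of 1 - l and 1 + l is a pole of Gamma. *)
Lemma dougall_sum_terminating (b d : Cx) : dougall_sum C1 b C1 d = (rgamma b * rgamma d)%Cx.
Proof.
  apply Clim_eq. apply (C_cv_ext (fun _ => (rgamma b * rgamma d)%Cx)); [|apply C_cv_const].
  intros K.
  assert (Hz : forall k, pair_term 1 1 (Z.of_nat (S k)) = C0 /\ pair_term 1 1 (- Z.of_nat (S k)) = C0).
  { intros k. unfold pair_term.
    rewrite opp_IZR, <- INR_IZR_INZ, S_INR.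
    assert (E : (1 - RtoC (INR k + 1))%Cx = RtoC (- INR k)).
    { rewrite RtoC_plus, RtoC_opp. change (RtoC 1) with C1. ring. }
    assert (E' : (1 + RtoC (- (INR k + 1)))%Cx = RtoC (- INR k)).
    { rewrite !RtoC_opp, RtoC_plus. change (RtoC 1) with C1. ring. }
    rewrite E, E', rgamma_nonpos. split; ring. }
  induction K as [|K IH].
  - simpl. unfold dougall_term, pair_term. change (RtoC 0) with C0.
    replace (1 - 0)%Cx with C1 by ring. replace (1 + 0)%Cx with C1 by ring.
    replace (b - 0)%Cx with b by ring. replace (d + 0)%Cx with d by ring.
    rewrite rgamma_1. ring.
  - cbn [bsum]. rewrite <- IH. destruct (Hz K) as [H1 H2].
    unfold dougall_term. rewrite H1, H2. ring.
Qed.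

(** The lower bounds on [b] and [d] put (1, b, 1, d) in the region too, so that the limit formula,
    used in both directions, carries the ratio to a = c = 1. *)
Lemma dougall_ratio_large (a b c d : Cx) : dougall_region a b c d ->
  2 <= fst b -> 2 <= fst d -> dougall_ratio a b c d = C1.
Proof.
  intros HR Hb Hd. rewrite dougall_ratio_limit by (assumption || lra).
  assert (HR1 : dougall_region C1 b C1 d) by (unfold dougall_region; simpl; lra).
  rewrite <- (dougall_ratio_limit C1 b C1 d) by (assumption || lra).
  unfold dougall_ratio. rewrite dougall_sum_terminating.
  unfold dougall_value, Gamma. replace (1 + 1 - 1)%Cx with C1 by ring.
  replace (1 + b + 1 + d - (1 + 1 + 1))%Cx with (b + d - 1)%Cx by ring.
  replace (1 + d - 1)%Cx with d by ring. replace (b + 1 - 1)%Cx with b by ring.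
  rewrite rgamma_1.
  assert (rgamma (b + d - 1) <> C0) by (apply rgamma_neq0; simpl; lra).
  assert (rgamma b <> C0) by (apply rgamma_neq0; lra).
  assert (rgamma d <> C0) by (apply rgamma_neq0; lra).
  field. repeat split; auto using C1_neq_C0.
Qed.

Theorem dougall (a b c d : Cx) : dougall_region a b c d ->
  C_cv (bsum (dougall_term a b c d)) (dougall_value a b c d).
Proof.
  intros HR.
  assert (H1 : dougall_ratio a b c d = C1).
  { destruct (INR_unbounded (2 - fst b + (2 - fst d) + Rabs (2 - fst b) + Rabs (2 - fst d))) as [n Hn].
    pose proof (Rle_abs (2 - fst b)). pose proof (Rle_abs (2 - fst d)).
    pose proof (Rle_abs (- (2 - fst b))) as H3. pose proof (Rle_abs (- (2 - fst d))) as H4.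
    rewrite Rabs_Ropp in H3, H4.
    rewrite dougall_ratio_swap, <- (dougall_ratio_shift b a d c n), dougall_ratio_swap.
    - apply dougall_ratio_large; unfold dougall_region in *; simpl fst in *; lra.
    - unfold dougall_region in *; lra. }
  replace (dougall_value a b c d) with (dougall_sum a b c d).
  - apply dougall_sum_cv. unfold dougall_region in HR. lra.
  - pose proof (dougall_value_neq0 _ _ _ _ HR) as H0.
    replace (dougall_sum a b c d) with (dougall_ratio a b c d * dougall_value a b c d)%Cx
      by (unfold dougall_ratio; field; exact H0).
    rewrite H1. ring.
Qed.

(** * Unconditional summation of nonnegative terms *)

Lemma Rsum_le_of_incl {T : Type} (G : T -> R) (l l' : list T) :
  NoDup l -> (forall x, In x l -> G x = 0 \/ In x l') -> (forall x, In x l' -> 0 <= G x) ->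
  Rsum (map G l) <= Rsum (map G l').
Proof.
  intros Hl. revert l'. induction Hl as [|x l Hx Hl IH]; intros l' Hin Hpos.
  - unfold Rsum; simpl. induction l' as [|y l' IH']; simpl; [lra|].
    pose proof (Hpos y (or_introl eq_refl)). specialize (IH' ltac:(intros z []) ).
    assert (0 <= fold_right Rplus 0 (map G l')) by (apply IH'; intros z Hz; apply Hpos; now right).
    lra.
  - destruct (Hin x (or_introl eq_refl)) as [H0|Hx'].
    + simpl. unfold Rsum in *; simpl. rewrite H0, Rplus_0_l.
      apply IH; [|exact Hpos]. intros y Hy; apply Hin; now right.
    + apply in_split in Hx'. destruct Hx' as (l1 & l2 & ->).
      assert (H : Rsum (map G l) <= Rsum (map G (l1 ++ l2))).
      { apply IH.
        - intros y Hy. destruct (Hin y (or_intror Hy)) as [H|H]; [now left|right].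
          apply in_app_iff in H. apply in_app_iff. destruct H as [H|[->|H]]; auto. contradiction.
        - intros y Hy. apply Hpos. apply in_app_iff in Hy. apply in_app_iff. simpl. tauto. }
      rewrite map_app, Rsum_app in *. simpl. unfold Rsum in *; simpl in *. lra.
Qed.

(** By nonnegativity, a finite set containing [B K] has at least the sum over [B K], which is close
    to s. Up to zero terms it lies in all later [B K'], so its sum cannot exceed the limit s. *)
Lemma exhaustion_sum {T : Type} (P : T -> Prop) (G : T -> R) (B : nat -> list T) (s : R) :
  (forall x, P x -> 0 <= G x) ->
  (forall K, NoDup (B K)) -> (forall K x, In x (B K) -> P x) ->
  (forall x, P x -> G x = 0 \/ exists K0, forall K, (K >= K0)%nat -> In x (B K)) ->
  is_lim_seq (fun K => Rsum (map G (B K))) s ->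
  forall eps, eps > 0 -> exists F0, (forall x, In x F0 -> P x) /\
    forall F, NoDup F -> (forall x, In x F -> P x) -> incl F0 F ->
    Rabs (Rsum (map G F) - s) < eps.
Proof.
  intros HG HB HBP Hex Hlim eps Heps. pose proof (proj1 (is_lim_seq_eps _ _) Hlim) as Hlim'. clear Hlim; rename Hlim' into Hlim.
  destruct (Hlim eps Heps) as [K HK]. exists (B K). split; [apply HBP|].
  intros F HF HFP Hincl.
  assert (Hlow : Rsum (map G (B K)) <= Rsum (map G F)).
  { apply Rsum_le_of_incl; [apply HB| |].
    - intros x Hx; right; now apply Hincl.
    - intros x Hx; now apply HG, HFP. }
  assert (Hlarge : exists K1, forall K', (K' >= K1)%nat -> forall x, In x F -> G x = 0 \/ In x (B K')).
  { clear Hincl Hlow HF. induction F as [|x F IH].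
    - exists 0%nat. intros K' _ x [].
    - destruct IH as [K1 HK1]; [intros y Hy; apply HFP; now right|].
      destruct (Hex x (HFP x (or_introl eq_refl))) as [H0|[K2 HK2]].
      + exists K1. intros K' HK' y [<-|Hy]; [now left|now apply HK1].
      + exists (max K1 K2). intros K' HK' y [<-|Hy]; [right; apply HK2; lia|apply HK1; [lia|exact Hy]]. }
  destruct Hlarge as [K1 HK1].
  assert (Hup : Rsum (map G F) <= s).
  { apply Rnot_lt_le. intros Hlt.
    destruct (Hlim (Rsum (map G F) - s)) as [K2 HK2]; [lra|].
    specialize (HK2 (max K1 K2) ltac:(lia)).
    assert (Rsum (map G F) <= Rsum (map G (B (max K1 K2)))).
    { apply Rsum_le_of_incl; [exact HF| |].
      - apply HK1; lia.
      - intros x Hx. apply HG, (HBP _ _ Hx). }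
    apply Rabs_def2 in HK2. lra. }
  specialize (HK K (Nat.le_refl K)). apply Rabs_def2 in HK. apply Rabs_def1; lra.
Qed.

(** * Boxes of interlacing signatures *)

Lemma In_choices {T : Type} (d : T) (Is : list (list T)) (x : list T) :
  In x (choices Is) <->
  length x = length Is /\ forall i, (i < length Is)%nat -> In (nth i x d) (nth i Is nil).
Proof.
  revert x. induction Is as [|J Is IH]; intros x; simpl.
  - split.
    + intros [<-|[]]. split; [reflexivity|]. intros; lia.
    + intros [H _]. left. now destruct x.
  - rewrite in_flat_map. split.
    + intros (t & Ht & Hx). apply in_map_iff in Hx. destruct Hx as (y & <- & Hy).
      apply IH in Hy. destruct Hy as [Hl Hn]. simpl. split; [now rewrite Hl|].
      intros [|i] Hi; [exact Ht|]. apply Hn; lia.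
    + intros [Hl Hn]. destruct x as [|t y]; [discriminate|].
      exists t. split; [apply (Hn 0%nat); lia|]. apply in_map. apply IH.
      simpl in Hl. split; [lia|]. intros i Hi. apply (Hn (S i)); lia.
Qed.

Lemma NoDup_choices {T : Type} (Is : list (list T)) :
  (forall J, In J Is -> NoDup J) -> NoDup (choices Is).
Proof.
  induction Is as [|J Is IH]; intros H; simpl.
  - constructor; [intros []|constructor].
  - assert (HIs : NoDup (choices Is)) by (apply IH; intros J' HJ'; apply H; now right).
    assert (HJ : NoDup J) by (apply H; now left). clear H IH.
    induction HJ as [|t J Ht HJ IHJ]; simpl; [constructor|].
    apply NoDup_app.
    + apply Injective_map_NoDup; [|exact HIs]. intros a b E; now injection E.
    + exact IHJ.
    + intros x Hx Hx'. apply in_map_iff in Hx. destruct Hx as (y & <- & _).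
      apply in_flat_map in Hx'. destruct Hx' as (t' & Ht' & Hy).
      apply in_map_iff in Hy. destruct Hy as (y' & E & _). injection E as -> _. contradiction.
Qed.

Lemma NoDup_box (n : nat) (m : nat -> Z) (K : nat) : NoDup (box n m K).
Proof.
  apply NoDup_choices. intros J HJ. apply in_map_iff in HJ.
  destruct HJ as (i & <- & _). apply NoDup_zrange.
Qed.

Lemma In_box (n : nat) (m : nat -> Z) (K : nat) (x : list Z) :
  In x (box n m K) <-> length x = S n /\ forall i, (i <= n)%nat ->
    (cutoff n m K (S i) + Z.of_nat (S i) <= nth i x 0 < cutoff n m K i + Z.of_nat (S i))%Z.
Proof.
  unfold box. rewrite (In_choices 0%Z), length_map, length_seq.
  assert (E : forall i, (i < S n)%nat ->
    nth i (map (fun i => zrange (cutoff n m K (S i) + Z.of_nat (S i))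
                                (cutoff n m K i + Z.of_nat (S i))) (seq 0 (S n))) nil
    = zrange (cutoff n m K (S i) + Z.of_nat (S i)) (cutoff n m K i + Z.of_nat (S i))).
  { intros i Hi.
    set (F := fun i => zrange (cutoff n m K (S i) + Z.of_nat (S i)) (cutoff n m K i + Z.of_nat (S i))).
    rewrite (nth_indep _ nil (F 0%nat)) by (rewrite length_map, length_seq; exact Hi).
    rewrite (map_nth F), seq_nth by exact Hi. reflexivity. }
  split; intros [Hl H]; (split; [exact Hl|]); intros i Hi.
  - specialize (H i ltac:(lia)). rewrite E in H by lia. now apply In_zrange in H.
  - rewrite E by lia. apply In_zrange. apply H. lia.
Qed.

Definition shifted (lam : list Z) (i : nat) : Z := (sigc lam i - Z.of_nat i)%Z.

Lemma sigc_S (nu : list Z) (i : nat) : sigc nu (S i) = nth i nu 0%Z.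
Proof. unfold sigc. f_equal. lia. Qed.

Lemma interlacebP (n : nat) (lam nu : list Z) :
  interlaceb (S n) lam nu = true <->
  forall i, (1 <= i <= n)%nat -> (sigc nu (S i) <= sigc lam i <= sigc nu i)%Z.
Proof.
  unfold interlaceb. rewrite forallb_forall. split; intros H i Hi.
  - specialize (H i). rewrite in_seq in H. specialize (H ltac:(lia)).
    apply Bool.andb_true_iff in H. lia.
  - apply in_seq in Hi. specialize (H i ltac:(lia)). apply Bool.andb_true_iff. lia.
Qed.

(** The strict bound l_(i+1) < m_i means nu_(i+1) <= lambda_i, since the index shift grows by one.
    Interlacing then forces the tuple to be nonincreasing. *)
Lemma box_interlacing (n : nat) (lam : list Z) (K : nat) (x : list Z) :
  In x (box n (shifted lam) K) -> is_signature (S n) x /\ interlaceb (S n) lam x = true.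
Proof.
  intros Hx. apply In_box in Hx. destruct Hx as [Hl H].
  assert (Hint : interlaceb (S n) lam x = true).
  { apply interlacebP. intros i Hi. pose proof (H i ltac:(lia)) as H1.
    destruct i as [|i]; [lia|]. pose proof (H i ltac:(lia)) as H2.
    revert H1 H2. unfold cutoff, shifted. rewrite !sigc_S.
    destruct (Nat.leb_spec (S i) n); lia. }
  split; [|exact Hint]. split; [exact Hl|]. intros i Hi.
  apply interlacebP with (i := i) in Hint; lia.
Qed.

Lemma interlacing_box (n : nat) (lam : list Z) (x : list Z) :
  is_signature (S n) x -> interlaceb (S n) lam x = true ->
  exists K0, forall K, (K >= K0)%nat -> In x (box n (shifted lam) K).
Proof.
  intros [Hl _] Hint.
  (* The summand n + 1 covers the difference between nu and l at the last coordinate. *)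
  exists (Z.to_nat (Z.abs (nth 0 x 0%Z) + Z.abs (nth n x 0%Z) + Z.of_nat (S n))).
  intros K HK. apply In_box. split; [exact Hl|]. intros i Hi.
  pose proof (proj1 (interlacebP n lam x) Hint) as H. split.
  - unfold cutoff, shifted. destruct (Nat.leb_spec (S i) n).
    + specialize (H (S i) ltac:(lia)). rewrite !sigc_S in *. lia.
    + replace i with n by lia. lia.
  - destruct i as [|i]; unfold cutoff, shifted; [lia|].
    destruct (Nat.leb_spec (S i) n); [|lia].
    specialize (H (S i) ltac:(lia)). rewrite !sigc_S in *. lia.
Qed.

(** * The dimension as a Vandermonde product *)

Lemma Rprod_map_div {T : Type} (f g : T -> R) (l : list T) :
  Rprod (map (fun i => f i / g i) l) = Rprod (map f l) / Rprod (map g l).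
Proof.
  induction l as [|x l IH]; simpl; [field|].
  unfold Rprod in *; simpl. rewrite IH. unfold Rdiv. rewrite Rinv_mult. ring.
Qed.

Lemma Rprod_map_ext {T : Type} (f g : T -> R) (l : list T) :
  (forall i, In i l -> f i = g i) -> Rprod (map f l) = Rprod (map g l).
Proof. intros H. f_equal. now apply map_ext_in. Qed.

Lemma Rprod_map_pos {T : Type} (f : T -> R) (l : list T) :
  (forall i, In i l -> 0 < f i) -> 0 < Rprod (map f l).
Proof.
  intros H. unfold Rprod. induction l as [|x l IH]; simpl; [lra|].
  apply Rmult_lt_0_compat; [apply H; now left|]. apply IH. intros i Hi; apply H; now right.
Qed.

Lemma Rprod_map_ge0 {T : Type} (f : T -> R) (l : list T) :
  (forall i, In i l -> 0 <= f i) -> 0 <= Rprod (map f l).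
Proof.
  intros H. unfold Rprod. induction l as [|x l IH]; simpl; [lra|].
  apply Rmult_le_pos; [apply H; now left|]. apply IH. intros i Hi; apply H; now right.
Qed.

(** The product of j - i over i < j < n, which equals 0! 1! ... (n-1)!: the denominator of the
    dimension. *)
Definition superfactorial (n : nat) : R := vandermonde n (fun i => - INR i).

Lemma vandermonde_ext (n : nat) (u v : nat -> R) :
  (forall i j, (i < j < n)%nat -> u i - u j = v i - v j) -> vandermonde n u = vandermonde n v.
Proof.
  intros H. unfold vandermonde. apply Rprod_map_ext. intros i Hi. apply Rprod_map_ext.
  intros j Hj. apply in_seq in Hi, Hj. apply H. lia.
Qed.

Lemma vandermonde_pos (n : nat) (v : nat -> R) :
  (forall i j, (i < j < n)%nat -> v j < v i) -> 0 < vandermonde n v.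
Proof.
  intros H. apply Rprod_map_pos. intros i Hi. apply Rprod_map_pos. intros j Hj.
  apply in_seq in Hi, Hj. specialize (H i j ltac:(lia)). lra.
Qed.

Lemma superfactorial_pos (n : nat) : 0 < superfactorial n.
Proof.
  apply vandermonde_pos. intros i j H. assert (INR i < INR j) by (apply lt_INR; lia). lra.
Qed.

Lemma vandermonde_S (n : nat) (v : nat -> R) :
  vandermonde (S n) v =
  Rprod (map (fun j => v 0%nat - v j) (seq 1 n)) * vandermonde n (fun i => v (S i)).
Proof.
  unfold vandermonde at 1. change (seq 0 (S n)) with (0%nat :: seq 1 n). cbn [map].
  replace (S n - 1)%nat with n by lia. unfold Rprod at 1. cbn [fold_right]. apply f_equal.
  unfold vandermonde. rewrite <- (seq_shift n 0), map_map. apply Rprod_map_ext. intros i Hi.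
  rewrite <- (seq_shift _ (S i)), map_map. reflexivity.
Qed.

Lemma Rprod_seq_fact (n : nat) : Rprod (map INR (seq 1 n)) = INR (fact n).
Proof.
  induction n as [|n IH]; [reflexivity|].
  rewrite seq_S, map_app, fact_simpl, mult_INR, <- IH. change (1 + n)%nat with (S n).
  generalize (map INR (seq 1 n)). unfold Rprod. induction l as [|x l IHl]; cbn [app fold_right map].
  - ring.
  - cbn [map] in IHl. rewrite IHl. ring.
Qed.

Lemma superfactorial_S (n : nat) : superfactorial (S n) = superfactorial n * INR (fact n).
Proof.
  unfold superfactorial at 1. rewrite vandermonde_S, Rmult_comm. f_equal.
  - apply vandermonde_ext. intros i j _. rewrite !S_INR. ring.
  - rewrite <- Rprod_seq_fact. apply Rprod_map_ext. intros j _. simpl (INR 0). ring.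
Qed.

(** The coordinate l_(i+1), indexed from 0; [shifted] is its counterpart indexed from 1. *)
Definition particle (nu : list Z) (i : nat) : Z := (nth i nu 0 - Z.of_nat (S i))%Z.

Lemma particle_shifted (nu : list Z) (i : nat) : particle nu i = shifted nu (S i).
Proof. unfold particle, shifted. now rewrite sigc_S. Qed.

Lemma Dim_vandermonde (N : nat) (nu : list Z) :
  Dim N nu = vandermonde N (fun i => IZR (particle nu i)) / superfactorial N.
Proof.
  unfold Dim, superfactorial, vandermonde. rewrite <- seq_shift, map_map.
  rewrite <- Rprod_map_div. apply Rprod_map_ext. intros i Hi.
  rewrite <- Rprod_map_div, <- seq_shift, map_map. apply Rprod_map_ext. intros j Hj.
  unfold particle. rewrite !sigc_S, !minus_IZR, <- !INR_IZR_INZ, !S_INR.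
  f_equal; ring.
Qed.

Lemma particle_decreasing (N : nat) (nu : list Z) : is_signature N nu ->
  forall i j, (i < j < N)%nat -> (particle nu j < particle nu i)%Z.
Proof.
  intros [_ H] i j [Hij HjN]. induction Hij as [|j Hij IH].
  - specialize (H (S i) ltac:(lia)). unfold particle. rewrite !sigc_S in H. lia.
  - specialize (IH ltac:(lia)). specialize (H (S j) ltac:(lia)).
    unfold particle in *. rewrite !sigc_S in H. lia.
Qed.

Lemma Dim_pos (N : nat) (nu : list Z) : is_signature N nu -> 0 < Dim N nu.
Proof.
  intros H. rewrite Dim_vandermonde. apply Rdiv_lt_0_compat; [|apply superfactorial_pos].
  apply vandermonde_pos. intros i j Hij. apply IZR_lt. now apply (particle_decreasing N).
Qed.

(** * Admissible quadruples *)

Definition nonneg_real (u : Cx) : Prop := snd u = 0 /\ 0 <= fst u.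

Lemma nonneg_real_mul (u v : Cx) : nonneg_real u -> nonneg_real v -> nonneg_real (u * v)%Cx.
Proof.
  intros [H1 H2] [H3 H4]. split; simpl; rewrite H1, H3; [ring|].
  rewrite Rmult_0_l, Rminus_0_r. now apply Rmult_le_pos.
Qed.

Lemma nonneg_real_inv (u : Cx) : nonneg_real u -> nonneg_real (Cinv u).
Proof.
  intros [H1 H2]. split; simpl; rewrite H1; unfold Rdiv; [ring|].
  apply Rmult_le_pos; [exact H2|]. rewrite Rmult_0_l, Rplus_0_r.
  destruct H2 as [H2|<-]; [|rewrite Rmult_0_l, Rinv_0; lra].
  apply Rlt_le, Rinv_0_lt_compat. nra.
Qed.

Lemma nonneg_real_RtoC (u : Cx) : nonneg_real u -> u = RtoC (fst u).
Proof. intros [H _]. apply Cx_ext; [reflexivity|exact H]. Qed.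

Lemma nonneg_real_lim (u : nat -> Cx) (a : Cx) :
  C_cv u a -> (forall n, nonneg_real (u n)) -> nonneg_real a.
Proof.
  intros H Hu. apply C_cv_parts in H. destruct H as [H1 H2]. split.
  - apply is_lim_seq_unique in H2. rewrite (Lim_seq_ext _ (fun _ => 0)) in H2.
    + rewrite Lim_seq_const in H2. now injection H2.
    + intros n. apply Hu.
  - apply (is_lim_seq_le (fun _ => 0) (fun n => fst (u n)) 0 (fst a)); auto.
    + intros n. apply Hu.
    + apply is_lim_seq_const.
Qed.

Definition admissible_pair (a b : Cx) : Prop :=
  forall k : Z, Cpos (Cmul (Cadd a (RtoC (IZR k))) (Cadd b (RtoC (IZR k)))).

Lemma admissible_pair_shift (a b : Cx) (k : Z) : admissible_pair a b ->
  admissible_pair (a + RtoC (IZR k))%Cx (b + RtoC (IZR k))%Cx.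
Proof.
  intros H l. specialize (H (k + l)%Z). rewrite plus_IZR, RtoC_plus in H.
  replace (a + RtoC (IZR k) + RtoC (IZR l))%Cx with (a + (RtoC (IZR k) + RtoC (IZR l)))%Cx by ring.
  replace (b + RtoC (IZR k) + RtoC (IZR l))%Cx with (b + (RtoC (IZR k) + RtoC (IZR l)))%Cx by ring.
  exact H.
Qed.

Lemma admissible_pair_real (a b : Cx) : admissible_pair a b ->
  snd (a + b)%Cx = 0 /\ snd (a * b)%Cx = 0.
Proof.
  intros H. destruct (H 0%Z) as [H0 _]. destruct (H 1%Z) as [H1 _].
  unfold Cim in *. simpl in *. lra.
Qed.

(** If [a] is not real, then [b] is its conjugate and the real parts agree. If both are real and b
    >= a + 1, the integer [up a] lies between them, and the shift by its opposite makes the product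
    nonpositive. *)
Lemma admissible_pair_close (a b : Cx) : admissible_pair a b -> fst b < fst a + 1.
Proof.
  intros H. destruct (admissible_pair_real a b H) as [H1 H2]. simpl in H1, H2.
  destruct (Req_dec (snd a) 0) as [Ha|Ha].
  - apply Rnot_le_lt. intros Hle. destruct (archimed (fst a)) as [Hu1 Hu2].
    destruct (H (- up (fst a))%Z) as [_ Hp]. unfold Cre in Hp. rewrite opp_IZR in Hp. simpl in Hp.
    replace (snd b) with 0 in Hp by lra. nra.
  - assert (E : snd a * (fst b - fst a) = 0).
    { replace (snd b) with (- snd a) in H2 by lra. lra. }
    apply Rmult_integral in E. lra.
Qed.

Lemma admissible_pair_sym (a b : Cx) : admissible_pair a b -> admissible_pair b a.
Proof.
  intros H k. specialize (H k).
  replace ((b + RtoC (IZR k)) * (a + RtoC (IZR k)))%Cx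
    with ((a + RtoC (IZR k)) * (b + RtoC (IZR k)))%Cx by ring. exact H.
Qed.

(** True of Gauss's approximants: the numerators multiply to a product of positive numbers
    (a+k)(b+k), and the denominators to (n!)^2 n^(a+b) with a + b real. The sign survives the
    limit. *)
Lemma rgamma_pair_nonneg (a b : Cx) : admissible_pair a b -> nonneg_real (rgamma a * rgamma b)%Cx.
Proof.
  intros H. apply (nonneg_real_lim (fun n => rgamma_seq a n * rgamma_seq b n)%Cx).
  - apply C_cv_mul; apply rgamma_cv.
  - intros n. rewrite !rgamma_seqE.
    assert (Hris : forall n, nonneg_real (rising a n * rising b n)%Cx).
    { clear n. induction n as [|n IH].
      - unfold rising; simpl. split; simpl; lra.
      - rewrite !rising_S.
        replace (rising a n * (a + RtoC (INR n)) * (rising b n * (b + RtoC (INR n))))%Cx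
          with ((rising a n * rising b n) * ((a + RtoC (INR n)) * (b + RtoC (INR n))))%Cx by ring.
        apply nonneg_real_mul; [exact IH|]. rewrite INR_IZR_INZ.
        destruct (H (Z.of_nat n)) as [H1 H2]. unfold Cim, Cre in *. split; lra. }
    replace (rising a (S n) / gauss_scale a n * (rising b (S n) / gauss_scale b n))%Cx
      with ((rising a (S n) * rising b (S n)) * Cinv (gauss_scale a n * gauss_scale b n))%Cx
      by (rewrite Cinv_mul; unfold Cdiv; ring).
    apply nonneg_real_mul; [apply Hris|]. apply nonneg_real_inv. unfold gauss_scale.
    set (L := RtoC (ln (INR n))).
    replace (RtoC (INR (fact n)) * Cexp (a * L) * (RtoC (INR (fact n)) * Cexp (b * L)))%Cx
      with (RtoC (INR (fact n)) * RtoC (INR (fact n)) * Cexp ((a + b) * L))%Cx.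
    2:{ replace ((a + b) * L)%Cx with (a * L + b * L)%Cx by ring. rewrite Cexp_add. ring. }
    replace ((a + b) * L)%Cx with (RtoC (fst (a + b)%Cx * ln (INR n))).
    2:{ destruct (admissible_pair_real a b H) as [H1 _]. unfold L.
        apply Cx_ext; simpl in *; rewrite H1; ring. }
    rewrite Cexp_RtoC, <- !RtoC_mult. split; [reflexivity|]. cbn [fst RtoC].
    apply Rmult_le_pos; [|apply Rlt_le, exp_pos]. pose proof (pos_INR (fact n)). nra.
Qed.

(** Admissibility couples [a] with [b] and [c] with [d], whereas [pair_term] couples [a] with [c];
    the four factors are regrouped accordingly. *)
Lemma dougall_term_real (a b c d : Cx) : admissible_pair a b -> admissible_pair c d ->
  forall l, dougall_term a b c d l = RtoC (fst (dougall_term a b c d l)) /\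
            0 <= fst (dougall_term a b c d l).
Proof.
  intros H1 H2 l.
  assert (H : nonneg_real (dougall_term a b c d l)).
  { unfold dougall_term, pair_term.
    replace (rgamma (a - RtoC (IZR l)) * rgamma (c + RtoC (IZR l)) *
      (rgamma (b - RtoC (IZR l)) * rgamma (d + RtoC (IZR l))))%Cx with
      ((rgamma (a + RtoC (IZR (- l))) * rgamma (b + RtoC (IZR (- l)))) *
       (rgamma (c + RtoC (IZR l)) * rgamma (d + RtoC (IZR l))))%Cx.
    - apply nonneg_real_mul; apply rgamma_pair_nonneg; now apply admissible_pair_shift.
    - rewrite opp_IZR, RtoC_opp. unfold Csub. ring. }
  split; [now apply nonneg_real_RtoC|apply H].
Qed.

(** The hypothesis on h(l+1) in [lim_box_sum_R]: lowering the level by one lowers [c] and [d] by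
    one, and the step in l costs one factor each from [a] and [b]. *)
Lemma dougall_term_up (a b c d : Cx) (l : Z) :
  dougall_term a b c d (l + 1) =
  (dougall_term a b (c + 1) (d + 1) l *
   ((RtoC (1 + IZR l) * RtoC (1 + IZR l)) - (a + b) * RtoC (1 + IZR l) + a * b))%Cx.
Proof.
  unfold dougall_term, pair_term. rewrite plus_IZR, !RtoC_plus. change (RtoC 1) with C1.
  set (x := RtoC (IZR l)).
  rewrite (rgamma_succ (a - (x + 1))), (rgamma_succ (b - (x + 1))).
  replace (a - (x + 1) + 1)%Cx with (a - x)%Cx by ring.
  replace (b - (x + 1) + 1)%Cx with (b - x)%Cx by ring.
  replace (c + 1 + x)%Cx with (c + (x + 1))%Cx by ring.
  replace (d + 1 + x)%Cx with (d + (x + 1))%Cx by ring. ring.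
Qed.

(** The hypothesis on h(l) in [lim_box_sum_R], with y the level N. *)
Lemma dougall_term_down (a b c d : Cx) (y : R) (l : Z) :
  dougall_term a b (c + RtoC y) (d + RtoC y) l =
  (dougall_term a b (c + RtoC y + 1) (d + RtoC y + 1) l *
   ((RtoC (y + IZR l) * RtoC (y + IZR l)) + (c + d) * RtoC (y + IZR l) + c * d))%Cx.
Proof.
  unfold dougall_term, pair_term. rewrite !RtoC_plus. set (x := RtoC (IZR l)).
  rewrite (rgamma_succ (c + RtoC y + x)), (rgamma_succ (d + RtoC y + x)).
  replace (c + RtoC y + 1 + x)%Cx with (c + RtoC y + x + 1)%Cx by ring.
  replace (d + RtoC y + 1 + x)%Cx with (d + RtoC y + x + 1)%Cx by ring. ring.
Qed.

Lemma zsum_bsum (T : Z -> Cx) (K : nat) :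
  zsum (fun l => fst (T l)) (- Z.of_nat K) (Z.of_nat K + 1) = fst (bsum T K).
Proof.
  induction K as [|K IH].
  - unfold zsum, zrange, Rsum; simpl. ring.
  - cbn [bsum]. simpl fst at 2. rewrite <- IH.
    rewrite (zsum_split _ (- Z.of_nat (S K)) (- Z.of_nat K)) by lia.
    rewrite (zsum_split _ (- Z.of_nat K) (Z.of_nat K + 1) (Z.of_nat (S K) + 1)) by lia.
    assert (H1 : forall g a, zsum g a (a + 1) = g a).
    { intros g a. unfold zsum, zrange, Rsum. replace (a + 1 - a)%Z with 1%Z by lia. simpl.
      rewrite Z.add_0_r. ring. }
    replace (- Z.of_nat K)%Z with (- Z.of_nat (S K) + 1)%Z at 1 by lia.
    replace (Z.of_nat K + 1)%Z with (Z.of_nat (S K)) at 2 by lia.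
    rewrite !H1. simpl. ring.
Qed.

(** With nonnegative terms, the sums from [a] increase with K, and each is contained in a
    sufficiently large symmetric sum, hence is at most D. *)
Lemma ex_lim_zsum_tail (f : Z -> R) (D : R) : (forall l, 0 <= f l) ->
  is_lim_seq (fun K => zsum f (- Z.of_nat K) (Z.of_nat K + 1)) D ->
  forall a, ex_finite_lim_seq (fun K => zsum f a (Z.of_nat K + 1)).
Proof.
  intros Hf HD a.
  assert (Hinc : forall a' b c, (b <= c)%Z -> zsum f a' b <= zsum f a' c).
  { intros a' b c Hbc. destruct (Z_le_gt_dec a' b) as [H|H].
    - rewrite (zsum_split f a' b c) by lia. pose proof (zsum_ge0 f b c Hf). lra.
    - unfold zsum at 1, zrange. replace (Z.to_nat (b - a')) with 0%nat by lia.
      unfold Rsum at 1; simpl. now apply zsum_ge0. }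
  apply (ex_finite_lim_seq_incr _ D).
  - intros K. apply Hinc. lia.
  - intros K.
    pose proof (is_lim_seq_le_loc (fun _ => zsum f a (Z.of_nat K + 1))
      (fun K' => zsum f (- Z.of_nat K') (Z.of_nat K' + 1)) (zsum f a (Z.of_nat K + 1)) D) as Hle. simpl in Hle.
    apply Hle; [|apply is_lim_seq_const|exact HD].
    exists (max K (Z.to_nat (Z.abs a))). intros K' HK'.
    apply Rle_trans with (zsum f a (Z.of_nat K' + 1)); [apply Hinc; lia|].
    rewrite (zsum_split f (- Z.of_nat K') a) by lia.
    pose proof (zsum_ge0 f (- Z.of_nat K') a Hf). lra.
Qed.

(** The power adds j to the exponent 2 - s of the terms, s being the sum of the real parts; j + 3 <=
    s makes the total at most -1. *)
Lemma dougall_term_moment_cv0 (a b c d : Cx) (j : nat) :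
  INR j + 3 <= fst a + fst b + fst c + fst d ->
  is_lim_seq (fun K => fst (dougall_term a b c d (Z.of_nat K + 1)) *
                       pow (- IZR (Z.of_nat K + 1)) j) 0 /\
  is_lim_seq (fun K => fst (dougall_term a b c d (- Z.of_nat K)) *
                       pow (- IZR (- Z.of_nat K)) j) 0.
Proof.
  intros Hs. destruct (dougall_term_bound a b c d) as [M [HM HB]].
  assert (Hmain : forall s, s = 1%Z \/ s = (-1)%Z ->
    is_lim_seq (fun K => fst (dougall_term a b c d (s * Z.of_nat (S K))) *
                         pow (- IZR (s * Z.of_nat (S K))) j) 0).
  { intros s Hs'.
    apply is_lim_seq_abs_0.
    apply (is_lim_seq_le_le_loc (fun _ => 0) _ (fun K => M * 2 ^ j * / INR K)).
    - exists 1%nat. intros K HK. split; [apply Rabs_pos|]. rewrite Rabs_mult.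
      assert (HK1 : 1 <= INR K) by (apply (le_INR 1); lia).
      pose proof (ln_INR_ge0 K HK) as HL.
      pose proof (Rle_trans _ _ _ (Cnorm_fst _) (HB K HK s Hs')) as H1.
      assert (H2 : Rabs (pow (- IZR (s * Z.of_nat (S K))) j) <= 2 ^ j * exp (INR j * ln (INR K))).
      { rewrite <- RPow_abs, Rabs_Ropp, mult_IZR, Rabs_mult, <- INR_IZR_INZ.
        replace (Rabs (IZR s)) with 1.
        2:{ destruct Hs' as [-> | ->]; [now rewrite Rabs_R1|].
            rewrite Rabs_left; lra. }
        rewrite Rmult_1_l, Rabs_right by (apply Rle_ge, pos_INR).
        replace (exp (INR j * ln (INR K))) with (INR K ^ j).
        - rewrite <- Rpow_mult_distr. apply pow_incr. rewrite S_INR. lra.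
        - rewrite <- Rpower_pow by lra. reflexivity. }
      apply Rle_trans with (M * exp ((2 - fst a - fst b - fst c - fst d) * ln (INR K)) *
                            (2 ^ j * exp (INR j * ln (INR K)))).
      { apply Rmult_le_compat; auto using Rabs_pos. }
      replace (M * exp ((2 - fst a - fst b - fst c - fst d) * ln (INR K)) *
                            (2 ^ j * exp (INR j * ln (INR K))))
        with (M * 2 ^ j * exp ((2 - fst a - fst b - fst c - fst d) * ln (INR K) + INR j * ln (INR K)))
        by (rewrite exp_plus; ring).
      apply Rmult_le_compat_l.
      { apply Rmult_le_pos; [lra|]. apply pow_le; lra. }
      rewrite <- (exp_ln (INR K)) at 3 by lra. rewrite <- exp_Ropp.
      assert (Hle : (2 - fst a - fst b - fst c - fst d) * ln (INR K) + INR j * ln (INR K)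
                    <= - ln (INR K)) by nra.
      destruct Hle as [Hlt|Heq]; [apply Rlt_le, exp_increasing, Hlt|rewrite Heq; lra].
    - apply is_lim_seq_const.
    - replace (Rbar.Finite 0) with (Rbar_mult (M * 2 ^ j) 0) by (simpl; f_equal; ring).
      apply is_lim_seq_scal_l, is_lim_seq_inv_INR. }
  split.
    apply (is_lim_seq_ext (fun K => fst (dougall_term a b c d (1 * Z.of_nat (S K))) *
                         pow (- IZR (1 * Z.of_nat (S K))) j)); [|apply Hmain; now left].
    intros K. now replace (1 * Z.of_nat (S K))%Z with (Z.of_nat K + 1)%Z by lia.
  - apply is_lim_seq_incr_1.
    apply (is_lim_seq_ext (fun K => fst (dougall_term a b c d (-1 * Z.of_nat (S K))) *
                         pow (- IZR (-1 * Z.of_nat (S K))) j)); [|apply Hmain; now right].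
    intros K. now replace (-1 * Z.of_nat (S K))%Z with (- Z.of_nat (S K))%Z by lia.
Qed.

(** * Coherence *)

Lemma Rsum_map_scal {T : Type} (c : R) (g : T -> R) (l : list T) :
  Rsum (map (fun x => c * g x) l) = c * Rsum (map g l).
Proof. unfold Rsum. induction l as [|x l IH]; simpl; [ring|]. rewrite IH. ring. Qed.

Lemma Csum_map_scal {T : Type} (c : Cx) (g : T -> R) (h : T -> Cx) (l : list T) :
  (forall x, In x l -> h x = (c * RtoC (g x))%Cx) ->
  Csum (map h l) = (c * RtoC (Rsum (map g l)))%Cx.
Proof.
  intros H. unfold Csum, Rsum. induction l as [|x l IH]; simpl.
  - change (RtoC 0) with C0. ring.
  - rewrite IH by (intros y Hy; apply H; now right). rewrite H by now left.
    rewrite RtoC_plus. ring.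
Qed.

Lemma Cprod_map_RtoC {T : Type} (g : T -> Cx) (r : T -> R) (l : list T) :
  (forall i, In i l -> g i = RtoC (r i)) -> Cprod (map g l) = RtoC (Rprod (map r l)).
Proof.
  intros H. unfold Cprod, Rprod. induction l as [|x l IH]; simpl; [reflexivity|].
  rewrite IH by (intros y Hy; apply H; now right). rewrite H by now left. now rewrite RtoC_mult.
Qed.

(** The leading coefficients multiply to a falling product, while the Gamma recurrence yields a
    rising one; they differ by the order of the factors. *)
Lemma falling_rising (x : R) (n : nat) :
  RtoC (Rprod (map (fun j => x - INR j) (seq 0 n))) = rising (RtoC (x - INR n + 1)) n.
Proof.
  revert x. induction n as [|n IH]; intros x; [reflexivity|].
  change (seq 0 (S n)) with (0%nat :: seq 1 n). rewrite <- seq_shift. cbn [map]. rewrite map_map.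
  unfold Rprod at 1. cbn [fold_right].
  rewrite (map_ext _ (fun j => (x - 1) - INR j)) by (intros j; rewrite S_INR; ring).
  fold (Rprod (map (fun j => x - 1 - INR j) (seq 0 n))).
  rewrite RtoC_mult, IH, rising_S, <- RtoC_plus, S_INR.
  replace (x - 1 - INR n + 1) with (x - (INR n + 1) + 1) by ring.
  replace (x - (INR n + 1) + 1 + INR n) with (x - INR 0) by (simpl (INR 0); ring). ring.
Qed.

Lemma C_cv_bsum_real (T : Z -> Cx) (s : Cx) :
  (forall l, T l = RtoC (fst (T l)) /\ 0 <= fst (T l)) -> C_cv (bsum T) s -> s = RtoC (fst s).
Proof.
  intros H Hs. apply nonneg_real_RtoC. apply (nonneg_real_lim _ _ Hs). intros K.
  assert (HT : forall l, nonneg_real (T l)).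
  { intros l. destruct (H l) as [E H0]. split; [now rewrite E|exact H0]. }
  assert (Hadd : forall u v, nonneg_real u -> nonneg_real v -> nonneg_real (u + v)%Cx).
  { intros u v [H1 H2] [H3 H4]. split; simpl; lra. }
  induction K as [|K IH]; cbn [bsum]; auto.
Qed.

(* The factor that a particle at [l = nu_i - i] contributes to [Mprime] at level [N]. *)
Definition weight_at (z z' w w' : Cx) (N : nat) (l : Z) : R :=
  fst (dougall_term z z' (w + RtoC (INR N) + 1) (w' + RtoC (INR N) + 1) l).

Section Coherence.
Variables (z z' w w' : Cx).
Hypothesis Hz : admissible_pair z z'.
Hypothesis Hw : admissible_pair w w'.
Hypothesis Hsum : fst z + fst z' + fst w + fst w' > -1.

Lemma weight_at_real (N : nat) (l : Z) :
  dougall_term z z' (w + RtoC (INR N) + 1) (w' + RtoC (INR N) + 1) l = RtoC (weight_at z z' w w' N l)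
  /\ 0 <= weight_at z z' w w' N l.
Proof.
  apply dougall_term_real; [exact Hz|].
  replace (w + RtoC (INR N) + 1)%Cx with (w + RtoC (IZR (Z.of_nat (S N))))%Cx.
  2:{ rewrite <- INR_IZR_INZ, S_INR, RtoC_plus. change (RtoC 1) with C1. ring. }
  replace (w' + RtoC (INR N) + 1)%Cx with (w' + RtoC (IZR (Z.of_nat (S N))))%Cx.
  2:{ rewrite <- INR_IZR_INZ, S_INR, RtoC_plus. change (RtoC 1) with C1. ring. }
  now apply admissible_pair_shift.
Qed.

Lemma Mprime_real (N : nat) (nu : list Z) :
  Mprime z z' w w' N nu =
  RtoC (Rprod (map (fun i => weight_at z z' w w' N (particle nu i)) (seq 0 N)) *
        (Dim N nu * Dim N nu)).
Proof.
  unfold Mprime. rewrite (RtoC_mult (Rprod _)). f_equal.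
  rewrite <- seq_shift, map_map. apply Cprod_map_RtoC. intros i _.
  rewrite <- (proj1 (weight_at_real N (particle nu i))).
  unfold Cprod, dougall_term, pair_term, Gamma. cbn [fold_right].
  rewrite !Cinv_mul, !Cinv_Cinv, Cinv_1.
  replace (- IZR (sigc nu (S i)) + INR (S i)) with (- IZR (particle nu i)).
  2:{ unfold particle. rewrite sigc_S, minus_IZR, <- INR_IZR_INZ. ring. }
  replace (INR N + 1 + IZR (sigc nu (S i)) - INR (S i)) with (INR N + 1 + IZR (particle nu i)).
  2:{ unfold particle. rewrite sigc_S, minus_IZR, <- INR_IZR_INZ. ring. }
  rewrite RtoC_opp, !RtoC_plus. change (RtoC 1) with C1.
  set (x := RtoC (IZR (particle nu i))). set (y := RtoC (INR N)).
  replace (w + (y + 1 + x))%Cx with (w + y + 1 + x)%Cx by ring.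
  replace (w' + (y + 1 + x))%Cx with (w' + y + 1 + x)%Cx by ring.
  unfold Csub. ring.
Qed.

Lemma weight_at_down (n : nat) (l : Z) :
  weight_at z z' w w' n l =
  fst (dougall_term z z' (w + RtoC (INR (S n))) (w' + RtoC (INR (S n))) l).
Proof.
  unfold weight_at. rewrite S_INR, RtoC_plus. change (RtoC 1) with C1.
  replace (w + (RtoC (INR n) + 1))%Cx with (w + RtoC (INR n) + 1)%Cx by ring.
  replace (w' + (RtoC (INR n) + 1))%Cx with (w' + RtoC (INR n) + 1)%Cx by ring. reflexivity.
Qed.

Definition total_mass (N : nat) : Cx :=
  dougall_value z z' (w + RtoC (INR N) + 1) (w' + RtoC (INR N) + 1).

(** For real parts, z+z' < 2z+1 and w+w' < 2w+1 by [admissible_pair_close], so -1 < 2(z+w) + 2. With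
    N >= 2 this yields Re(z+w) + N + 1 > 1, as [dougall_region] demands. *)
Lemma sum_close : forall a b, (a = z \/ a = z') -> (b = w \/ b = w') -> fst a + fst b > - 3 / 2.
Proof.
  pose proof (admissible_pair_close z z' Hz).
  pose proof (admissible_pair_close z' z (admissible_pair_sym _ _ Hz)).
  pose proof (admissible_pair_close w w' Hw).
  pose proof (admissible_pair_close w' w (admissible_pair_sym _ _ Hw)).
  intros a b [-> | ->] [-> | ->]; lra.
Qed.

Lemma total_mass_region (n : nat) : (1 <= n)%nat ->
  dougall_region z z' (w + RtoC (INR (S n)) + 1) (w' + RtoC (INR (S n)) + 1).
Proof.
  intros Hn.
  pose proof (sum_close z w (or_introl eq_refl) (or_introl eq_refl)).
  pose proof (sum_close z w' (or_introl eq_refl) (or_intror eq_refl)).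
  pose proof (sum_close z' w (or_intror eq_refl) (or_introl eq_refl)).
  pose proof (sum_close z' w' (or_intror eq_refl) (or_intror eq_refl)).
  apply (le_INR 1) in Hn. change (INR 1) with 1 in Hn.
  unfold dougall_region. rewrite S_INR. simpl. lra.
Qed.

Lemma total_mass_cv (n : nat) : (1 <= n)%nat ->
  C_cv (bsum (dougall_term z z' (w + RtoC (INR (S n)) + 1) (w' + RtoC (INR (S n)) + 1)))
    (total_mass (S n)).
Proof. intros Hn. now apply dougall, total_mass_region. Qed.

Lemma total_mass_neq0 (n : nat) : (1 <= n)%nat -> total_mass (S n) <> C0.
Proof. intros Hn. unfold total_mass. now apply dougall_value_neq0, total_mass_region. Qed.

Definition kappa_product (n : nat) : R :=
  Rprod (map (fun j => fst (z + z')%Cx + fst (w + w')%Cx + 2 * INR (S n) - 2 - INR j) (seq 0 n)).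

(** Every factor exceeds -1 + 2n - (n-1) = n. *)
Lemma kappa_product_pos (n : nat) : (1 <= n)%nat -> 0 < kappa_product n.
Proof.
  intros Hn. apply Rprod_map_pos. intros j Hj. apply in_seq in Hj.
  assert (Hjn : INR (S j) <= INR n) by (apply le_INR; lia). rewrite S_INR in *.
  pose proof (pos_INR j). simpl. lra.
Qed.

Lemma lim_interlacing_sum (n : nat) (lam : list Z) : (1 <= n)%nat -> is_signature n lam ->
  is_lim_seq (fun K => kappa_product n *
      Rsum (map (MinorLimits.interlacing_weight n (weight_at z z' w w' (S n)))
                (box n (shifted lam) K)))
    (fst (total_mass (S n)) *
     (Rprod (map (fun i => weight_at z z' w w' n (particle lam i)) (seq 0 n)) *
      vandermonde n (fun i => IZR (particle lam i)))).
Proof.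
  intros Hn Hlam. pose proof (total_mass_cv n Hn) as Hcv.
  assert (HD : is_lim_seq (fun K => zsum (weight_at z z' w w' (S n)) (- Z.of_nat K) (Z.of_nat K + 1))
                 (fst (total_mass (S n)))).
  { apply C_cv_parts in Hcv. destruct Hcv as [Hcv _]. revert Hcv. apply is_lim_seq_ext.
    intros K. symmetry. apply zsum_bsum. }
  (* The sum on the right exceeds -1 + 2(n+1) = 2n+1, and j + 3 <= n + 2 <= 2n + 1. *)
  assert (Hmom : forall j, lt j n -> INR j + 3 <=
     fst z + fst z' + fst (w + RtoC (INR (S n)))%Cx + fst (w' + RtoC (INR (S n)))%Cx).
  { intros j Hj. assert (Hjn : INR (S j) <= INR n) by (apply le_INR; lia).
    apply (le_INR 1) in Hn. change (INR 1) with 1 in Hn. rewrite S_INR in Hjn |- *. simpl. lra. }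
  pose proof (@MinorLimits.lim_box_sum_R n (weight_at z z' w w' (S n)) (weight_at z z' w w' n)
    (fst (z + z')%Cx) (fst (z * z')%Cx) (fst (w + w')%Cx) (fst (w * w')%Cx)
    (fst (total_mass (S n))) (shifted lam)) as H.
  replace (Rprod (map (fun i => weight_at z z' w w' n (particle lam i)) (seq 0 n)))
    with (Rprod (map (fun i => weight_at z z' w w' n (shifted lam (S i))) (seq 0 n)))
    by (apply Rprod_map_ext; intros; now rewrite particle_shifted).
  replace (vandermonde n (fun i => IZR (particle lam i)))
    with (vandermonde n (fun i => IZR (shifted lam (S i))))
    by (apply vandermonde_ext; intros; now rewrite !particle_shifted).
  apply H; clear H.
  - intros l. rewrite weight_at_down, dougall_term_up, (proj1 (weight_at_real (S n) l)).
    generalize (weight_at z z' w w' (S n) l). intros u. cbn. ring.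
  - intros l. rewrite weight_at_down, dougall_term_down, (proj1 (weight_at_real (S n) l)).
    generalize (weight_at z z' w w' (S n) l), (INR (S n)). intros u y. cbn. ring.
  - intros i Hi1 Hi2. destruct Hlam as [_ Hlam]. specialize (Hlam i ltac:(lia)).
    unfold shifted. lia.
  - intros j Hj. destruct (dougall_term_moment_cv0 z z' (w + RtoC (INR (S n)))
      (w' + RtoC (INR (S n))) j (Hmom j Hj)) as [H _].
    revert H. apply is_lim_seq_ext. intros K. now rewrite weight_at_down.
  - intros j Hj. destruct (dougall_term_moment_cv0 z z' (w + RtoC (INR (S n)))
      (w' + RtoC (INR (S n))) j (Hmom j Hj)) as [_ H].
    revert H. apply is_lim_seq_ext. intros K. now rewrite weight_at_down.
  - apply (ex_lim_zsum_tail _ (fst (total_mass (S n)))); [|exact HD].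
    intros l. apply weight_at_real.
  - exact HD.
Qed.

(** The factor i = N of the normalization, standing for C_N / C_(N-1). *)
Definition last_factor (N : nat) : Cx :=
  let s := RtoC (INR N) in
  Cdiv (Gamma (Cadd (Cadd (Cadd z z') (Cadd w w')) s))
       (Cprod [ Gamma (Cadd (Cadd z w) s); Gamma (Cadd (Cadd z w') s);
                Gamma (Cadd (Cadd z' w) s); Gamma (Cadd (Cadd z' w') s);
                Gamma s ]).

Lemma Cnorming_S (n : nat) :
  Cnorming z z' w w' (S n) = (Cnorming z z' w w' n * last_factor (S n))%Cx.
Proof.
  unfold Cnorming. rewrite seq_S, map_app, Cprod_app. f_equal.
  transitivity (last_factor (S n) * 1)%Cx; [reflexivity|ring].
Qed.

(** Put sigma = z+z'+w+w' and N = n+1. Dougall's value has Gamma(sigma+2N-1) = (sigma+N)_n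
    Gamma(sigma+N), and this Pochhammer symbol is [kappa_product n] read upwards. The factor n!
    compensates the Gamma(N) in the denominator of [last_factor]. *)
Lemma total_mass_factor (n : nat) : (1 <= n)%nat ->
  total_mass (S n) = (last_factor (S n) * RtoC (INR (fact n) * kappa_product n))%Cx.
Proof.
  intros Hn. apply (le_INR 1) in Hn. change (INR 1) with 1 in Hn.
  unfold total_mass, dougall_value, last_factor, kappa_product. cbn zeta.
  destruct (admissible_pair_real z z' Hz) as [Hz1 _].
  destruct (admissible_pair_real w w' Hw) as [Hw1 _].
  set (x := fst (z + z')%Cx + fst (w + w')%Cx + 2 * INR (S n) - 2).
  set (a := ((z + z') + (w + w') + RtoC (INR (S n)))%Cx).
  assert (Ha : RtoC (x - INR n + 1) = a).
  { unfold a, x. rewrite S_INR. apply Cx_ext; simpl in *; lra. }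
  assert (Ha0 : 0 < fst a) by (unfold a; rewrite S_INR; simpl; lra).
  rewrite RtoC_mult, falling_rising, Ha.
  replace (z + z' + (w + RtoC (INR (S n)) + 1) + (w' + RtoC (INR (S n)) + 1) - (1 + 1 + 1))%Cx
    with (a + RtoC (INR n))%Cx.
  2:{ unfold a. rewrite S_INR, RtoC_plus. change (RtoC 1) with C1. ring. }
  unfold Cprod. cbn [fold_right]. rewrite Gamma_nat. unfold Cdiv. rewrite !Cinv_mul, Cinv_1.
  unfold Gamma. rewrite !Cinv_Cinv, (rgamma_rising a n), Cinv_mul.
  set (y := RtoC (INR (S n))).
  replace (z + (w + y + 1) - 1)%Cx with (z + w + y)%Cx by ring.
  replace (z + (w' + y + 1) - 1)%Cx with (z + w' + y)%Cx by ring.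
  replace (z' + (w + y + 1) - 1)%Cx with (z' + w + y)%Cx by ring.
  replace (z' + (w' + y + 1) - 1)%Cx with (z' + w' + y)%Cx by ring.
  assert (Hr : rgamma (a + RtoC (INR n)) <> C0) by (apply rgamma_neq0; change (0 < fst a + INR n); lra).
  pose proof (rising_neq0 a n Ha0). pose proof (RtoC_neq _ (INR_fact_neq_0 n)).
  field. repeat split; auto.
Qed.

Lemma coherence_step (n : nat) (lam : list Z) : (1 <= n)%nat -> is_signature n lam ->
  has_sum (is_signature (S n))
    (fun nu => Cmul (Mzw z z' w w' (S n) nu) (RtoC (Link (S n) nu lam)))
    (Mzw z z' w w' n lam).
Proof.
  intros Hn Hlam eps Heps.
  (* The part of the summand that does not depend on nu, apart from 1/C_N: the numerator of the link
     and the denominator of the one factor Dim nu that survives. *)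
  set (c := Dim n lam / superfactorial (S n)).
  set (W := MinorLimits.interlacing_weight n (weight_at z z' w w' (S n))).
  set (G := fun nu => if interlaceb (S n) lam nu then c * W nu else 0).
  set (k := Cinv (Cnorming z z' w w' (S n))).
  set (H := Rprod (map (fun i => weight_at z z' w w' n (particle lam i)) (seq 0 n))).
  set (V := vandermonde n (fun i => IZR (particle lam i))).
  set (s := c / kappa_product n * (fst (total_mass (S n)) * (H * V))).
  assert (Hkap := kappa_product_pos n Hn).
  assert (Hc : 0 < c) by (apply Rdiv_lt_0_compat; [now apply Dim_pos|apply superfactorial_pos]).
  assert (HVW : forall nu, W nu =
    Rprod (map (fun i => weight_at z z' w w' (S n) (particle nu i)) (seq 0 (S n))) *
    vandermonde (S n) (fun i => IZR (particle nu i))) by reflexivity.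
  assert (Hterm : forall nu, is_signature (S n) nu ->
    (Mzw z z' w w' (S n) nu * RtoC (Link (S n) nu lam))%Cx = (k * RtoC (G nu))%Cx).
  { intros nu Hnu. unfold Mzw, Cdiv. fold k. rewrite Mprime_real.
    replace (RtoC (Rprod (map (fun i => weight_at z z' w w' (S n) (particle nu i)) (seq 0 (S n))) *
      (Dim (S n) nu * Dim (S n) nu)) * k * RtoC (Link (S n) nu lam))%Cx
      with (k * RtoC (Rprod (map (fun i => weight_at z z' w w' (S n) (particle nu i)) (seq 0 (S n))) *
      (Dim (S n) nu * Dim (S n) nu) * Link (S n) nu lam))%Cx by (rewrite RtoC_mult; ring).
    do 2 f_equal. unfold Link, G. destruct (interlaceb (S n) lam nu); [|ring].
    replace (S n - 1)%nat with n by lia. pose proof (Dim_pos _ _ Hnu) as Hd.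
    rewrite HVW. unfold c.
    transitivity (Dim n lam * (Rprod (map (fun i => weight_at z z' w w' (S n) (particle nu i))
      (seq 0 (S n))) * Dim (S n) nu)); [field; lra|].
    rewrite (Dim_vandermonde (S n) nu). field. pose proof (superfactorial_pos (S n)). lra. }
  assert (Htarget : Mzw z z' w w' n lam = (k * RtoC s)%Cx).
  { unfold Mzw, k. rewrite Mprime_real, Cnorming_S. unfold Cdiv. rewrite Cinv_mul. fold H.
    pose proof (total_mass_factor n Hn) as Hf. pose proof (total_mass_neq0 n Hn) as H0.
    rewrite Hf in H0.
    assert (Hl : last_factor (S n) <> C0).
    { intros E. apply H0. rewrite E. ring. }
    (* Here D divided by [kappa_product n] is n! C_N / C_n. This n! reduces [superfactorial (S n)]
       to [superfactorial n], which turns the Vandermonde product [V] into a second factor Dim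
       lambda. *)
    assert (Hs : RtoC s = (RtoC (H * (Dim n lam * Dim n lam)) * last_factor (S n))%Cx).
    { unfold s. rewrite !RtoC_mult.
      rewrite <- (C_cv_bsum_real _ _ (weight_at_real (S n)) (total_mass_cv n Hn)), Hf.
      rewrite (Dim_vandermonde n lam) at 2. fold V. unfold c.
      rewrite superfactorial_S.
      pose proof (superfactorial_pos n). pose proof (INR_fact_lt_0 n).
      rewrite <- !RtoC_mult.
      replace (RtoC (Dim n lam / (superfactorial n * INR (fact n)) / kappa_product n) *
        (last_factor (S n) * RtoC (INR (fact n) * kappa_product n) * RtoC (H * V)))%Cx
        with (RtoC (Dim n lam / (superfactorial n * INR (fact n)) / kappa_product n *
          (INR (fact n) * kappa_product n) * (H * V)) * last_factor (S n))%Cx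
        by (rewrite !RtoC_mult; ring).
      f_equal. f_equal. field. lra. }
    rewrite Hs. set (q := RtoC (H * (Dim n lam * Dim n lam))).
    set (i := Cinv (Cnorming z z' w w' n)). field. exact Hl. }
  assert (HG : forall nu, is_signature (S n) nu -> 0 <= G nu).
  { intros nu Hnu. unfold G. destruct (interlaceb (S n) lam nu); [|lra].
    apply Rmult_le_pos; [lra|]. rewrite HVW. apply Rmult_le_pos.
    - apply Rprod_map_ge0. intros i _. apply weight_at_real.
    - apply Rlt_le, vandermonde_pos. intros i j Hij. apply IZR_lt.
      now apply (particle_decreasing (S n)). }
  (* The added 1 keeps the denominator positive without any knowledge of [k]. *)
  destruct (exhaustion_sum (is_signature (S n)) G (fun K => box n (shifted lam) K) s HG)
    with (eps := eps / (Cnorm k + 1)) as (F0 & HF0 & HF).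
  - intros K. apply NoDup_box.
  - intros K x Hx. now apply box_interlacing in Hx.
  - intros x Hx. unfold G. destruct (interlaceb (S n) lam x) eqn:E; [right|now left].
    now apply interlacing_box.
  - pose proof (is_lim_seq_scal_l _ (c / kappa_product n) _ (lim_interlacing_sum n lam Hn Hlam)) as HL.
    revert HL. apply is_lim_seq_ext. intros K. fold W.
    transitivity (Rsum (map (fun x => c * W x) (box n (shifted lam) K))).
    + rewrite Rsum_map_scal. field. lra.
    + f_equal. apply map_ext_in. intros x Hx. unfold G.
      now rewrite (proj2 (box_interlacing _ _ _ _ Hx)).
  - pose proof (Cnorm_ge0 k). apply Rdiv_lt_0_compat; lra.
  - exists F0. split; [exact HF0|]. intros F HFn HFP Hincl.
    rewrite (Csum_map_scal k G) by (intros x Hx; apply Hterm, HFP, Hx).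
    rewrite Htarget.
    replace (k * RtoC (Rsum (map G F)) - k * RtoC s)%Cx
      with (k * RtoC (Rsum (map G F) - s))%Cx by (rewrite RtoC_minus; ring).
    rewrite Cnorm_mul, Cnorm_RtoC. specialize (HF F HFn HFP Hincl).
    pose proof (Cnorm_ge0 k).
    apply Rle_lt_trans with (Cnorm k * (eps / (Cnorm k + 1))).
    + apply Rmult_le_compat_l; lra.
    + apply (Rmult_lt_reg_r (Cnorm k + 1)); [lra|].
      replace (Cnorm k * (eps / (Cnorm k + 1)) * (Cnorm k + 1)) with (Cnorm k * eps) by (field; lra).
      nra.
Qed.

End Coherence.

Theorem theorem4 (z z' w w' : Cx) :
  admissible z z' w w' ->
  forall (N : nat), (2 <= N)%nat ->
  forall lam : list Z, is_signature (N - 1) lam ->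
    has_sum (is_signature N)
      (fun nu => Cmul (Mzw z z' w w' N nu) (RtoC (Link N nu lam)))
      (Mzw z z' w w' (N - 1) lam).
Proof.
  intros [Hadm Hsum] [|n] HN lam Hlam; [lia|].
  replace (S n - 1)%nat with n in * by lia.
  apply coherence_step; auto; try lia.
  - intros k. apply Hadm.
  - intros k. apply Hadm.
  - unfold Cre in Hsum. simpl in Hsum. lra.
Qed.
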